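(* Let $(M,g)$ and $(\hat M,\hat g)$ be connected, complete, oriented Riemannian manifolds of dimensions $n$ and $\hat n$ with $n<\hat n$. Assume that there exists a complete totally geodesic submanifold $\hat N$ of $\hat M$ of dimension $m$ with $n\le m<\hat n$. Then the rolling system $\Sigma_R$ on $Q(M,\hat M)$ (rolling without spinning nor slipping) is not completely controllable.
   Context: All manifolds are smooth, connected and finite dimensional. $T^*M\otimes T\hat M$ denotes the vector bundle over $M\times\hat M$ whose fiber over $(x,\hat x)$ is the space of linear maps $A:T_xM\to T_{\hat x}\hat M$; its points are written $(x,\hat x;A)$. Since $n<\hat n$, $Q=Q(M,\hat M)\subset T^*M\otimes T\hat M$ is the set of $(x,\hat x;A)$ such that $\hat g(AX,AY)=g(X,Y)$ for all $X,Y\in T_xM$. $P_s^t(\gamma)$ denotes Levi-Civita parallel transport along $\gamma$ from $\gamma(s)$ to $\gamma(t)$. For $q=(x,\hat x;A)\in Q$ and $X\in T_xM$, the rolling lift is $\mathscr L_R(X)|_q=\frac{d}{dt}\big|_0 P_0^t(\hat\gamma)\circ A\circ P_t^0(\gamma)\in T_qQ$, where $\gamma,\hat\gamma$ are any smooth curves in $M,\hat M$ with $\dot\gamma(0)=X$ and $\dot{\hat\gamma}(0)=AX$. The rolling distribution is $\mathscr D_R|_q=\{\mathscr L_R(X)|_q\mid X\in T_xM\}$. Equivalently, an absolutely continuous curve $(\gamma(t),\hat\gamma(t);A(t))$ in $Q$ is a.e. tangent to $\mathscr D_R$ iff $\dot{\hat\gamma}(t)=A(t)\dot\gamma(t)$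 and $\overline\nabla_{(\dot\gamma(t),\dot{\hat\gamma}(t))}A(t)=0$ for a.e. $t$, where $\overline\nabla$ is the Levi-Civita connection of the Riemannian product $M\times\hat M$. The system $\Sigma_R$ is completely controllable if for every pair $q_{init},q_{final}\in Q$ there is an absolutely continuous curve in $Q$ from $q_{init}$ to $q_{final}$ tangent to $\mathscr D_R$ almost everywhere. *)

(* Defs.v *)
From HB Require Import structures.
From mathcomp Require Import all_boot all_order all_algebra.
From mathcomp Require Import all_classical all_reals all_analysis.

Set Implicit Arguments.
Unset Strict Implicit.
Unset Printing Implicit Defensive.

Import Order.TTheory GRing.Theory Num.Theory.
Import numFieldNormedType.Exports.

Local Open Scope classical_set_scope.
Local Open Scope ring_scope.

(* Vectors are row vectors: a linear map T_x M -> T_xhat Mhat is a matrix acting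
   on the right, so composition "B after A" is A *m B. *)

Section Smoothness.
Context {R : realType} {V W : normedModType R}.

(* The sets U are meant to be open. *)
Fixpoint Ck_on (k : nat) (U : set V) (f : V -> W) : Prop :=
  if k is k'.+1 then
    (forall x, U x -> differentiable f x) /\
    (forall v : V, Ck_on k' U (fun x => 'd f x v))
  else forall x, U x -> {for x, continuous f}.

Definition smooth_on (U : set V) (f : V -> W) : Prop := forall k, Ck_on k U f.

End Smoothness.

Section AbsoluteContinuity.
Context {R : realType} {W : normedModType R}.

(* A finite disjoint family of subintervals of [a, b] is listed from left to
   right as [s 0, t 0], ..., [s (m-1), t (m-1)]. *)
Definition abs_continuous_on (a b : R) (f : R -> W) : Prop :=
  forall e : R, 0 < e -> exists2 d : R, 0 < d &
  forall (m : nat) (s t : nat -> R),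
    (forall i, (i < m)%N -> a <= s i /\ s i <= t i /\ t i <= b) ->
    (forall i, (i.+1 < m)%N -> t i <= s i.+1) ->
    \sum_(i < m) (t i - s i) < d ->
    \sum_(i < m) `|f (t i) - f (s i)| < e.

End AbsoluteContinuity.

Record chart (R : realType) (n : nat) (T : topologicalType) := Chart {
  cdom : set T ;
  cmap : T -> 'rV[R]_n ;
  cinv : 'rV[R]_n -> T ;
  cdom_open : open cdom ;
  cimage_open : open (cmap @` cdom) ;
  cmapK : {in cdom, cancel cmap cinv} ;
  cmap_continuous : forall x, cdom x -> {for x, continuous cmap} ;
  cinv_continuous : forall y, (cmap @` cdom) y -> {for y, continuous cinv}
}.

(* The tangent space T_x M is 'rV[R]_n: its elements are the components of a
   tangent vector in the preferred chart chart_at x.  The choice of chart_at is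
   arbitrary (it need not be continuous in x in any sense), so smoothness and
   derivatives are always read in a fixed chart. *)
Record manifold (R : realType) (n : nat) := Manifold {
  carrier :> topologicalType ;
  atlas : set (chart R n carrier) ;
  chart_at : carrier -> chart R n carrier ;
  chart_at_atlas : forall x, atlas (chart_at x) ;
  chart_at_dom : forall x, cdom (chart_at x) x ;
  atlas_smooth : forall c c', atlas c -> atlas c' ->
    smooth_on (cmap c @` (cdom c `&` cdom c')) (cmap c' \o cinv c) ;
  manifold_hausdorff : hausdorff_space carrier ;
  manifold_second_countable : @second_countable carrier ;
  manifold_nonempty : [set: carrier] !=set0 ;
  manifold_connected : connected [set: carrier]
}.

Section Manifold.
Context {R : realType} {n : nat} {M : manifold R n}.
Implicit Types (c : chart R n M) (x : M) (g : M -> 'M[R]_n).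

(* Components in c times this matrix are components in c', at the point x. *)
Definition change_chart c c' x : 'M[R]_n :=
  'J (cmap c' \o cinv c) (cmap c x).

Definition to_chart c x : 'M[R]_n := change_chart (chart_at x) c x.
Definition from_chart c x : 'M[R]_n := change_chart c (chart_at x) x.

(* The value at x tells whether the coordinate frame of chart_at x is positive;
   the sign of the frame of any fixed chart has to be locally constant. *)
Definition is_orientation (o : M -> bool) : Prop :=
  forall c, atlas c -> forall x, cdom c x ->
  \forall y \near x,
    o y (+) (\det (to_chart c y) < 0) = o x (+) (\det (to_chart c x) < 0).

Definition inner g x (u v : 'rV[R]_n) : R := (u *m g x *m v^T) 0 0.

Definition metric_in_chart g c (y : 'rV[R]_n) : 'M[R]_n :=
  let x := cinv c y in from_chart c x *m g x *m (from_chart c x)^T.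

(* Gamma^k_ij
   = 1/2 sum_l G^kl (partial_i G_jl + partial_j G_il - partial_l G_ij) *)
Definition christoffel g c (y : 'rV[R]_n) (i j k : 'I_n) : R :=
  let G := metric_in_chart g c in
  let dG (l : 'I_n) : 'M[R]_n := 'D_(delta_mx 0 l) G y in
  2^-1 * \sum_(l < n) invmx (G y) k l * (dG i j l + dG j i l - dG l i j).

Definition christoffel_form g c (y u v : 'rV[R]_n) : 'rV[R]_n :=
  \row_k \sum_(i < n) \sum_(j < n) christoffel g c y i j k * u 0 i * v 0 j.

(* I is meant to be an open interval. *)
Definition smooth_curve (I : set R) (gamma : R -> M) : Prop :=
  (forall t, I t -> {for t, continuous gamma}) /\
  (forall c, atlas c ->
     smooth_on (I `&` gamma @^-1` cdom c) (cmap c \o gamma)).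

Definition velocity (gamma : R -> M) (t : R) : 'rV[R]_n :=
  'D_1 (cmap (chart_at (gamma t)) \o gamma) t.

(* X t is a tangent vector at gamma t.  The vanishing of the Levi-Civita
   covariant derivative of X along gamma, in every chart:
   (X^k)' = - Gamma^k_ij (gamma^i)' X^j. *)
Definition parallel_along g (I : set R) (gamma : R -> M) (X : R -> 'rV[R]_n) :
    Prop :=
  forall c, atlas c -> forall t, I t -> cdom c (gamma t) ->
    is_derive t (1 : R) (fun s => X s *m to_chart c (gamma s))
      (- christoffel_form g c (cmap c (gamma t)) ('D_1 (cmap c \o gamma) t)
           (X t *m to_chart c (gamma t))).

(* P s t is the matrix of P_s^t(gamma) : T_{gamma s} M -> T_{gamma t} M. *)
Definition parallel_transport g (I : set R) (gamma : R -> M)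
    (P : R -> R -> 'M[R]_n) : Prop :=
  forall s, I s -> P s s = 1%:M /\
    forall v, parallel_along g I gamma (fun t => v *m P s t).

Definition path_length g (gamma : R -> M) : R :=
  \int[@lebesgue_measure R]_(t in `[0, 1])
    Num.sqrt (inner g (gamma t) (velocity gamma t) (velocity gamma t)).

(* x and y are joined by a piecewise smooth path of length l. *)
Inductive joined g : M -> M -> R -> Prop :=
| joined_refl x : joined g x x 0
| joined_step x y l (gamma : R -> M) (e : R) :
    joined g x y l -> 0 < e -> smooth_curve `]- e, 1 + e[ gamma ->
    gamma 0 = y -> joined g x (gamma 1) (l + path_length g gamma).

Definition riemannian_distance g x y : R := inf [set l | joined g x y l].

Definition complete_metric g : Prop :=
  forall u : nat -> M,
    (forall e : R, 0 < e -> exists N : nat, forall i j,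
       (N <= i)%N -> (N <= j)%N -> riemannian_distance g (u i) (u j) < e) ->
    exists x : M, u @ \oo --> x.

End Manifold.

Record riemannian_metric (R : realType) (n : nat) (M : manifold R n) :=
  RiemannianMetric {
  metric :> M -> 'M[R]_n ;
  metric_sym : forall x, (metric x)^T = metric x ;
  metric_pos : forall x v, v != 0 -> 0 < inner metric x v v ;
  metric_smooth : forall c, atlas c ->
    smooth_on (cmap c @` cdom c) (metric_in_chart metric c)
}.

Section Submanifold.
Context {R : realType} {m nhat : nat} {N : manifold R m} {M : manifold R nhat}.
Implicit Types (f : N -> M) (g : M -> 'M[R]_nhat).

Definition in_charts f (c : chart R m N) (c' : chart R nhat M) :
    'rV[R]_m -> 'rV[R]_nhat := cmap c' \o f \o cinv c.

Definition smooth_map f : Prop :=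
  continuous f /\
  forall c c', atlas c -> atlas c' ->
    smooth_on (cmap c @` (cdom c `&` f @^-1` cdom c')) (in_charts f c c').

Definition differential f (p : N) : 'M[R]_(m, nhat) :=
  'J (in_charts f (chart_at p) (chart_at (f p))) (cmap (chart_at p) p).

(* Submanifolds are (injectively) immersed; embedded ones are a special case. *)
Definition immersed_submanifold f : Prop :=
  [/\ injective f, smooth_map f & forall p, row_free (differential f p)].

Definition induced_metric g f (p : N) : 'M[R]_m :=
  differential f p *m g (f p) *m (differential f p)^T.

(* The covariant derivative in M of f_* Y in the direction f_* X at p, where Y
   is extended with constant components in the chart c; the result is expressed
   in the chart c'.  Its normal component does not depend on the extension. *)
Definition ambient_derivative g f c c' (p : N) (X Y : 'rV[R]_m) :
    'rV[R]_nhat :=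
  let F := in_charts f c c' in
  let y := cmap c p in
  'D_X ('D_Y F) y + christoffel_form g c' (F y) ('D_X F y) ('D_Y F y).

(* The components of X, Y are in the chart c, those of nu in the chart c'. *)
Definition second_fundamental_form g f c c' (p : N) (X Y : 'rV[R]_m)
    (nu : 'rV[R]_nhat) : R :=
  (ambient_derivative g f c c' p X Y
     *m metric_in_chart g c' (cmap c' (f p)) *m nu^T) 0 0.

Definition normal_vector g f c c' (p : N) (nu : 'rV[R]_nhat) : Prop :=
  forall Z : 'rV[R]_m,
    ('D_Z (in_charts f c c') (cmap c p)
       *m metric_in_chart g c' (cmap c' (f p)) *m nu^T) 0 0 = 0.

Definition totally_geodesic g f : Prop :=
  forall c c' p, atlas c -> atlas c' -> cdom c p -> cdom c' (f p) ->
  forall nu, normal_vector g f c c' p nu ->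
  forall X Y, second_fundamental_form g f c c' p X Y nu = 0.

End Submanifold.

(* A point (x, xhat; A) of T^*M (x) T Mhat. *)
Record hom_point (R : realType) (n nhat : nat)
    (M : manifold R n) (Mhat : manifold R nhat) := HomPoint {
  pt : M ;
  pthat : Mhat ;
  hom : 'M[R]_(n, nhat)
}.

Section Rolling.
Context {R : realType} {n nhat : nat}.
Context {M : manifold R n} {Mhat : manifold R nhat}.
Variables (g : riemannian_metric M) (ghat : riemannian_metric Mhat).
Implicit Types q : hom_point M Mhat.

Definition Q : set (hom_point M Mhat) :=
  [set q | forall X Y : 'rV[R]_n,
     inner ghat (pthat q) (X *m hom q) (Y *m hom q) = inner g (pt q) X Y].

(* The chart of T^*M (x) T Mhat induced by the charts c and c'. *)
Definition hom_chart (c : chart R n M) (c' : chart R nhat Mhat) q :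
    ('rV[R]_n * 'rV[R]_nhat * 'M[R]_(n, nhat))%type :=
  (cmap c (pt q), cmap c' (pthat q),
   from_chart c (pt q) *m hom q *m to_chart c' (pthat q)).

(* Tangent vectors to T^*M (x) T Mhat at q are given by their components in the
   chart induced by the preferred charts at pt q and pthat q. *)
Definition has_velocity (q : R -> hom_point M Mhat) (t : R)
    (W : ('rV[R]_n * 'rV[R]_nhat * 'M[R]_(n, nhat))%type) : Prop :=
  is_derive t (1 : R)
    (hom_chart (chart_at (pt (q t))) (chart_at (pthat (q t))) \o q) W.

(* W = L_R(X)|_q *)
Definition rolling_lift q (X : 'rV[R]_n)
    (W : ('rV[R]_n * 'rV[R]_nhat * 'M[R]_(n, nhat))%type) : Prop :=
  exists (e : R) (gamma : R -> M) (gammahat : R -> Mhat)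
         (P : R -> R -> 'M[R]_n) (Phat : R -> R -> 'M[R]_nhat),
    let I := `]- e, e[%classic : set R in
    [/\ 0 < e,
        [/\ smooth_curve I gamma, gamma 0 = pt q & velocity gamma 0 = X],
        [/\ smooth_curve I gammahat, gammahat 0 = pthat q
          & velocity gammahat 0 = X *m hom q],
        parallel_transport g I gamma P /\
          parallel_transport ghat I gammahat Phat
      & has_velocity (fun t => HomPoint (gamma t) (gammahat t)
                                 (P t 0 *m hom q *m Phat 0 t)) 0 W].

Definition rolling_distribution q :
    set ('rV[R]_n * 'rV[R]_nhat * 'M[R]_(n, nhat))%type :=
  [set W | exists X, rolling_lift q X W].

Definition abs_continuous_curve (T : R) (q : R -> hom_point M Mhat) : Prop :=
  [/\ {within `[0, T], continuous (fun t : R => pt (q t))},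
      {within `[0, T], continuous (fun t : R => pthat (q t))}
    & forall c c' (a b : R), atlas c -> atlas c' -> 0 <= a -> b <= T ->
        (forall t, a <= t <= b -> cdom c (pt (q t)) /\ cdom c' (pthat (q t))) ->
        abs_continuous_on a b (hom_chart c c' \o q)].

Definition tangent_ae (T : R) (q : R -> hom_point M Mhat) : Prop :=
  {ae @lebesgue_measure R, forall t : R, 0 <= t <= T ->
     exists2 W, has_velocity q t W & rolling_distribution (q t) W}.

Definition completely_controllable : Prop :=
  forall q_init q_final, Q q_init -> Q q_final ->
  exists (T : R) (q : R -> hom_point M Mhat),
    [/\ 0 < T,
        q 0 = q_init /\ q T = q_final,
        (forall t, 0 <= t <= T -> Q (q t)),
        abs_continuous_curve T q
      & tangent_ae T q].

End Rolling.

(* Main.v *)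
(* Call q = (x, xhat; A) tangent at p in N when iota p = xhat and A maps T_x M into
   the tangent space of N at p.  Tangency is preserved along rolling curves, while
   Q contains tangent and (for n >= 1) non-tangent points, because m < nhat leaves
   room for an isometric A whose range contains a normal of N.

   Tangency spreads to nearby times.  In charts iota becomes an immersion F with
   jacobian J; let u(t) be the point of the parameter space for which F(u(t)) agrees
   with y(t), the position of xhat, in directions complementary to the slice.  The
   deviation z = (y - F(u), component of A transversal to J(u)) then satisfies
   |z'| <= C |x'| |z| almost everywhere: the forcing terms cancel because the
   second derivative of F corrected by the Christoffel symbols is tangent to N.
   Since x is absolutely continuous, z = 0 by a Gronwall argument.

   Tangency passes to limit times t1.  The points p(t) of N have induced distances
   controlled by the variation of xhat, because an immersion is locally
   bi-Lipschitz; so p(t) is Cauchy as t -> t1 and converges by completeness of N.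

   For n = 0 a rolling curve does not move at all. *)

From HB Require Import structures.
From mathcomp Require Import all_boot all_order all_algebra.
From mathcomp Require Import all_classical all_reals all_analysis.
From mathcomp Require Import ring lra.
Require Import Defs.


Set Implicit Arguments.
Unset Strict Implicit.
Unset Printing Implicit Defensive.

Import Order.TTheory GRing.Theory Num.Theory.
Import numFieldNormedType.Exports.

Local Open Scope classical_set_scope.
Local Open Scope ring_scope.

(** * Differential calculus of matrix-valued maps *)

(** The curves are only absolutely continuous and are constrained almost everywhere, so the
    classical uniqueness theorem for equations with continuous coefficients does not apply to them.
    Bounds on derivatives are converted into bounds on increments: off a short open cover of the
    exceptional null set through differentiability, inside it through absolute continuity, the two
    being combined over a fine partition. The variation of the whole chart reading of the curve
    serves as clock, since it dominates that of x.

    The slice coordinate u is defined pointwise by an implicit equation. The immersion makes it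
    depend on y in a Lipschitz way, so it is absolutely continuous, and differentiable wherever y
    is; this is all the regularity the deviation needs.

    N is injectively immersed and perhaps not embedded, so nearby points of Mhat may have distant
    preimages. The local statement therefore also asserts that the point of N stays close in a chart
    of N; this is what makes the length of p(t) measurable by short segments in charts. *)

Section MatrixNorm.
Context {R : realType}.

Lemma mx_entry_le p q (A : 'M[R]_(p, q)) i j : `|A i j| <= `|A|.
Proof. by rewrite [leRHS]/Num.norm /= mx_normrE (le_bigmax _ _ (i, j)). Qed.

Lemma mx_norm_le p q (A : 'M[R]_(p, q)) (e : R) :
  0 <= e -> (forall i j, `|A i j| <= e) -> `|A| <= e.
Proof.
move=> e0 H; rewrite [leLHS]/Num.norm /= mx_normrE bigmax_le//.
Qed.

(** The norm is the largest absolute value of an entry, so every product costs a factor equal to the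
    inner dimension. This is where the dimensions in all later constants come from. *)
Lemma mulmx_norm p q r (A : 'M[R]_(p, q)) (B : 'M[R]_(q, r)) :
  `|A *m B| <= q%:R * `|A| * `|B|.
Proof.
apply: mx_norm_le => [|i j]; first by rewrite !mulr_ge0.
rewrite mxE (le_trans (ler_norm_sum _ _ _))//.
rewrite (le_trans (_ : _ <= \sum_(k < q) (`|A| * `|B|)))//.
  by apply: ler_sum => k _; rewrite normrM ler_pM ?mx_entry_le.
by rewrite sumr_const card_ord -[leLHS]mulr_natl mulrA.
Qed.

Lemma trmx_norm p q (A : 'M[R]_(p, q)) : `|A^T| = `|A|.
Proof.
apply/eqP; rewrite eq_le; apply/andP; split; apply: mx_norm_le => // i j.
  by rewrite mxE mx_entry_le.
by have := mx_entry_le A^T j i; rewrite mxE.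
Qed.

Lemma linear_mx_bounded p q (W : normedModType R)
    (f : {linear 'M[R]_(p, q) -> W}) :
  exists2 k : R, 0 <= k & forall A, `|f A| <= k * `|A|.
Proof.
exists (\sum_i \sum_j `|f (delta_mx i j)|).
  by apply: sumr_ge0 => i _; apply: sumr_ge0.
move=> A; rewrite {1}(matrix_sum_delta A) linear_sum mulr_suml.
rewrite (le_trans (ler_norm_sum _ _ _))// ler_sum// => i _.
rewrite linear_sum mulr_suml (le_trans (ler_norm_sum _ _ _))// ler_sum// => j _.
by rewrite linearZ normrZ mulrC ler_wpM2l// mx_entry_le.
Qed.

Lemma linear_mx_continuous p q (W : normedModType R)
    (f : {linear 'M[R]_(p, q) -> W}) : continuous f.
Proof.
apply: bounded_linear_continuous; apply/linear_boundedP.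
have [k k0 H] := linear_mx_bounded f.
exists k; split; first exact: num_real.
by move=> y ky x; rewrite (le_trans (H x))// ler_wpM2r// ltW.
Qed.

End MatrixNorm.

Section Differentiability.
Context {R : realType}.
Implicit Types V W : normedModType R.

Lemma differentiable_increment V W (f : V -> W) x :
  differentiable f x ->
  forall e : R, 0 < e -> exists2 d : R, 0 < d &
    forall h, `|h| < d -> `|f (x + h) - f x - 'd f x h| <= e * `|h|.
Proof.
move=> df e e0.
have /eqaddoP/(_ e e0) := diff_locally df.
move=> /nbhs_normP[d /= d0 H]; exists d => // h hd.
have := H h; rewrite /= sub0r normrN => /(_ hd) /=.
by rewrite /cst /= !fctE opprD addrA [h + x]addrC.
Qed.

Lemma differentiable_of_increment V W (f : V -> W) (L : {linear V -> W}) x :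
  continuous L ->
  (forall e : R, 0 < e -> exists2 d : R, 0 < d &
    forall h, `|h| < d -> `|f (x + h) - f x - L h| <= e * `|h|) ->
  differentiable f x /\ 'd f x = L :> (V -> W).
Proof.
move=> cL H.
have E : f \o shift x = cst (f x) + L +o_ 0 id.
  apply/eqaddoP => e e0; have [d d0 {}H] := H e e0.
  apply/nbhs_normP; exists d => // h; rewrite /= sub0r normrN => /H.
  by rewrite !fctE opprD addrA [h + x]addrC.
have D := diff_unique cL E; split=> //.
by apply/diff_locallyP; rewrite D.
Qed.

Lemma near_eq_differentiable V W (f g : V -> W) x :
  (\near x, f x = g x) -> differentiable f x ->
  differentiable g x /\ 'd g x = 'd f x :> (V -> W).
Proof.
move=> fg df; apply: differentiable_of_increment; first exact: diff_continuous.
move=> e e0; have [d d0 H] := differentiable_increment df e0.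
move: (fg) => /nbhs_normP[r /= r0 Hr].
exists (Num.min d r); first by rewrite lt_min d0.
move=> h; rewrite lt_min => /andP[hd hr].
rewrite -(nbhs_singleton fg) -Hr ?H//=.
by rewrite opprD addrA subrr sub0r normrN.
Qed.

Lemma is_derive_mxP V p q (f : V -> 'M[R]_(p, q)) x v (df : 'M[R]_(p, q)) :
  is_derive x v f df <->
  forall i j, is_derive x v (fun y => f y i j) (df i j).
Proof.
split=> [[fd fv] i j|H].
  have fij := (derivable_mxP _ _ _).1 fd i j.
  by apply: DeriveDef => //; rewrite -fv derive_mx// mxE.
have fd : derivable f x v by apply/derivable_mxP => i j; have [] := H i j.
apply: DeriveDef => //; rewrite derive_mx//; apply/matrixP => i j.
by rewrite mxE; have [_ ->] := H i j.
Qed.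

Lemma is_derive_mulmx V p q r (f : V -> 'M[R]_(p, q))
    (g : V -> 'M[R]_(q, r)) x v df dg :
  is_derive x v f df -> is_derive x v g dg ->
  is_derive x v (fun y => f y *m g y) (df *m g x + f x *m dg).
Proof.
move=> /is_derive_mxP Hf /is_derive_mxP Hg; apply/is_derive_mxP => i j.
rewrite (_ : (fun y => _) = \sum_(k < q) (fun y => f y i k * g y k j)).
  have H k : is_derive x v (fun y => f y i k * g y k j)
      (df i k * g x k j + f x i k * dg k j).
    have h1 := Hf i k; have h2 := Hg k j.
    apply: is_derive_eq (is_deriveM h1 h2) _.
    by rewrite /GRing.scale /= addrC [g x k j * _]mulrC.
  apply: is_derive_eq (is_derive_sum _) _.
  by rewrite !mxE -big_split.
by apply/funext => y; rewrite fct_sumE mxE.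
Qed.

Lemma is_derive_differentiable W (f : R -> W) t df :
  is_derive t (1 : R) f df -> differentiable f t /\ 'd f t 1 = df.
Proof.
move=> [fd <-]; have D : differentiable f t by exact/derivable1_diffP.
by split=> //; rewrite deriveE.
Qed.

Lemma differentiable_is_derive V W (f : V -> W) x v :
  differentiable f x -> is_derive x v f ('d f x v).
Proof.
by move=> df; apply: DeriveDef; [exact: diff_derivable|rewrite deriveE].
Qed.

Lemma is_derive_comp V W (f : R -> V) (g : V -> W) t df :
  is_derive t (1 : R) f df -> differentiable g (f t) ->
  is_derive t (1 : R) (g \o f) ('d g (f t) df).
Proof.
move=> /is_derive_differentiable[fd <-] gd.
apply: is_derive_eq (differentiable_is_derive _ _) _.
  exact: differentiable_comp.
by rewrite diff_comp.
Qed.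


End Differentiability.

(* Sealed, since failing conversions between two instances of the jacobian
   unfold down to the choice operator. *)
HB.lock Definition jac (R : realType) (p q : nat) (f : 'rV[R]_p -> 'rV[R]_q)
  (x : 'rV[R]_p) : 'M[R]_(p, q) := 'J f x.

Section Jacobian.
Context {R : realType}.

Definition has_jac p q (f : 'rV[R]_p -> 'rV[R]_q) x J :=
  differentiable f x /\ forall v, 'd f x v = v *m J.

Lemma jacE p q (f : 'rV[R]_p -> 'rV[R]_q) x : 'J f x = jac f x.
Proof. by rewrite jac.unlock. Qed.

Lemma has_jac_jac p q (f : 'rV[R]_p -> 'rV[R]_q) x :
  differentiable f x -> has_jac f x (jac f x).
Proof.
move=> df; split=> // v.
by rewrite -jacE -(deriveE _ df); exact: deriveEjacobian.
Qed.

Lemma mulmx_ext p q (A B : 'M[R]_(p, q)) :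
  (forall v : 'rV_p, v *m A = v *m B) -> A = B.
Proof. by move=> H; apply/row_matrixP => i; rewrite !rowE. Qed.

Lemma has_jac_unique p q (f : 'rV[R]_p -> 'rV[R]_q) x J :
  has_jac f x J -> jac f x = J.
Proof.
move=> [df H]; apply: mulmx_ext => v.
have [_ H'] := has_jac_jac df.
by move: (H v) (H' v) => -> ->.
Qed.

Lemma has_jac_comp p q r (f : 'rV[R]_p -> 'rV[R]_q)
    (g : 'rV[R]_q -> 'rV[R]_r) x J K :
  has_jac f x J -> has_jac g (f x) K -> has_jac (g \o f) x (J *m K).
Proof.
move=> [df Jf] [dg Jg]; split; first exact: differentiable_comp.
by move=> v; rewrite diff_comp//= mulmxA -Jf -Jg.
Qed.

Lemma near_eq_has_jac p q (f g : 'rV[R]_p -> 'rV[R]_q) x J :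
  (\near x, f x = g x) -> has_jac f x J -> has_jac g x J.
Proof.
move=> fg [df Jf]; have [dg E] := near_eq_differentiable fg df.
split; first exact: dg.
by move=> v; rewrite E; exact: Jf.
Qed.

Lemma has_jac_id p (x : 'rV[R]_p) : has_jac id x 1%:M.
Proof.
have H : is_diff x (@id 'rV[R]_p) id by exact: is_diff_id.
by split=> [//|v]; rewrite mulmx1 diff_val.
Qed.

End Jacobian.

HB.instance Definition _ (R : realType) (m n : nat) :=
  Complete.on 'M[R]_(m, n).

Section ContinuouslyDifferentiable.
Context {R : realType}.

(** Each entry obeys the mean value theorem on the segment, and the sup norm reassembles the
    entries. The matrix [w] is a prediction of the increment: the value of one fixed derivative in
    [strictly_differentiable], zero in [linear_ode_unique]. *)
Lemma mean_value_estimate (V : normedModType R) p q (f : V -> 'M[R]_(p, q))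
    x y w (eta : R) :
  (forall t : R, 0 <= t <= 1 -> differentiable f (x + t *: (y - x)) /\
     `|'d f (x + t *: (y - x)) (y - x) - w| <= eta) ->
  `|f y - f x - w| <= eta.
Proof.
move=> H.
have eta0 : 0 <= eta.
  have [|_ /(le_trans (normr_ge0 _))//] := H 0; by rewrite lexx ler01.
apply: mx_norm_le => // i j.
pose l (t : R) := x + t *: (y - x).
have dl t : is_derive t (1 : R) l (y - x).
  rewrite /l.
  have -> : (fun t : R => x + t *: (y - x)) = cst x + (fun t : R => t *: (y - x)).
    by [].
  have h1 := is_derive_cst x t (1 : R).
  have h2 : is_derive t (1 : R) (fun t : R => t *: (y - x)) (y - x).
    have [d1 d2] := is_diff_scalel t (y - x).
    by apply: is_derive_eq (differentiable_is_derive _ d1) _; rewrite d2 scale1r.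
  by apply: is_derive_eq (is_deriveD h1 h2) _; rewrite add0r.
have D (t : R) : t \in `[(0 : R), 1] ->
    is_derive t (1 : R) (fun s => f (l s) i j) ('d f (l t) (y - x) i j).
  rewrite in_itv /= => /H[df _].
  exact: (is_derive_mxP _ _ _ _).1 (is_derive_comp (dl t) df) i j.
have [c cI E] := @MVT_segment R (fun s => f (l s) i j)
  (fun t => 'd f (l t) (y - x) i j) 0 1 ler01
  (fun t tI => D t (subset_itv_oo_cc tI))
  (derivable_within_continuous (fun t tI => @ex_derive _ _ _ _ _ _ _ (D t tI))).
move: cI; rewrite in_itv /= => /H[_]; apply: le_trans.
apply: le_trans (mx_entry_le _ i j).
move: E; rewrite subr0 mulr1 {1 2}/l scale1r scale0r addr0 [x + _]addrC subrK => E.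
have <- : (f y - f x - w) i j = ('d f (l c) (y - x) - w) i j.
  by rewrite !mxE E.
by [].
Qed.

Lemma linear_row_dist (W : normedModType R) m (L L' : {linear 'rV[R]_m -> W})
    (e : R) v :
  (forall i, `|L (delta_mx 0 i) - L' (delta_mx 0 i)| <= e) ->
  `|L v - L' v| <= m%:R * e * `|v|.
Proof.
move=> H.
have E (M : {linear 'rV[R]_m -> W}) :
    M v = \sum_(i < m) v 0 i *: M (delta_mx 0 i).
  rewrite {1}(row_sum_delta v) linear_sum; apply: eq_bigr => i _.
  exact: linearZ.
rewrite (E L) (E L') -sumrB.
rewrite (le_trans (ler_norm_sum _ _ _))//.
have -> : m%:R * e * `|v| = \sum_(i < m) (e * `|v|).
  by rewrite sumr_const card_ord -[RHS]mulr_natl mulrA.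
apply: ler_sum => i _.
rewrite -scalerBr normrZ mulrC ler_pM//.
exact: mx_entry_le.
Qed.

(** The derivative is close to ['d f x0] on a whole ball because it is so along each of the finitely
    many basis vectors; the mean value estimate on segments of the ball concludes. *)
Lemma strictly_differentiable m p q (U : set 'rV[R]_m)
    (f : 'rV[R]_m -> 'M[R]_(p, q)) x0 :
  open U -> Ck_on 1 U f -> U x0 ->
  forall eta : R, 0 < eta -> exists2 r : R, 0 < r &
    forall x y, `|x - x0| < r -> `|y - x0| < r ->
      [/\ U x, U y & `|f y - f x - 'd f x0 (y - x)| <= eta * `|y - x|].
Proof.
move=> oU [df dfc] Ux0 eta eta0.
have /nbhs_normP[r1 /= r10 Hr1] : nbhs x0 U by exact: open_nbhs_nbhs.
(* The errors along the [m] basis vectors add up to [m * e <= eta]; the added 1 keeps the divisor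
   positive when [m = 0]. *)
pose e := eta / (m%:R + 1).
have m1 : 0 < m%:R + 1 :> R by rewrite ltr_wpDl.
have e0 : 0 < e by rewrite divr_gt0.
have : \forall z \near x0, forall i : 'I_m,
    `|'d f x0 (delta_mx 0 i) - 'd f z (delta_mx 0 i)| < e.
  apply: (@filter_forall _ _ _ _ (nbhs_filter x0)) => i.
  by move/cvgrPdist_lt: (dfc (delta_mx 0 i) x0 Ux0); apply.
move=> /nbhs_normP[r2 /= r20 Hr2].
exists (Num.min r1 r2); first by rewrite lt_min r10.
move=> x y; rewrite !lt_min => /andP[x1 x2] /andP[y1 y2].
split; [by apply: Hr1; rewrite /= distrC|by apply: Hr1; rewrite /= distrC|].
apply: mean_value_estimate => t /andP[t0 t1].
set z := x + _.
have zb r : `|x - x0| < r -> `|y - x0| < r -> `|x0 - z| < r.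
  move=> xr yr.
  have -> : x0 - z = - ((1 - t) *: (x - x0) + t *: (y - x0)).
    rewrite /z !scalerBr !scalerBl !scale1r.
    by apply/rowP => k; rewrite !mxE; ring.
  rewrite normrN (le_lt_trans (ler_normD _ _))// !normrZ.
  rewrite (ger0_norm t0) ger0_norm ?subr_ge0//.
  have [->|tn1] := eqVneq t 1; first by rewrite subrr mul0r add0r mul1r.
  have : 0 < 1 - t by rewrite subr_gt0 lt_neqAle tn1.
  by nra.
split; first by apply: df; apply: Hr1; exact: zb.
have Hz := Hr2 z (zb _ x2 y2).
apply: le_trans (linear_row_dist (e := e) _ _) _ => [i|].
  by rewrite distrC ltW// Hz.
rewrite ler_wpM2r// /e mulrC -mulrA -[leRHS]mulr1 ler_wpM2l ?ltW//.
by rewrite ltr_pdivrMl// mulr1 ltrDl.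
Qed.

Lemma C1_lipschitz m p q (U : set 'rV[R]_m)
    (f : 'rV[R]_m -> 'M[R]_(p, q)) x0 :
  open U -> Ck_on 1 U f -> U x0 ->
  exists r L : R, [/\ 0 < r, 0 <= L &
    forall x y, `|x - x0| < r -> `|y - x0| < r ->
      `|f y - f x| <= L * `|y - x|].
Proof.
move=> oU fC Ux0.
have [r r0 H] := strictly_differentiable oU fC Ux0 ltr01.
have [k k0 Hk] := linear_mx_bounded ('d f x0).
exists r, (1 + k); split; rewrite ?addr_ge0// => x y xr yr.
have [_ _ Hxy] := H x y xr yr.
rewrite -(subrK ('d f x0 (y - x)) (f y - f x)) mulrDl.
by rewrite (le_trans (ler_normD _ _))// lerD.
Qed.

End ContinuouslyDifferentiable.

(** * Maps close to the identity: expansion and local surjectivity *)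

Section LocalInverse.
Context {R : realType} {m : nat}.

Lemma near_identity_expansion (G : 'rV[R]_m -> 'rV[R]_m) x y :
  `|G y - G x - (y - x)| <= 2^-1 * `|y - x| -> `|y - x| <= 2 * `|G y - G x|.
Proof.
move=> H; have : `|y - x| <= `|G y - G x| + `|G y - G x - (y - x)|.
  rewrite -{1}(subKr (G y - G x) (y - x)); apply: le_trans (ler_normB _ _) _.
  by rewrite lexx.
lra.
Qed.

(** A preimage of [z] is a fixed point of [u + (z - G u)], a contraction of ratio 1/2. On the closed
    ball of radius [r / 2] it moves the centre by less than [r / 4] and shrinks the rest to [r / 4],
    so the ball is mapped into itself. *)
Lemma near_identity_surjective (G : 'rV[R]_m -> 'rV[R]_m) u0 (r : R) z :
  0 < r ->
  (forall x y, `|x - u0| < r -> `|y - u0| < r ->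
     `|G y - G x - (y - x)| <= 2^-1 * `|y - x|) ->
  `|z - G u0| < r / 4 ->
  exists2 u, `|u - u0| < r & G u = z.
Proof.
move=> r0 H zr.
pose U : set 'rV[R]_m := closed_ball u0 (r / 2).
have r2 : 0 < r / 2 by rewrite divr_gt0.
have UE x : U x <-> `|x - u0| <= r / 2.
  by rewrite /U closed_ballE// /closed_ball_ /= distrC.
have Ur x : U x -> `|x - u0| < r by move=> /UE; lra.
pose T u := u + (z - G u).
have TT x y : U x -> U y -> `|T x - T y| <= 2^-1 * `|x - y|.
  move=> Ux Uy; have := H _ _ (Ur _ Ux) (Ur _ Uy).
  rewrite [`|y - x|]distrC; congr (`|_| <= _).
  by rewrite /T; apply/rowP => k; rewrite !mxE; ring.
have Uu0 : U u0 by apply/UE; rewrite subrr normr0 ltW.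
have TU x : U x -> U (T x).
  move=> Ux; apply/UE.
  have -> : T x - u0 = (T x - T u0) + (z - G u0).
    by rewrite /T; apply/rowP => k; rewrite !mxE; ring.
  rewrite (le_trans (ler_normD _ _))//.
  by have := TT _ _ Ux Uu0; move/UE: Ux; lra.
pose Tf : {fun U >-> U} := HB.pack T (isFun.Build _ _ U U T TU).
have cT : is_contraction Tf.
  exists (2^-1%:nng); split; first by rewrite /=; lra.
  by move=> [x y] [Ux Uy] /=; exact: TT.
have clU : closed U by exact: closed_ball_closed.
have [u Uu Eu] := banach_fixed_point cT clU (ex_intro _ _ Uu0).
exists u; first exact: Ur.
have {}Eu : u = T u by exact: Eu.
apply/esym/subr0_eq; apply: (@addrI _ u); rewrite addr0; exact/esym.
Qed.

End LocalInverse.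

(** * Increments of absolutely continuous curves *)

Section RealInduction.
Context {R : realType}.

(** Take the supremum of the times up to which [P] holds throughout. The last hypothesis gives [P]
    there, and the second one contradicts maximality unless the supremum is [b]. *)
Lemma real_induction (a b : R) (P : R -> Prop) :
  P a ->
  (forall t, a <= t < b -> P t ->
     exists2 d, 0 < d & forall s, t <= s < t + d -> s <= b -> P s) ->
  (forall t, a < t <= b -> (forall s, a <= s < t -> P s) -> P t) ->
  forall t, a <= t <= b -> P t.
Proof.
move=> Pa Pright Pleft t0 /andP[at0 t0b].
have ab : a <= b by exact: le_trans t0b.
pose A := [set t | a <= t <= b /\ forall s, a <= s <= t -> P s].
have Aa : A a.
  split; first by rewrite lexx.
  by move=> s sa; have -> : s = a by apply/eqP; rewrite eq_le andbC.
have supA : has_sup A by split; [exists a|exists b => t [/andP[]]].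
pose c := sup A.
have ac : a <= c by exact: sup_upper_bound supA _ Aa.
have cb : c <= b by apply: sup_le_ub; [exists a|move=> t [/andP[]]].
have Pc s : a <= s < c -> P s.
  move=> /andP[sa sc].
  have [t [_ Pt] st] := sup_gt supA.1 sc.
  by apply: Pt; rewrite sa ltW.
have {}Pc s : a <= s <= c -> P s.
  move=> /andP[sa]; rewrite le_eqVlt => /predU1P[->|sc]; last first.
    by apply: Pc; rewrite sa.
  move: ac; rewrite le_eqVlt => /predU1P[<-//|ac].
  by apply: Pleft => //; rewrite ac.
have cE : c = b.
  apply/eqP; rewrite eq_le cb leNgt; apply/negP => ltcb.
  have Pcc : P c by apply: Pc; rewrite ac lexx.
  have accb : a <= c < b by rewrite ac.
  have [d d0 Hd] := Pright c accb Pcc.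
  pose t := Num.min (c + d / 2) b.
  have ct : c < t by rewrite /t lt_min ltcb andbT ltrDl divr_gt0.
  have : A t.
    split; first by rewrite (le_trans ac (ltW ct)) /t ge_min lexx orbT.
    move=> s /andP[sa st]; have [sc|sc] := leP s c; first by apply: Pc; rewrite sa.
    have sb : s <= b by rewrite (le_trans st)// /t ge_min lexx orbT.
    apply: Hd => //; rewrite (ltW sc)/= (le_lt_trans st)//.
    by rewrite /t gt_min; apply/orP; left; lra.
  by move=> /(sup_upper_bound supA); rewrite leNgt ct.
by apply: Pc; rewrite cE at0.
Qed.

(** Points may repeat, and [k = 0] is allowed on a degenerate interval. *)
Definition partition_of (a b : R) (k : nat) (tau : nat -> R) :=
  [/\ tau 0%N = a, tau k = b & forall i, (i < k)%N -> tau i <= tau i.+1].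

Lemma partition_bounds a b k tau : partition_of a b k tau ->
  forall i, (i <= k)%N -> a <= tau i <= b.
Proof.
move=> [ta tb H].
have mono i j : (i <= j)%N -> (j <= k)%N -> tau i <= tau j.
  elim: j => [|j IH]; first by rewrite leqn0 => /eqP->.
  rewrite leq_eqVlt => /predU1P[->//|]; rewrite ltnS => ij jk.
  by apply: le_trans (H _ jk); apply: IH => //; exact: ltnW.
by move=> i ik; rewrite -ta -tb !mono.
Qed.

(* Cousin's lemma, with every tag made an end point of its interval. *)
Lemma cousin_partition (a b : R) (E : R -> R -> Prop) :
  a <= b ->
  (forall t, a <= t <= b -> exists2 d, 0 < d &
     (forall s, a <= s -> t - d < s <= t -> E s t) /\
     (forall s, s <= b -> t <= s < t + d -> E t s)) ->
  exists k tau, partition_of a b k tau /\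
    forall i, (i < k)%N -> E (tau i) (tau i.+1).
Proof.
move=> ab HE.
(* Real induction on the right end point: a fine partition of an initial interval is prolonged by a
   single point. *)
pose P t := exists k tau, partition_of a t k tau /\
    forall i, (i < k)%N -> E (tau i) (tau i.+1).
have step s t : s <= t -> E s t -> P s -> P t.
  move=> st Est [k [tau [[ta ts H] HEt]]].
  exists k.+1, (fun i => if (i <= k)%N then tau i else t).
  split.
    split; [by []|by rewrite ltnn|].
    move=> i; rewrite ltnS => ik; rewrite ik.
    by case: ltngtP ik => // [ik _|-> _]; [exact: H|rewrite ts].
  move=> i; rewrite ltnS => ik; rewrite ik.
  by case: ltngtP ik => // [ik _|-> _]; [exact: HEt|rewrite ts].
apply: (@real_induction a b P) => //; last by rewrite ab lexx.
- by exists 0%N, (fun=> a); split=> //; split.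
- move=> t /andP[at_ tb] Pt.
  have [|d d0 [_ Hd]] := HE t; first by rewrite at_ ltW.
  exists d => // s std sb; apply: (step t) => //; first by case/andP: std.
  exact: Hd.
- move=> t /andP[at_ tb] Pt.
  have [|d d0 [Hd _]] := HE t; first by rewrite tb ltW.
  pose s := Num.max a (t - d / 2).
  have st : s < t by rewrite /s gt_max at_ /=; lra.
  have as_ : a <= s by rewrite /s le_max lexx.
  apply: (step s); [exact: ltW| |by apply: Pt; rewrite as_].
  apply: Hd => //; rewrite (ltW st) andbT /s lt_max; apply/orP; right; lra.
Qed.

End RealInduction.

Section AbsolutelyContinuousIncrement.
Context {R : realType}.
Notation mu := (@lebesgue_measure R).

(** Taken half-open, the bad pieces are disjoint subsets of [U] inside [[a, b[], so additivity of
    the measure bounds their total length. *)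
Lemma partition_length_le (a b : R) k tau (bad : nat -> bool) (U : set R) :
  partition_of a b k tau -> measurable U ->
  (forall i, (i < k)%N -> bad i -> `[tau i, tau i.+1]%classic `<=` U) ->
  ((\sum_(i < k | bad i) (tau i.+1 - tau i))%:E <= mu (U `&` `[a, b[%classic))%E.
Proof.
move=> [ta <- H] mU; rewrite -ta {ta}.
elim: k H => [|k IH] H HU; first by rewrite big_ord0 measure_ge0.
have kk : tau k <= tau k.+1 by apply: H.
have k0 : tau 0%N <= tau k.
  have : partition_of (tau 0%N) (tau k) k tau.
    by split=> // i ik; apply: H; exact: ltnW.
  by move=> /partition_bounds/(_ k (leqnn k))/andP[].
rewrite (_ : `[tau 0%N, tau k.+1[%classic =
    `[tau 0%N, tau k[%classic `|` `[tau k, tau k.+1[%classic); last first.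
  apply/seteqP; split=> x; rewrite /= !in_itv /=.
    by move=> /andP[x0 xk]; case: (ltP x (tau k)) => ?; [left|right]; apply/andP.
  by move=> [|] /andP[x0 xk]; apply/andP; split=> //;
    [exact: lt_le_trans kk|exact: le_trans x0].
rewrite setIUr measureU; last first.
- rewrite setIACA setIid; apply/seteqP; split=> x //= [_ []].
  by rewrite !in_itv /= => /andP[_ xk] /andP[kx _]; move: xk; rewrite ltNge kx.
- by apply: measurableI.
- by apply: measurableI.
rewrite big_mkcond big_ord_recr /= -big_mkcond /= EFinD.
apply: leeD.
  apply: IH => i ik; first by apply: H; exact: ltnW.
  by apply: HU; exact: ltnW.
case: ifPn => bk; last exact: measure_ge0.
have -> : U `&` `[tau k, tau k.+1[%classic = `[tau k, tau k.+1[%classic.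
  apply/setIidPr => x; rewrite /= in_itv /= => /andP[x0 /ltW x1].
  by apply: (HU k) => //=; rewrite in_itv /= x0.
by rewrite lebesgue_measure_itv /= lte_fin; case: ltgtP kk => // -> _; rewrite subrr.
Qed.

(** An inequality between derivatives at one time becomes one between increments, up to an error
    linear in the elapsed time. *)
Lemma increment_of_derivative (W1 W2 : normedModType R) (f : R -> W1)
    (w : R -> W2) t f' w' (K e : R) :
  is_derive t (1 : R) f f' -> is_derive t (1 : R) w w' -> 0 <= K ->
  `|f'| <= K * `|w'| -> 0 < e ->
  exists2 d, 0 < d & forall s, `|s - t| < d ->
    `|f s - f t| <= K * `|w s - w t| + e * `|s - t|.
Proof.
move=> /is_derive_differentiable[df Ef] /is_derive_differentiable[dw Ew] K0 H e0.
have K1 : 0 < K + 1 by rewrite ltr_wpDl.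
(* The linearisation error of [f] enters once and that of [w] is multiplied by [K], which makes
   [(K + 1) * e' = e]. *)
pose e' := e / (K + 1).
have e'0 : 0 < e' by rewrite divr_gt0.
have [d1 d10 H1] := differentiable_increment df e'0.
have [d2 d20 H2] := differentiable_increment dw e'0.
exists (Num.min d1 d2); first by rewrite lt_min d10.
move=> s; rewrite lt_min => /andP[/H1 + /H2].
have E (W : normedModType R) (L : {linear R -> W}) (h : R) : L h = h *: L 1.
  by rewrite -[in LHS](mulr1 h) -[h * 1]/(h *: (1 : R^o)) linearZ.
rewrite (addrC t) subrK (E W1) Ef (E W2) Ew.
set h := s - t => {}H1 {}H2.
have h1 : `|f s - f t| <= `|h| * `|f'| + e' * `|h|.
  rewrite -normrZ -(subrK (h *: f') (f s - f t)) addrC.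
  by rewrite (le_trans (ler_normD _ _))// lerD2l.
have h2 : `|h| * `|w'| <= `|w s - w t| + e' * `|h|.
  rewrite -normrZ -(subKr (w s - w t) (h *: w')).
  by rewrite (le_trans (ler_normB _ _))// lerD2l.
apply: (le_trans h1).
have h3 : `|h| * `|f'| <= K * (`|h| * `|w'|).
  by rewrite mulrCA ler_wpM2l.
have h4 : K * (`|h| * `|w'|) <= K * (`|w s - w t| + e' * `|h|).
  by rewrite ler_wpM2l.
have <- : (K + 1) * e' = e by rewrite mulrC divfK// gt_eqF.
by lra.
Qed.

Lemma negligible_open_cover (N : set R) (e : R) : mu.-negligible N -> 0 < e ->
  exists U, [/\ open U, N `<=` U & (mu U < e%:E)%E].
Proof.
move=> [B [mB B0 NB]] e0.
have [|U [oU BU mUB]] := lebesgue_regularity_outer mB _ e0.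
  by rewrite [X in (X < _)%E]B0 ltry.
exists U; split=> //; first exact: subset_trans BU.
apply: le_lt_trans mUB.
rewrite -[X in (mu X <= _)%E](setDUK BU).
apply: le_trans (measureU2 _ _ _) _ => //.
  by apply: measurableD => //; exact: measurable_realfun.open_measurable.
by rewrite [X in (X + _ <= _)%E]B0 add0e.
Qed.

Lemma ler_norm_telescope (W : normedModType R) (f : R -> W) a b k tau :
  partition_of a b k tau ->
  `|f b - f a| <= \sum_(i < k) `|f (tau i.+1) - f (tau i)|.
Proof.
move=> [<- <- _]; elim: k => [|k IH]; first by rewrite big_ord0 subrr normr0.
rewrite big_ord_recr /= addrC.
by rewrite (le_trans (ler_distD (f (tau k)) _ _))// lerD2l.
Qed.

(* Away from the exceptional null set the increments of [f] are controlled by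
   those of [w] through differentiability, near it by absolute continuity. *)
Lemma ac_increment_le (W1 W2 : normedModType R) (f : R -> W1) (w : R -> W2)
    (a b : R) (N : set R) (K eta : R) :
  a <= b -> 0 <= K -> abs_continuous_on a b f -> mu.-negligible N ->
  (forall t, a <= t <= b -> ~ N t -> exists f' w',
     [/\ is_derive t (1 : R) f f', is_derive t (1 : R) w w'
       & `|f'| <= K * `|w'|]) ->
  (forall k tau, partition_of a b k tau ->
     \sum_(i < k) `|w (tau i.+1) - w (tau i)| <= eta) ->
  `|f b - f a| <= K * eta.
Proof.
move=> ab K0 acf N0 H Hw; apply/ler_addgt0Pr => e e0.
(* Summed over the good pieces this error is at most [e / 2]; the other half is left for the bad
   pieces. The added 1 covers [a = b]. *)
pose e1 := e / (2 * (b - a + 1)).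
have ba1 : 0 < b - a + 1 by lra.
have e10 : 0 < e1 by rewrite divr_gt0// mulr_gt0.
have [d d0 Hd] := acf (e / 2) (divr_gt0 e0 (ltr0n _ 2)).
have [U [oU NU mUd]] := negligible_open_cover N0 d0.
(* A piece is acceptable if its increment is controlled by differentiability or if it lies in the
   open set [U] of small measure that covers the null set. *)
pose E s t := `|f t - f s| <= K * `|w t - w s| + e1 * (t - s) \/
  `[s, t]%classic `<=` U.
have [t /andP[at_ tb]|k [tau [Htau HE]]] := @cousin_partition R a b E ab.
  have [Ut|nUt] := pselect (U t).
    have /nbhs_normP[r /= r0 Hr] : nbhs t U by exact: open_nbhs_nbhs.
    exists r => //; split=> s _ /andP[s1 s2]; right => x /=;
      rewrite in_itv /= => /andP[x1 x2]; apply: Hr; rewrite /=;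
      rewrite ltr_norml; apply/andP; split; lra.
  have [||f' [w' [Df Dw Hfw]]] := H t; [by rewrite at_|by move=> /NU|].
  have [r r0 Hr] := increment_of_derivative Df Dw K0 Hfw e10.
  exists r => //; split=> s _ /andP[s1 s2]; left.
    have st : `|s - t| = t - s by rewrite distrC ger0_norm// subr_ge0.
    by have := Hr s; rewrite st [`|f s - _|]distrC [`|w s - _|]distrC; apply; lra.
  have st : `|s - t| = s - t by rewrite ger0_norm// subr_ge0.
  by have := Hr s; rewrite st; apply; lra.
pose bad i := `[< `[tau i, tau i.+1]%classic `<=` U >].
have badP i : bad i -> `[tau i, tau i.+1]%classic `<=` U by move/asboolP.
have goodP i : (i < k)%N -> ~~ bad i ->
    `|f (tau i.+1) - f (tau i)| <=
    K * `|w (tau i.+1) - w (tau i)| + e1 * (tau i.+1 - tau i).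
  by move=> /HE[//|bi] /asboolPn.
have lenbad : \sum_(i < k | bad i) (tau i.+1 - tau i) < d.
  rewrite -lte_fin; apply: le_lt_trans mUd.
  have mU : measurable U by exact: measurable_realfun.open_measurable.
  apply: le_trans (partition_length_le Htau mU (fun i _ => @badP i)) _.
  by apply: le_measure; rewrite ?inE//; exact: measurableI.
have Hmono := let: And3 _ _ h := Htau in h.
have bounds := partition_bounds Htau.
have sumbad : \sum_(i < k | bad i) `|f (tau i.+1) - f (tau i)| < e / 2.
  (* Good pieces are collapsed to their left end points, so that absolute continuity applies to the
     family with its indexing unchanged. *)
  have := Hd k tau (fun i => if bad i then tau i.+1 else tau i).
  have -> : \sum_(i < k) `|f (if bad i then tau i.+1 else tau i) - f (tau i)| =
      \sum_(i < k | bad i) `|f (tau i.+1) - f (tau i)|.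
    rewrite [RHS]big_mkcond; apply: eq_bigr => i _.
    by case: ifP => // _; rewrite subrr normr0.
  apply.
  - move=> i ik; have /andP[h1 _] := bounds i (ltnW ik).
    have /andP[h3 h4] := bounds i.+1 ik.
    by case: ifP => _; split=> //; split=> //;
      [exact: Hmono|exact: le_trans (Hmono i ik) h4].
  - by move=> i ik; case: ifP => // _; apply: Hmono; exact: ltnW.
  - apply: le_lt_trans lenbad; rewrite [leRHS]big_mkcond.
    by apply: ler_sum => i _; case: ifP => // _; rewrite subrr.
have sumgood : \sum_(i < k | ~~ bad i) `|f (tau i.+1) - f (tau i)| <=
    K * eta + e1 * (b - a).
  apply: (@le_trans _ _ (\sum_(i < k)
      (K * `|w (tau i.+1) - w (tau i)| + e1 * (tau i.+1 - tau i)))).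
    rewrite big_mkcond; apply: ler_sum => i _; case: ifP => bi.
      exact: goodP.
    by rewrite addr_ge0// mulr_ge0// ?subr_ge0 ?Hmono// ltW.
  rewrite big_split /= -!mulr_sumr lerD//.
    by rewrite ler_wpM2l// Hw.
  have -> : \sum_(i < k) (tau i.+1 - tau i) = b - a.
    rewrite -(big_mkord xpredT (fun i => tau i.+1 - tau i)) telescope_sumr//.
    by case: Htau => -> ->.
  by [].
apply: le_trans (ler_norm_telescope f Htau) _.
rewrite (bigID (fun i : 'I_k => bad i)) /=.
have e1b : e1 * (b - a) <= e / 2.
  have -> : e / 2 = e1 * (b - a + 1) by rewrite /e1; field; lra.
  by rewrite ler_wpM2l ?ltW//; lra.
lra.
Qed.

Lemma ac_partition_sum_lt (W : normedModType R) (w : R -> W) (a b e : R) :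
  abs_continuous_on a b w -> 0 < e ->
  exists2 d, 0 < d & forall s t k tau, a <= s -> t <= b -> t - s < d ->
    partition_of s t k tau ->
    \sum_(i < k) `|w (tau i.+1) - w (tau i)| < e.
Proof.
move=> acw e0; have [d d0 Hd] := acw e e0; exists d => // s t k tau as_ tb std Htau.
have bounds := partition_bounds Htau.
apply: (Hd k tau (fun i => tau i.+1)).
- move=> i ik; have /andP[h1 _] := bounds i (ltnW ik).
  have /andP[_ h2] := bounds i.+1 ik; case: Htau => _ _ /(_ _ ik) h.
  by split; [exact: le_trans h1|split=> //; exact: le_trans h2 _].
- by [].
- rewrite -(big_mkord xpredT (fun i => tau i.+1 - tau i)) telescope_sumr//.
  by case: Htau => -> ->.
Qed.

Lemma abs_continuous_sub (W : normedModType R) (f : R -> W) (a b c d : R) :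
  abs_continuous_on a b f -> a <= c -> d <= b -> abs_continuous_on c d f.
Proof.
move=> acf ac db e e0; have [r r0 H] := acf e e0; exists r => // m s t Hst.
apply: H => i /Hst[h1 [h2 h3]].
by split; [exact: le_trans h1|split=> //; exact: le_trans h3 _].
Qed.

(* Gronwall's lemma for a coefficient that is merely integrable: its integral
   is replaced by the variation of [w]. *)
Lemma gronwall_zero (W1 W2 : normedModType R) (z : R -> W1) (w : R -> W2)
    (a b c : R) (N : set R) (C B : R) :
  a <= c <= b -> 0 <= C -> z c = 0 -> abs_continuous_on a b z ->
  mu.-negligible N ->
  (forall t, a <= t <= b -> `|z t| <= B) ->
  (forall t, a <= t <= b -> ~ N t -> exists z' w',
     [/\ is_derive t (1 : R) z z', is_derive t (1 : R) w w'
       & `|z'| <= C * `|w'| * `|z t|]) ->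
  (forall s t k tau, a <= s -> t <= b -> partition_of s t k tau ->
     C * \sum_(i < k) `|w (tau i.+1) - w (tau i)| <= 2^-1) ->
  forall t, a <= t <= b -> z t = 0.
Proof.
move=> /andP[ac cb] C0 zc acz N0 HB H Hw.
have halve M : 0 <= M -> (forall t, a <= t <= b -> `|z t| <= M) ->
    forall t, a <= t <= b -> `|z t| <= M / 2.
  move=> M0 HM t /andP[at_ tb].
  have key s u : a <= s -> s <= u -> u <= b -> `|z u - z s| <= M / 2.
    move=> as_ su ub.
    apply: (@ac_increment_le _ _ z (C \*: w) s u N) => //.
    - exact: abs_continuous_sub acz as_ ub.
    - move=> v /andP[v1 v2].
      have vab : a <= v <= b by rewrite (le_trans as_ v1) (le_trans v2 ub).
      move=> /(H v vab)[z' [w' [Dz Dw Hz']]]; exists z', (C *: w'); split=> //.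
        exact: is_deriveZ.
      apply: le_trans Hz' _; rewrite normrZ (ger0_norm C0) mulrC.
      by rewrite ler_wpM2r ?mulr_ge0// HM.
    - move=> k tau Htau; apply: le_trans (Hw s u k tau as_ ub Htau).
      rewrite mulr_sumr ler_sum// => i _.
      by rewrite -scalerBr normrZ (ger0_norm C0).
  have [tc|ct] := leP t c.
    by have := key t c at_ tc cb; rewrite zc sub0r normrN.
  by have := key c t ac (ltW ct) tb; rewrite zc subr0.
have B0 : 0 <= B by apply: le_trans (HB c _); rewrite ?ac.
have iterB n : forall t, a <= t <= b -> `|z t| <= B / 2 ^+ n.
  elim: n => [|n IH]; first by move=> t /HB; rewrite expr0 divr1.
  move=> t tab; rewrite exprSr invfM mulrA; apply: halve => //.
  by rewrite divr_ge0// exprn_ge0.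
move=> t tab; apply/eqP; rewrite -normr_le0 leNgt; apply/negP => zt.
have [n Hn] : exists n : nat, B / `|z t| < n%:R.
  exists (Num.bound (B / `|z t|)).
  by apply: archi_boundP; rewrite divr_ge0.
have := iterB n t tab; rewrite ler_pdivlMr ?exprn_gt0//; apply/negP; rewrite -ltNge.
move: Hn; rewrite ltr_pdivrMr// => Hn; apply: lt_le_trans Hn _.
rewrite [leRHS]mulrC ler_wpM2r// -natrX ler_nat ltnW//.
exact: ltn_expl.
Qed.

End AbsolutelyContinuousIncrement.

(** * Inversion of matrices: local bounds and derivative along curves *)

Section InverseMatrix.
Context {R : realType} {p : nat}.
Implicit Types M : 'M[R]_p.

(** If [v *m M = 0] then [v = v *m (M0 - M) *m invmx M0], of norm at most half that of [v], so
    [v = 0]. The same estimate, applied to [invmx M] itself, bounds its norm by twice that of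
    [invmx M0]. *)
Lemma invmx_near M0 : M0 \in unitmx ->
  exists r B : R, [/\ 0 < r, 0 <= B &
    forall M, `|M - M0| < r -> M \in unitmx /\ `|invmx M| <= B].
Proof.
move=> uM0.
pose c := p%:R * p%:R * `|invmx M0| + 1.
have c0 : 0 < c by rewrite ltr_wpDl// !mulr_ge0.
have small q (v : 'M[R]_(q, p)) M : `|M - M0| < (2 * c)^-1 ->
    `|v *m (M0 - M) *m invmx M0| <= 2^-1 * `|v|.
  move=> HM; apply: (le_trans (mulmx_norm _ _)).
  apply: (@le_trans _ _ (p%:R * (p%:R * `|v| * `|M0 - M|) * `|invmx M0|)).
    by rewrite ler_wpM2r// ler_wpM2l// mulmx_norm.
  rewrite [`|M0 - M|]distrC.
  rewrite (_ : p%:R * _ * _ = (p%:R * p%:R * `|invmx M0|) * `|M - M0| * `|v|);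
    last by ring.
  rewrite ler_wpM2r//; apply: (@le_trans _ _ (c * (2 * c)^-1)).
    apply: ler_pM => //; rewrite ?mulr_ge0//; first by rewrite lerDl.
    exact: ltW.
  by rewrite invfM mulrCA divff ?mulr1// gt_eqF.
exists (2 * c)^-1, (2 * `|invmx M0|); split; rewrite ?mulr_ge0//.
  by rewrite invr_gt0 mulr_gt0.
move=> M HM.
have uM : M \in unitmx.
  rewrite -row_free_unit; apply: inj_row_free => v vM.
  have := small _ v M HM.
  rewrite mulmxBr vM subr0 mulmxK// => h.
  by apply/eqP; rewrite -normr_le0; lra.
split=> //.
have E : invmx M = invmx M0 + invmx M *m (M0 - M) *m invmx M0.
  by rewrite mulmxBr mulVmx// mulmxBl mulmxK// mul1mx addrC subrK.
have := small _ (invmx M) M HM.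
have : `|invmx M| <= `|invmx M0| + `|invmx M *m (M0 - M) *m invmx M0|.
  by rewrite {1}E ler_normD.
lra.
Qed.

Lemma invmxB M M' : M \in unitmx -> M' \in unitmx ->
  invmx M - invmx M' = invmx M *m (M' - M) *m invmx M'.
Proof.
by move=> uM uM'; rewrite mulmxBr mulVmx// mulmxBl mulmxK// mul1mx.
Qed.

End InverseMatrix.

Lemma linear_scalar (R : realType) (W : normedModType R) (L : {linear R -> W})
    (h : R) : L h = h *: L 1.
Proof. by rewrite -[in LHS](mulr1 h) -[h * 1]/(h *: (1 : R^o)) linearZ. Qed.

Section CurveIncrement.
Context {R : realType} {W : normedModType R}.

Lemma is_derive_increment (f : R -> W) t df :
  is_derive t (1 : R) f df ->
  forall e : R, 0 < e -> exists2 d : R, 0 < d &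
    forall h : R, `|h| < d -> `|f (t + h) - f t - h *: df| <= e * `|h|.
Proof.
move=> /is_derive_differentiable[Df <-] e e0.
have [d d0 H] := differentiable_increment Df e0; exists d => // h /H.
by rewrite (linear_scalar ('d f t) h).
Qed.

Lemma is_derive_of_increment (f : R -> W) t df :
  (forall e : R, 0 < e -> exists2 d : R, 0 < d &
    forall h : R, `|h| < d -> `|f (t + h) - f t - h *: df| <= e * `|h|) ->
  is_derive t (1 : R) f df.
Proof.
move=> H.
have lin : linear ( *:%R ^~ df : R -> W).
  by move=> u y z; rewrite scalerDl scalerA.
pose LM := GRing.isLinear.Build _ _ _ _ _ lin.
pose L : {linear R -> W} := HB.pack ( *:%R ^~ df : R -> W) LM.
have cL : continuous L by exact: scalel_continuous.
have [Df E] := differentiable_of_increment cL H.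
by apply: is_derive_eq (differentiable_is_derive _ Df) _; rewrite E /= scale1r.
Qed.

Lemma is_derive_lipschitz (f : R -> W) t df :
  is_derive t (1 : R) f df -> exists2 d : R, 0 < d &
    forall h : R, `|h| < d -> `|f (t + h) - f t| <= (`|df| + 1) * `|h|.
Proof.
move=> /is_derive_increment/(_ 1 ltr01)[d d0 H]; exists d => // h /H Hh.
rewrite -(subrK (h *: df) (f (t + h) - f t)).
rewrite (le_trans (ler_normD _ _))// normrZ mulrDl addrC.
by rewrite lerD// mulrC.
Qed.

End CurveIncrement.

Lemma mulmx3_norm (R : realType) p q r s (A : 'M[R]_(p, q)) (B : 'M[R]_(q, r))
    (C : 'M[R]_(r, s)) :
  `|A *m B *m C| <= q%:R * r%:R * `|A| * `|B| * `|C|.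
Proof.
apply: (le_trans (mulmx_norm _ _)); rewrite [q%:R * _]mulrC -!mulrA ler_wpM2l//.
by rewrite !mulrA ler_wpM2r// mulmx_norm.
Qed.

(** Two uses of the identity [invmxB] split the error into a term quadratic in the increment of [f]
    and the linearisation error of [f] between two bounded inverses. *)
Lemma is_derive_invmx (R : realType) p (f : R -> 'M[R]_p) t df :
  is_derive t (1 : R) f df -> f t \in unitmx ->
  is_derive t (1 : R) (fun s => invmx (f s))
    (- (invmx (f t) *m df *m invmx (f t))).
Proof.
move=> Df uft.
have [r [B [r0 B0 HB]]] := invmx_near uft.
have [d1 d10 H1] := is_derive_lipschitz Df.
set D := `|df| + 1 in H1.
have D0 : 0 < D by rewrite ltr_wpDl.
apply: is_derive_of_increment => e e0.
pose c : R := p%:R * p%:R.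
have c0 : 0 <= c by rewrite mulr_ge0.
pose k2 := c * B * B + 1.
have k20 : 0 < k2 by rewrite ltr_wpDl// !mulr_ge0.
have [d2 d20 H2] := is_derive_increment Df (divr_gt0 e0 (mulr_gt0 (ltr0n _ 2) k20)).
(* [k1] bounds the coefficient of the quadratic term and [k2] that of the linearisation error; each
   term is to contribute at most [e / 2 * |h|]. *)
pose k1 := c * c * B * B * B * D * D + 1.
have k10 : 0 < k1 by rewrite ltr_wpDl// !mulr_ge0 ?(ltW D0).
exists (Num.min (Num.min d1 (r / D)) (Num.min d2 (e / (2 * k1)))).
  by rewrite !lt_min d10 d20 !divr_gt0// mulr_gt0.
move=> h; rewrite !lt_min => /andP[/andP[hd1 hr] /andP[hd2 he]].
have Hh1 := H1 h hd1; have Hh2 := H2 h hd2.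
set Delta := f (t + h) - f t in Hh1 Hh2.
have [uh Bh] : f (t + h) \in unitmx /\ `|invmx (f (t + h))| <= B.
  apply: HB; apply: le_lt_trans Hh1 _.
  by rewrite mulrC -ltr_pdivlMr.
have [_ Bt] : f t \in unitmx /\ `|invmx (f t)| <= B.
  by apply: HB; rewrite subrr normr0.
set I0 := invmx (f t) in Bt *; set I1 := invmx (f (t + h)) in Bh *.
have -> : I1 - I0 - h *: - (I0 *m df *m I0) =
    I1 *m Delta *m (I0 *m Delta *m I0) - I0 *m (Delta - h *: df) *m I0.
  have E : I1 - I0 = - (I1 *m Delta *m I0).
    by rewrite invmxB// -mulNmx -mulmxN opprB.
  have -> : I1 *m Delta *m (I0 *m Delta *m I0) = (I0 - I1) *m Delta *m I0.
    by rewrite -(opprB I1) E opprK !mulmxA.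
  rewrite (mulmxBr I0) (mulmxBl (I0 *m Delta)) -scalemxAr -scalemxAl.
  rewrite (mulmxBl I0) (mulmxBl (I0 *m Delta)) E scalerN opprK opprB.
  by rewrite addrC [X in _ = X]addrC addrA subrK.
have n1 : `|I1 *m Delta *m (I0 *m Delta *m I0)| <= k1 * `|h| * `|h|.
  apply: le_trans (mulmx3_norm _ _ _) _.
  apply: (@le_trans _ _ (c * B * (D * `|h|) * (c * B * (D * `|h|) * B))).
    have h0 : 0 <= c * B * (D * `|h|) by rewrite !mulr_ge0 ?(ltW D0).
    have hD : c * `|I1| * `|Delta| <= c * B * (D * `|h|).
      by rewrite ler_pM ?mulr_ge0// ler_wpM2l.
    apply: ler_pM; rewrite ?mulr_ge0//.
    apply: le_trans (mulmx3_norm _ _ _) _; rewrite -/c.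
    by rewrite ler_pM ?mulr_ge0// ler_pM ?mulr_ge0// ler_wpM2l.
  rewrite (_ : _ * _ = (k1 - 1) * (`|h| * `|h|)); last by rewrite /k1; ring.
  by rewrite -mulrA ler_wpM2r ?mulr_ge0// gerBl.
have n2 : `|I0 *m (Delta - h *: df) *m I0| <= e / 2 * `|h|.
  apply: le_trans (mulmx3_norm _ _ _) _; rewrite -/c.
  apply: (@le_trans _ _ (c * B * (e / (2 * k2) * `|h|) * B)).
    by rewrite ler_pM ?mulr_ge0// ler_pM ?mulr_ge0// ler_wpM2l.
  rewrite (_ : _ * B = (c * B * B) * (e / (2 * k2) * `|h|)); last by ring.
  apply: (@le_trans _ _ (k2 * (e / (2 * k2) * `|h|))).
    apply: ler_wpM2r; last by rewrite lerDl.
    by rewrite mulr_ge0// divr_ge0 ?mulr_ge0 ?(ltW k20) ?(ltW e0).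
  rewrite (_ : k2 * _ = e / 2 * `|h|)//; field; exact: lt0r_neq0.
have n3 : k1 * `|h| * `|h| <= e / 2 * `|h|.
  rewrite ler_wpM2r//; move: he; rewrite ltr_pdivlMr ?mulr_gt0//; nra.
by rewrite (le_trans (ler_normB _ _))//; lra.
Qed.

(* The form in which absolute continuity is passed from [w] on to [f]. *)
Definition dominated_on (R : realType) (T : Type) (V W : normedModType R)
    (I : set T) (w : T -> V) (f : T -> W) := exists L B : R, [/\ 0 <= L, 0 <= B,
  forall s t, I s -> I t -> `|f t - f s| <= L * `|w t - w s|
  & forall t, I t -> `|f t| <= B].

Section Dominated.
Context {R : realType} {T : Type} {V : normedModType R}.
Variables (I : set T) (w : T -> V).

Lemma dominated_cst (W : normedModType R) (x : W) : dominated_on I w (cst x).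
Proof. by exists 0, `|x|; split=> // s t _ _; rewrite subrr normr0 mul0r. Qed.

Lemma dominatedB (W : normedModType R) (f g : T -> W) :
  dominated_on I w f -> dominated_on I w g ->
  dominated_on I w (fun t => f t - g t).
Proof.
move=> [L [B [L0 B0 H HB]]] [L' [B' [L0' B0' H' HB']]].
exists (L + L'), (B + B'); split; [exact: addr_ge0|exact: addr_ge0|move=> s t Is It|move=> t It].
  have -> : f t - g t - (f s - g s) = (f t - f s) - (g t - g s).
    by rewrite !opprB addrACA [- g t + _]addrC addrAC -!addrA [g s + _]addrC.
  rewrite mulrDl.
  by rewrite (le_trans (ler_normB _ _))// lerD// ?H ?H'.
by rewrite (le_trans (ler_normB _ _))// lerD// ?HB ?HB'.
Qed.

Lemma dominated_mulmx p q r (f : T -> 'M[R]_(p, q)) (g : T -> 'M[R]_(q, r)) :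
  dominated_on I w f -> dominated_on I w g ->
  dominated_on I w (fun t => f t *m g t).
Proof.
move=> [L [B [L0 B0 H HB]]] [L' [B' [L0' B0' H' HB']]].
exists (q%:R * (L * B' + B * L')), (q%:R * B * B').
split; [by rewrite !(mulr_ge0, addr_ge0)|by rewrite !mulr_ge0|
  move=> s t Is It|move=> t It]; last first.
  rewrite (le_trans (mulmx_norm _ _))// -!mulrA ler_wpM2l//.
  by rewrite ler_pM// ?HB ?HB'.
have -> : f t *m g t - f s *m g s = (f t - f s) *m g t + f s *m (g t - g s).
  by rewrite mulmxBl mulmxBr addrA subrK.
rewrite (le_trans (ler_normD _ _))// -mulrA mulrDl mulrDr; apply: lerD.
  rewrite (le_trans (mulmx_norm _ _))// -mulrA ler_wpM2l//.
  by rewrite mulrAC ler_pM// ?H ?HB'.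
rewrite (le_trans (mulmx_norm _ _))// -mulrA ler_wpM2l//.
by rewrite -mulrA ler_pM// ?HB ?H'.
Qed.

Lemma dominated_invmx p (f : T -> 'M[R]_p) (B : R) : 0 <= B ->
  (forall t, I t -> f t \in unitmx /\ `|invmx (f t)| <= B) ->
  dominated_on I w f -> dominated_on I w (fun t => invmx (f t)).
Proof.
move=> B0 HB [L [B' [L0 B0' H _]]].
exists (p%:R * p%:R * B * L * B), B.
split; [by rewrite !mulr_ge0|by []|move=> s t Is It|by move=> t /HB[]].
have [us Bs] := HB s Is; have [ut Bt] := HB t It.
rewrite invmxB// (le_trans (mulmx3_norm _ _ _))//.
have -> : p%:R * p%:R * B * L * B * `|w t - w s| =
    p%:R * p%:R * B * (L * `|w t - w s|) * B by ring.
by rewrite ler_pM ?mulr_ge0// ler_pM ?mulr_ge0// ?ler_wpM2l ?mulr_ge0//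
  distrC H.
Qed.

End Dominated.

Lemma dominated_abs_continuous (R : realType) (V W : normedModType R)
    (w : R -> V) (f : R -> W) (a b : R) :
  dominated_on `[a, b]%classic w f -> abs_continuous_on a b w ->
  abs_continuous_on a b f.
Proof.
move=> [L [_ [L0 _ H _]]] acw e e0.
have L1 : 0 < L + 1 by rewrite ltr_wpDl.
have [d d0 Hd] := acw (e / (L + 1)) (divr_gt0 e0 L1).
exists d => // m s t Hst Hts Hl.
have := Hd m s t Hst Hts Hl; rewrite ltr_pdivlMr//; apply: le_lt_trans.
rewrite mulr_suml; apply: ler_sum => i _.
have [h1 [h2 h3]] := Hst i (ltn_ord i).
apply: (@le_trans _ _ (L * `|w (t i) - w (s i)|)).
  apply: H; rewrite /= in_itv /= ?h1 ?h3 ?andbT; first exact: le_trans h3.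
  exact: le_trans h2.
by rewrite mulrC ler_wpM2l// lerDl.
Qed.

(** * Immersions in coordinates *)

Section CkCalculus.
Context {R : realType}.
Implicit Types V W : normedModType R.

Lemma Ck_on_ext V W k (U : set V) (f g : V -> W) : open U ->
  (forall x, U x -> f x = g x) -> Ck_on k U f -> Ck_on k U g.
Proof.
move=> oU; elim: k f g => [|k IH] f g fg /=.
  move=> cf x Ux; rewrite /prop_for /continuous_at -(fg x Ux).
  apply: cvg_trans (cf x Ux); apply: near_eq_cvg.
  have : nbhs x U by exact: open_nbhs_nbhs.
  by apply: filterS => y /fg.
move=> [df dfC].
have H x : U x -> differentiable g x /\ 'd g x = 'd f x :> (V -> W).
  move=> Ux; apply: near_eq_differentiable; last exact: df.
  have : nbhs x U by exact: open_nbhs_nbhs.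
  by apply: filterS => y /fg.
split=> [x /H[]//|v].
by apply: IH (dfC v) => x /H[_ ->].
Qed.

Lemma Ck_on_sub V W k (U U' : set V) (f : V -> W) : U' `<=` U ->
  Ck_on k U f -> Ck_on k U' f.
Proof.
move=> sU; elim: k f => [|k IH] f /=; first by move=> cf x /sU/cf.
by move=> [df dfC]; split=> [x /sU/df//|v]; exact: IH.
Qed.

Lemma Ck_onS V W k (U : set V) (f : V -> W) : Ck_on k.+1 U f -> Ck_on k U f.
Proof.
elim: k f => [|k IH] f.
  by move=> [df _] x /df/differentiable_continuous.
by move=> [df dfC]; split=> // v; exact: IH.
Qed.

Lemma Ck_onD V W k (U : set V) (f g : V -> W) : open U ->
  Ck_on k U f -> Ck_on k U g -> Ck_on k U (f + g).
Proof.
move=> oU; elim: k f g => [|k IH] f g /=.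
  by move=> cf cg x Ux; apply: cvgD; [exact: cf|exact: cg].
move=> [df dfC] [dg dgC]; split=> [x Ux|v].
  by apply: differentiableD; [exact: df|exact: dg].
apply: Ck_on_ext oU _ (IH _ _ (dfC v) (dgC v)) => x Ux.
by rewrite diffD//; [exact: df|exact: dg].
Qed.

Lemma Ck_on_cst V W k (U : set V) (a : W) : Ck_on k U (cst a).
Proof.
elim: k a => [|k IH] a /=; first by move=> x _; exact: cvg_cst.
split=> [x _|v]; first exact: differentiable_cst.
have -> : (fun x : V => 'd (cst a) x v) = cst 0.
  by apply/funext => x; rewrite diff_cst.
exact: IH.
Qed.

Lemma Ck_on_sum V W k (U : set V) p (f : 'I_p -> V -> W) : open U ->
  (forall i, Ck_on k U (f i)) -> Ck_on k U (\sum_(i < p) f i).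
Proof.
move=> oU; elim: p f => [|p IH] f H; first by rewrite big_ord0; exact: Ck_on_cst.
by rewrite big_ord_recr; apply: Ck_onD => //; exact: IH.
Qed.

Lemma Ck_on_linear V W W' k (U : set V) (f : V -> W) (L : {linear W -> W'}) :
  open U -> continuous L -> Ck_on k U f -> Ck_on k U (L \o f).
Proof.
move=> oU cL; elim: k f => [|k IH] f /=.
  by move=> cf x Ux; apply: continuous_comp; [exact: cf|exact: cL].
have dL y : differentiable L y by exact: linear_differentiable.
move=> [df dfC]; split=> [x Ux|v].
  by apply: differentiable_comp; [exact: df|exact: dL].
apply: Ck_on_ext oU _ (IH _ (dfC v)) => x Ux.
by rewrite diff_comp//=; [rewrite diff_lin|exact: df].
Qed.

Lemma Ck_on_affine V W k (U : set V) (f : V -> W) (x0 w : V) :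
  open U -> Ck_on k U f ->
  Ck_on k [set t : R | U (x0 + t *: w)] (fun t => f (x0 + t *: w)).
Proof.
move=> oU.
have D t : is_derive t (1 : R) (fun t : R => x0 + t *: w) w.
  apply: is_derive_of_increment => e e0; exists 1 => // h _.
  by rewrite scalerDl addrA (addrC _ (h *: w)) addrK subrr normr0 mulr_ge0// ltW.
have dD t := is_derive_differentiable (D t).
have oU' : open [set t : R | U (x0 + t *: w)].
  by apply: open_comp => // t _; apply: differentiable_continuous; case: (dD t).
elim: k f => [|k IH] f /=.
  move=> cf t Ut; apply: (@continuous_comp _ _ _ (fun t : R => x0 + t *: w) f).
    by apply: differentiable_continuous; case: (dD t).
  exact: cf.
move=> [df dfC]; split=> [t Ut|v].
  apply: (@differentiable_comp _ _ _ _ (fun t : R => x0 + t *: w) f).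
    by case: (dD t).
  exact: df.
apply: Ck_on_ext oU' _ (IH _ (dfC (v *: w))) => t Ut.
rewrite (@diff_comp _ _ _ _ (fun t : R => x0 + t *: w) f); last 2 first.
- by case: (dD t).
- exact: df.
by rewrite /= linear_scalar; case: (dD t) => _ ->.
Qed.

(** [Ck_on] speaks of directional derivatives only. The jacobian is the sum of fixed linear maps,
    each placing one row, applied to the derivatives along the basis vectors. *)
Lemma Ck_on_jac p q k (U : set 'rV[R]_p) (f : 'rV[R]_p -> 'rV[R]_q) :
  open U -> Ck_on k.+1 U f -> Ck_on k U (jac f).
Proof.
move=> oU [df dfC].
pose L (i : 'I_p) : {linear 'rV[R]_q -> 'M[R]_(p, q)} := mulmx (delta_mx i 0).
apply: (@Ck_on_ext _ _ k U (\sum_(i < p) (L i \o (fun x => 'd f x (delta_mx 0 i))))).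
- by [].
- move=> x Ux; have [_ H] := has_jac_jac (df x Ux).
  rewrite fct_sumE; apply/row_matrixP => i.
  rewrite linear_sum (bigD1 i)//= big1 ?addr0; last first.
    move=> j ji; rewrite row_mul (_ : row i _ = 0) ?mul0mx//.
    by apply/rowP => k'; rewrite !mxE eq_sym (negbTE ji).
  rewrite row_mul (_ : row i _ = 1%:M) ?mul1mx ?H -?rowE//.
  by apply/rowP => k'; rewrite !mxE eqxx ord1.
- apply: Ck_on_sum => // i; apply: Ck_on_linear => //; last exact: dfC.
  exact: linear_mx_continuous.
Qed.

Lemma diff_jac p q (U : set 'rV[R]_p) (f : 'rV[R]_p -> 'rV[R]_q) x X Y :
  open U -> Ck_on 2 U f -> U x ->
  'd (fun z => 'd f z Y) x X = Y *m 'd (jac f) x X.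
Proof.
move=> oU f2 Ux; have [df _] := f2.
have [dJ _] := Ck_on_jac oU f2.
pose L : {linear 'M[R]_(p, q) -> 'rV[R]_q} := mulmx Y.
have cL : continuous L by exact: linear_mx_continuous.
have E : \forall z \near x, (L \o jac f) z = 'd f z Y.
  have : nbhs x U by exact: open_nbhs_nbhs.
  by apply: filterS => z /df/has_jac_jac[_ ->].
have dLJ : differentiable (L \o jac f) x.
  by apply: differentiable_comp; [exact: dJ|exact: linear_differentiable].
have [_ ->] := near_eq_differentiable E dLJ.
by rewrite diff_comp; [rewrite /= diff_lin|exact: dJ|exact: linear_differentiable].
Qed.

End CkCalculus.

Lemma mulmx_le (R : realType) p q r (A : 'M[R]_(p, q)) (B : 'M[R]_(q, r))
    (a b : R) : `|A| <= a -> `|B| <= b -> `|A *m B| <= q%:R * a * b.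
Proof.
move=> Aa Bb; apply: le_trans (mulmx_norm _ _) _.
by rewrite ler_pM ?mulr_ge0// ler_wpM2l.
Qed.

Section ImmersionChart.
Context {R : realType} {m q : nat}.
Variables (U : set 'rV[R]_m) (F : 'rV[R]_m -> 'rV[R]_q).
Hypotheses (oU : open U) (F2 : Ck_on 2 U F).
Local Notation J := (jac F).

Lemma immersion_has_jac u : U u -> has_jac F u (J u).
Proof. by case: F2 => df _ /df/has_jac_jac. Qed.

Lemma immersion_expansion u0 : U u0 -> forall eta : R, 0 < eta ->
  exists2 r : R, 0 < r & forall u u', `|u - u0| < r -> `|u' - u0| < r ->
    [/\ U u, U u', `|F u' - F u - (u' - u) *m J u0| <= eta * `|u' - u|
      & `|J u' - J u| <= eta].
Proof.
move=> Uu0 eta eta0.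
have F1 := Ck_onS F2.
have [r1 r10 H1] := strictly_differentiable oU F1 Uu0 eta0.
have [r2 [L [r20 L0 H2]]] := C1_lipschitz oU (Ck_on_jac oU F2) Uu0.
have L1 : 0 < 2 * (L + 1) by rewrite mulr_gt0// ltr_wpDl.
exists (Num.min r1 (Num.min r2 (eta / (2 * (L + 1))))).
  by rewrite !lt_min r10 r20 divr_gt0.
move=> u u'; rewrite !lt_min => /and3P[u1 u2 u3] /and3P[u1' u2' u3'].
have [Uu Uu' H] := H1 u u' u1 u1'; split=> //.
  by move: H; rewrite (proj2 (immersion_has_jac Uu0)).
apply: le_trans (H2 u u' u2 u2') _.
have : `|u' - u| <= 2 * (eta / (2 * (L + 1))).
  rewrite -(subrKA u0) mulr_natl mulr2n; apply: le_trans (ler_normD _ _) _.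
  by rewrite lerD ?(distrC u0) ?ltW.
move=> h; apply: le_trans (ler_wpM2l L0 h) _.
rewrite (_ : L * _ = eta * (L / (L + 1))); last by field; lra.
by rewrite -[leRHS]mulr1 ler_wpM2l ?(ltW eta0)// ler_pdivrMr ?mul1r; lra.
Qed.

(* In the ball of radius [r] around [u0] the component [F u *m P] is a local
   diffeomorphism, so it can be used as a coordinate on the submanifold. *)
Record adapted u0 (P : 'M[R]_(q, m)) (r B : R) := Adapted {
  adapted_r : 0 < r ;
  adapted_B : 0 <= B ;
  adapted_U : forall u, `|u - u0| < r -> U u ;
  adapted_P : forall u u', `|u - u0| < r -> `|u' - u0| < r ->
    `|F u' *m P - F u *m P - (u' - u)| <= 2^-1 * `|u' - u| ;
  adapted_F : forall u u', `|u - u0| < r -> `|u' - u0| < r ->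
    `|F u' - F u| <= B * `|u' - u| ;
  adapted_J : forall u u', `|u - u0| < r -> `|u' - u0| < r ->
    `|J u' - J u| <= B * `|u' - u| ;
  adapted_Jle : forall u, `|u - u0| < r -> `|J u| <= B ;
  adapted_K : forall u, `|u - u0| < r ->
    J u *m P \in unitmx /\ `|invmx (J u *m P)| <= B }.

(** [P] is a right inverse of [J u0], so [F u *m P] has the identity as derivative at [u0]: it is
    near-identity on a small ball, and [J u *m P] stays invertible there. *)
Lemma adapted_exists u0 r0 : U u0 -> row_free (J u0) -> 0 < r0 ->
  exists P r B, r <= r0 /\ adapted u0 P r B.
Proof.
move=> Uu0 /row_freeP[P JP] r00.
(* After multiplication by [P] the error in the expansion of [F] must not exceed half the
   displacement. *)
pose eta := (2 * (q%:R * `|P| + 1))^-1.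
have qP : 0 < q%:R * `|P| + 1 by rewrite ltr_wpDl// mulr_ge0.
have eta0 : 0 < eta by rewrite invr_gt0 mulr_gt0.
have [r1 r10 H1] := immersion_expansion Uu0 eta0.
have [r2 [B2 [r20 B20 H2]]] := C1_lipschitz oU (Ck_onS F2) Uu0.
have [r3 [B3 [r30 B30 H3]]] := C1_lipschitz oU (Ck_on_jac oU F2) Uu0.
have [r4 [B4 [r40 B40 H4]]] := @invmx_near R m 1%:M (unitmx1 _ _).
have B31 : 0 < q%:R * B3 * `|P| + 1 by rewrite ltr_wpDl// !mulr_ge0.
pose r := Num.min (Num.min r0 r1) (Num.min (Num.min r2 r3)
  (Num.min 1 (r4 / (q%:R * B3 * `|P| + 1)))).
have rr0 : 0 < r by rewrite !lt_min r00 r10 r20 r30 ltr01 divr_gt0.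
(* One constant for all bounds: [B2] and [B3] are Lipschitz constants of [F] and [J], [B4] bounds
   the inverse, and the last bracket bounds [J] because [r <= 1]. *)
pose B := B2 + B3 + B4 + (`|J u0| + B3).
exists P, r, B; split; first by rewrite /r !ge_min lexx.
have rE u : `|u - u0| < r -> [/\ `|u - u0| < r1, `|u - u0| < r2,
    `|u - u0| < r3, `|u - u0| < 1 & `|u - u0| * (q%:R * B3 * `|P| + 1) < r4].
  rewrite /r !lt_min => /andP[/andP[_ ->] /andP[/andP[-> ->] /andP[-> ]]].
  by rewrite ltr_pdivlMr// => ->.
have u0r : `|u0 - u0| < r by rewrite subrr normr0.
have JB u : `|u - u0| < r -> `|J u - J u0| <= B3 * `|u - u0|.
  by move=> /rE[_ _ h _ _]; apply: H3; rewrite ?subrr ?normr0.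
split.
- by [].
- by rewrite !addr_ge0.
- by move=> u /rE[h _ _ _ _]; have [] := H1 u u h h.
- move=> u u' /rE[h _ _ _ _] /rE[h' _ _ _ _].
  have [_ _ E _] := H1 u u' h h'.
  have -> : F u' *m P - F u *m P - (u' - u) =
      (F u' - F u - (u' - u) *m J u0) *m P.
    by rewrite !mulmxBl -!mulmxA JP !mulmx1.
  apply: le_trans (mulmx_norm _ _) _.
  apply: (@le_trans _ _ (q%:R * (eta * `|u' - u|) * `|P|)).
    by rewrite ler_wpM2r// ler_wpM2l.
  rewrite (_ : _ * `|P| = eta * (q%:R * `|P|) * `|u' - u|); last by ring.
  rewrite ler_wpM2r// /eta invfM -mulrA -[leRHS]mulr1 ler_wpM2l//.
  by rewrite ler_pdivrMl// mulr1 lerDl.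
- move=> u u' /rE[_ h _ _ _] /rE[_ h' _ _ _]; apply: le_trans (H2 u u' h h') _.
  by rewrite ler_wpM2r// /B -!addrA lerDl !addr_ge0.
- move=> u u' /rE[_ _ h _ _] /rE[_ _ h' _ _]; apply: le_trans (H3 u u' h h') _.
  rewrite ler_wpM2r// /B; have := normr_ge0 (J u0); lra.
- move=> u ur; have [_ _ _ u1 _] := rE u ur; have h := JB u ur.
  have : `|J u| <= `|J u0| + `|J u - J u0|.
    by rewrite -{1}(subrKC (J u0) (J u)) ler_normD.
  have : B3 * `|u - u0| <= B3 by rewrite -[leRHS]mulr1 ler_wpM2l// ltW.
  rewrite /B; lra.
- move=> u ur; have [_ _ _ _ u4] := rE u ur.
  have [|uK bK] := H4 (J u *m P); last first.
    by split=> //; apply: le_trans bK _; rewrite /B; have := normr_ge0 (J u0); lra.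
  rewrite -JP -mulmxBl; apply: le_lt_trans (mulmx_norm _ _) _.
  apply: le_lt_trans u4.
  apply: (@le_trans _ _ (q%:R * (B3 * `|u - u0|) * `|P|)).
    by rewrite ler_wpM2r// ler_wpM2l// JB.
  rewrite (_ : _ * `|P| = `|u - u0| * (q%:R * B3 * `|P|)); last by ring.
  by rewrite ler_wpM2l// lerDl.
Qed.

Section Adapted.
Variables (u0 : 'rV[R]_m) (P : 'M[R]_(q, m)) (r B : R).
Hypothesis H : adapted u0 P r B.

Lemma adapted_lipschitz u u' : `|u - u0| < r -> `|u' - u0| < r ->
  `|u' - u| <= 2 * `|F u' *m P - F u *m P|.
Proof.
move=> ur ur'; apply: (@near_identity_expansion _ _ (fun v => F v *m P)).
exact: adapted_P H _ _ ur ur'.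
Qed.

Lemma adapted_surjective z : `|z - F u0 *m P| < r / 4 ->
  exists2 u, `|u - u0| < r & F u *m P = z.
Proof.
move=> zr; apply: (@near_identity_surjective _ _ (fun v => F v *m P) _ r) => //.
  exact: adapted_r H.
by move=> x y xr yr; exact: (adapted_P H xr yr).
Qed.

Local Notation K u := (invmx (J u *m P)).

(** Implicit differentiation of [F u *m P = y *m P] without prior regularity of [u]. By
    [adapted_lipschitz] the increment of [u] is of the order of that of [y], so the linearisation
    error of [F] is negligible and [J *m P] can be inverted. *)
Lemma adapted_derive (u : R -> 'rV[R]_m) (y : R -> 'rV[R]_q) t y' :
  (\forall s \near t, `|u s - u0| < r /\ F (u s) *m P = y s *m P) ->
  is_derive t (1 : R) y y' -> is_derive t (1 : R) u (y' *m P *m K (u t)).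
Proof.
move=> Hu Dy.
have [utr Eut] := nbhs_singleton Hu.
have [uK bK] := adapted_K H utr.
have HP : is_derive t (1 : R) (fun s => y s *m P) (y' *m P).
  apply: is_derive_eq (is_derive_mulmx Dy (is_derive_cst P t 1)) _.
  by rewrite mulmx0 addr0.
have [d1 d10 H1] := is_derive_lipschitz HP.
set D := `|_| + 1 in H1.
have D0 : 0 < D by rewrite ltr_wpDl.
apply: is_derive_of_increment => e e0.
have B0 := adapted_B H.
pose k : R := m%:R * B + 1.
have k0 : 0 < k by rewrite ltr_wpDl// mulr_ge0.
have [d2 d20 H2] := is_derive_increment HP (divr_gt0 e0 (mulr_gt0 (ltr0n _ 2) k0)).
have JuP : has_jac (fun v => F v *m P) (u t) (J (u t) *m P).
  have -> : (fun v => F v *m P) = (mulmxr P : {linear _ -> _}) \o F.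
    by apply/funext => v.
  apply: has_jac_comp; first exact: immersion_has_jac (adapted_U H utr).
  have cP : continuous (mulmxr P : {linear 'rV[R]_q -> 'rV[R]_m}).
    exact: linear_mx_continuous.
  split; first exact: linear_differentiable.
  by move=> v; rewrite diff_lin.
pose eta := e / (2 * k * (2 * D)).
have eta0 : 0 < eta by rewrite divr_gt0// !mulr_gt0.
have [d3 d30 H3] := differentiable_increment (proj1 JuP) eta0.
move: Hu => /nbhs_normP[d4 /= d40 H4].
exists (Num.min (Num.min d1 d2) (Num.min d4 (d3 / (2 * D)))).
  by rewrite !lt_min d10 d20 d40 divr_gt0// mulr_gt0.
move=> h; rewrite !lt_min => /andP[/andP[h1 h2] /andP[h4 h3]].
have [uhr Euh] : `|u (t + h) - u0| < r /\ F (u (t + h)) *m P = y (t + h) *m P.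
  by apply: H4; rewrite /= opprD addrA subrr sub0r normrN.
have {}H1 := H1 h h1; have {}H2 := H2 h h2.
have Lu : `|u (t + h) - u t| <= 2 * D * `|h|.
  apply: le_trans (adapted_lipschitz utr uhr) _.
  by rewrite Euh Eut -mulrA ler_wpM2l.
have := H3 (u (t + h) - u t).
rewrite (proj2 JuP) (addrC (u t)) subrK Euh Eut => H3'.
have {}H3 : `|y (t + h) *m P - y t *m P - (u (t + h) - u t) *m (J (u t) *m P)|
    <= eta * `|u (t + h) - u t|.
  apply: H3'; apply: le_lt_trans Lu _.
  by rewrite mulrC -ltr_pdivlMr// mulr_gt0.
set du := u (t + h) - u t in H3 Lu *.
set dy := y (t + h) *m P - y t *m P in H1 H2 H3.
(* The error in [u] is the difference of the linearisation errors of [y *m P] and of [F *m P],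
   multiplied by the inverse of [J *m P]. *)
have -> : du - h *: (y' *m P *m K (u t)) =
    (dy - h *: (y' *m P) - (dy - du *m (J (u t) *m P))) *m K (u t).
  by rewrite opprB [_ + (_ - dy)]addrC subrKA mulmxBl mulmxK// scalemxAl.
apply: le_trans (mulmx_norm _ _) _.
have bound : `|dy - h *: (y' *m P) - (dy - du *m (J (u t) *m P))| <= e / k * `|h|.
  apply: le_trans (ler_normB _ _) _.
  have : eta * `|du| <= e / (2 * k) * `|h|.
    apply: (@le_trans _ _ (eta * (2 * D * `|h|))).
      by rewrite ler_wpM2l// ltW.
    rewrite (_ : eta * _ = e / (2 * k) * `|h|)// /eta; field.
    by apply/andP; split; apply: lt0r_neq0.
  have -> : e / k * `|h| = e / (2 * k) * `|h| + e / (2 * k) * `|h|.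
    by field; exact: lt0r_neq0.
  by move=> h'; apply: lerD => //; exact: le_trans h'.
apply: (@le_trans _ _ (m%:R * (e / k * `|h|) * B)).
  by rewrite ler_pM ?mulr_ge0// ler_wpM2l.
rewrite (_ : _ * B = (m%:R * B) * (e / k * `|h|)); last by ring.
apply: (@le_trans _ _ (k * (e / k * `|h|))).
  rewrite ler_wpM2r ?lerDl// mulr_ge0// divr_ge0 ?ltW//.
by rewrite mulrA mulrCA divff ?mulr1// gt_eqF.
Qed.

End Adapted.

End ImmersionChart.

Section Pairs.
Context {R : realType} {V W : normedModType R}.

Lemma fst_norm_le (x : V * W) : `|x.1| <= `|x|.
Proof. by rewrite prod_normE le_max lexx. Qed.

Lemma snd_norm_le (x : V * W) : `|x.2| <= `|x|.
Proof. by rewrite prod_normE le_max lexx orbT. Qed.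

Lemma is_derive_fst (f : R -> V * W) t df :
  is_derive t (1 : R) f df -> is_derive t (1 : R) (fun s => (f s).1) df.1.
Proof.
move=> /is_derive_increment H; apply: is_derive_of_increment => e /H[d d0 {}H].
exists d => // h /H; apply: le_trans.
exact: (fst_norm_le (f (t + h) - f t - h *: df)).
Qed.

Lemma is_derive_snd (f : R -> V * W) t df :
  is_derive t (1 : R) f df -> is_derive t (1 : R) (fun s => (f s).2) df.2.
Proof.
move=> /is_derive_increment H; apply: is_derive_of_increment => e /H[d d0 {}H].
exists d => // h /H; apply: le_trans.
exact: (snd_norm_le (f (t + h) - f t - h *: df)).
Qed.

Lemma is_derive_pair (f : R -> V) (g : R -> W) t df dg :
  is_derive t (1 : R) f df -> is_derive t (1 : R) g dg ->
  is_derive t (1 : R) (fun s => (f s, g s)) (df, dg).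
Proof.
move=> /is_derive_increment Hf /is_derive_increment Hg.
apply: is_derive_of_increment => e e0.
have [d d0 {}Hf] := Hf e e0; have [d' d0' {}Hg] := Hg e e0.
exists (Num.min d d'); first by rewrite lt_min d0.
move=> h; rewrite lt_min => /andP[/Hf {}Hf /Hg {}Hg].
by rewrite prod_normE ge_max Hf.
Qed.

Lemma dominated_pair (V' : normedModType R) (I : set R) (w : R -> V')
    (f : R -> V) (g : R -> W) :
  dominated_on I w f -> dominated_on I w g ->
  dominated_on I w (fun t => (f t, g t)).
Proof.
move=> [L [B [L0 B0 H HB]]] [L' [B' [L0' B0' H' HB']]].
exists (L + L'), (B + B').
split; [exact: addr_ge0|exact: addr_ge0|move=> s t Is It|move=> t It].
  rewrite prod_normE ge_max /= (le_trans (H s t Is It)).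
    by rewrite (le_trans (H' s t Is It))// ler_wpM2r// lerDr.
  by rewrite ler_wpM2r// lerDl.
rewrite prod_normE ge_max /= (le_trans (HB t It)) ?lerDl//.
by rewrite (le_trans (HB' t It)) ?lerDr.
Qed.

Lemma dominated_comp (V' : normedModType R) (I : set R) (w : R -> V')
    (f : R -> V) (g : R -> W) (L B : R) : 0 <= L -> 0 <= B ->
  (forall s t, I s -> I t -> `|g t - g s| <= L * `|f t - f s|) ->
  (forall t, I t -> `|g t| <= B) ->
  dominated_on I w f -> dominated_on I w g.
Proof.
move=> L0 B0 H HB [L' [_ [L0' _ H' _]]]; exists (L * L'), B; split=> //.
  exact: mulr_ge0.
move=> s t Is It; apply: le_trans (H s t Is It) _.
by rewrite -mulrA ler_wpM2l// H'.
Qed.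

End Pairs.

(** * Invariance of a slice under the equations of motion *)

Section SliceVelocity.
Context {R : realType} {n m q : nat}.

(** The algebraic core. [Gy] is the connection at [y] along [y'], [Gf] the connection at [F u], [dJ]
    the derivative of [J] along [u'], and [xi *m A *m P *m Kt *m Jt] the velocity of [F u].
    Everything that is not already proportional to the deviation cancels because total geodesy makes
    [dJ + Jt *m Gf] of that velocity tangent. *)
Lemma slice_velocity_bound (A : 'M[R]_(n, q)) (Jt dJ : 'M[R]_(m, q))
    (P : 'M[R]_(q, m)) (Kt : 'M[R]_m) (xi : 'rV[R]_n) (Om : 'M[R]_n)
    (Gy : 'M[R]_q) (Gf : 'rV[R]_q -> 'M[R]_q) (BA BQ CO LG ze : R) :
  0 <= LG -> 0 <= CO -> 0 <= ze -> Jt *m P *m Kt = 1%:M ->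
  ((dJ + Jt *m Gf (xi *m A *m P *m Kt *m Jt))%R <= Jt)%MS ->
  (forall w, `|Gf w| <= LG * `|w|) ->
  (forall w w', Gf (w - w') = Gf w - Gf w') ->
  `|Gy - Gf (xi *m A)| <= LG * ze * `|xi *m A| ->
  `|A| <= BA -> `|P *m Kt *m Jt| <= BQ -> `|Om| <= CO * `|xi| ->
  `|A - A *m P *m Kt *m Jt| <= ze ->
  let A' := Om *m A - A *m Gy in
  let C := (n%:R + (n%:R * CO + q%:R * (q%:R * BA * (LG * (n%:R * BA)) +
      q%:R * BA * (LG * n%:R) + q%:R * (LG * (q%:R * (n%:R * BA) * BQ))) *
      (1 + BQ))) * `|xi| * ze in
  (`|xi *m A - xi *m A *m P *m Kt *m Jt| <= C) /\
  (`|A' - (((A' *m P) *m Kt + A *m P *m - (Kt *m (dJ *m P) *m Kt)) *m Jt +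
      A *m P *m Kt *m dJ)| <= C).
Proof.
move=> LG0 CO0 ze0 JPK TQ GfB GfD HG ABA QBQ OmB z2B A' C.
have BA0 : 0 <= BA by apply: le_trans ABA.
have BQ0 : 0 <= BQ by apply: le_trans QBQ.
(* The projection that kills the row space of [Jt]; the transversal component of [A] is
   [A *m Pi]. *)
pose Pi := 1%:M - P *m Kt *m Jt.
have {}TQ : (dJ + Jt *m Gf (xi *m A *m P *m Kt *m Jt)) *m Pi = 0.
  have /submxP[D ->] := TQ.
  rewrite -mulmxA mulmxBr mulmx1 !mulmxA JPK mul1mx subrr mulmx0 //.
have PiB : `|Pi| <= 1 + BQ.
  apply: le_trans (ler_normB _ _) _; apply: lerD => //.
  by apply: mx_norm_le => // i j; rewrite mxE; case: eqP; rewrite ?normr1 ?normr0.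
set z2 := A - _ in z2B.
have zPi : z2 = A *m Pi by rewrite mulmxBr mulmx1 !mulmxA.
have vz : xi *m A - xi *m A *m P *m Kt *m Jt = xi *m z2.
  by rewrite mulmxBr !mulmxA.
have vB : `|xi *m A| <= n%:R * `|xi| * BA by exact: mulmx_le.
pose E1 := A *m (Gy - Gf (xi *m A)).
pose E2 := A *m Gf (xi *m z2).
pose E3 := z2 *m Gf (xi *m A *m P *m Kt *m Jt).
have E1B : `|E1| <= q%:R * BA * (LG * ze * (n%:R * `|xi| * BA)).
  apply: mulmx_le => //; apply: le_trans HG _.
  by rewrite ler_wpM2l// mulr_ge0.
have E2B : `|E2| <= q%:R * BA * (LG * (n%:R * `|xi| * ze)).
  apply: mulmx_le => //; apply: le_trans (GfB _) _.
  by rewrite ler_wpM2l//; exact: mulmx_le.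
have E3B : `|E3| <= q%:R * ze * (LG * (q%:R * (n%:R * `|xi| * BA) * BQ)).
  apply: mulmx_le => //; apply: le_trans (GfB _) _.
  have -> : xi *m A *m P *m Kt *m Jt = xi *m A *m (P *m Kt *m Jt).
    by rewrite !mulmxA.
  by rewrite ler_wpM2l//; exact: mulmx_le.
have OB : `|Om *m z2| <= n%:R * (CO * `|xi|) * ze by exact: mulmx_le.
(* [E1] is the cost of evaluating the connection at [F u] instead of [y], [E2] of replacing the
   velocity of [y] by that of [F u], [E3] of replacing [A] by its tangential part. Each is of the
   order of [|xi|] times the deviation. *)
have formula : A' - (((A' *m P) *m Kt + A *m P *m - (Kt *m (dJ *m P) *m Kt)) *m Jt +
      A *m P *m Kt *m dJ) = Om *m z2 - (E1 + E2 + E3) *m Pi.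
  have -> : A' - (((A' *m P) *m Kt + A *m P *m - (Kt *m (dJ *m P) *m Kt)) *m Jt +
      A *m P *m Kt *m dJ) = (A' - A *m P *m Kt *m dJ) *m Pi.
    have -> : (A' *m P *m Kt + A *m P *m - (Kt *m (dJ *m P) *m Kt)) *m Jt =
        (A' - A *m P *m Kt *m dJ) *m (P *m Kt *m Jt).
      by rewrite mulmxDl mulmxN mulNmx [RHS]mulmxBl !mulmxA.
    by rewrite [RHS]mulmxBr mulmx1 opprD addrA addrAC.
  have dJE : dJ *m Pi = - (Jt *m Gf (xi *m A *m P *m Kt *m Jt) *m Pi).
    by apply/eqP; rewrite -addr_eq0 -mulmxDl TQ.
  have XPi : A *m P *m Kt *m dJ *m Pi =
      - ((A - z2) *m Gf (xi *m A *m P *m Kt *m Jt) *m Pi).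
    by rewrite -(mulmxA _ dJ) dJE mulmxN {1}/z2 subKr !mulmxA.
  rewrite mulmxBl XPi opprK /A' mulmxBl -(mulmxA Om) -zPi -addrA; congr (_ + _).
  rewrite -[RHS]mulNmx -[- (A *m Gy *m Pi)]mulNmx -mulmxDl; congr (_ *m Pi).
  have w_eq : xi *m A *m P *m Kt *m Jt = xi *m A - xi *m z2.
    by rewrite -vz subKr.
  rewrite /E1 /E2 /E3 mulmxBl mulmxBr.
  have -> : A *m Gf (xi *m A *m P *m Kt *m Jt) =
      A *m Gf (xi *m A) - A *m Gf (xi *m z2) by rewrite w_eq GfD mulmxBr.
  by rewrite !opprD opprK !addrA.
have s0 := normr_ge0 xi.
split.
  rewrite vz; apply: le_trans (mulmx_le (lexx _) z2B) _.
  rewrite /C ler_wpM2r// ler_wpM2r// lerDl.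
  by rewrite !(addr_ge0, mulr_ge0).
rewrite formula; apply: le_trans (ler_normB _ _) _.
have EB : `|(E1 + E2 + E3) *m Pi| <= q%:R *
    (q%:R * BA * (LG * ze * (n%:R * `|xi| * BA)) +
     q%:R * BA * (LG * (n%:R * `|xi| * ze)) +
     q%:R * ze * (LG * (q%:R * (n%:R * `|xi| * BA) * BQ))) * (1 + BQ).
  apply: mulmx_le => //; apply: le_trans (ler_normD _ _) _; apply: lerD => //.
  by apply: le_trans (ler_normD _ _) _; apply: lerD.
apply: le_trans (lerD OB EB) _.
(* The constant exceeds what is needed here by exactly the share of the first component, as it has
   to serve both. *)
rewrite -subr_ge0 (_ : _ - _ = n%:R * `|xi| * ze); last by rewrite /C; ring.
by rewrite !mulr_ge0.
Qed.

End SliceVelocity.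

Section SliceDerivative.
Context {R : realType} {n m q : nat}.
Variables (U : set 'rV[R]_m) (F : 'rV[R]_m -> 'rV[R]_q).
Hypotheses (oU : open U) (F2 : Ck_on 2 U F).
Local Notation J := (jac F).
Variables (u0 : 'rV[R]_m) (P : 'M[R]_(q, m)) (r B : R).
Hypothesis HA : adapted U F u0 P r B.
Local Notation K u := (invmx (J u *m P)).

(* The connection: [v *m G y w] is the Christoffel form applied to [w] and [v]. *)
Variables (G : 'rV[R]_q -> 'rV[R]_q -> 'M[R]_q) (rG LG : R).
Hypotheses
  (GB : forall y w, `|y - F u0| < rG -> `|G y w| <= LG * `|w|)
  (GD : forall y w w', G y (w - w') = G y w - G y w')
  (GL : forall y y' w, `|y - F u0| < rG -> `|y' - F u0| < rG ->
     `|G y w - G y' w| <= LG * `|y - y'| * `|w|)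
  (TG : forall u X, U u -> `|F u - F u0| < rG ->
     (('d J u X + J u *m G (F u) (X *m J u))%R <= J u)%MS).

Variables (u : R -> 'rV[R]_m) (h : R -> 'rV[R]_n * 'rV[R]_q * 'M[R]_(n, q)).

(* The deviations of (y; A) from the submanifold: [y - F u] and the component of
   [A] that is not tangent to it. *)
Definition slice_deviation (t : R) : 'rV[R]_q * 'M[R]_(n, q) :=
  ((h t).1.2 - F (u t),
   (h t).2 - (h t).2 *m P *m K (u t) *m J (u t)).

(** At a time where [h] is differentiable so are [u], [J u] and the inverse of [J u *m P]; the
    product rule gives the derivative of the deviation in the shape estimated above. *)
Lemma slice_derivative (BA BQ CO : R) t (xi : 'rV[R]_n) (Om : 'M[R]_n) :
  (\forall s \near t, `|u s - u0| < r /\ F (u s) *m P = (h s).1.2 *m P) ->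
  `|(h t).1.2 - F u0| < rG -> `|F (u t) - F u0| < rG ->
  `|(h t).2| <= BA -> `|P *m K (u t) *m J (u t)| <= BQ -> `|Om| <= CO * `|xi| ->
  0 <= LG -> 0 <= CO ->
  is_derive t (1 : R) h (xi, xi *m (h t).2,
    Om *m (h t).2 - (h t).2 *m G (h t).1.2 (xi *m (h t).2)) ->
  exists2 z', is_derive t (1 : R) slice_deviation z' &
    `|z'| <= (n%:R + (n%:R * CO + q%:R * (q%:R * BA * (LG * (n%:R * BA)) +
      q%:R * BA * (LG * n%:R) + q%:R * (LG * (q%:R * (n%:R * BA) * BQ))) *
      (1 + BQ))) * `|xi| * `|slice_deviation t|.
Proof.
move=> Hu yr Fr ABA QBQ OmB LG0 CO0 Dh.
have [utr Eut] := nbhs_singleton Hu.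
have Uut := adapted_U HA utr.
have [uK bK] := adapted_K HA utr.
have Dy : is_derive t (1 : R) (fun s => (h s).1.2) (xi *m (h t).2).
  exact: (is_derive_snd (is_derive_fst Dh)).
have DA : is_derive t (1 : R) (fun s => (h s).2)
    (Om *m (h t).2 - (h t).2 *m G (h t).1.2 (xi *m (h t).2)).
  exact: (is_derive_snd Dh).
have Du := adapted_derive F2 HA Hu Dy.
set u' := xi *m (h t).2 *m P *m K (u t) in Du.
have [dJ _] := Ck_on_jac oU F2.
have DJ := is_derive_comp Du (dJ _ Uut).
have TGt := TG u' Uut Fr.
have [dF HF] := immersion_has_jac F2 Uut.
have DF := is_derive_comp Du dF; rewrite HF in DF.
have DJP : is_derive t (1 : R) (fun s => J (u s) *m P) ('d J (u t) u' *m P).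
  apply: is_derive_eq (is_derive_mulmx DJ (is_derive_cst P t 1)) _.
  by rewrite mulmx0 addr0.
have DK := is_derive_invmx DJP uK.
have DAP : is_derive t (1 : R) (fun s => (h s).2 *m P)
    ((Om *m (h t).2 - (h t).2 *m G (h t).1.2 (xi *m (h t).2)) *m P).
  apply: is_derive_eq (is_derive_mulmx DA (is_derive_cst P t 1)) _.
  by rewrite mulmx0 addr0.
have Db := is_derive_mulmx DAP DK.
have DbJ := is_derive_mulmx Db DJ.
have Dz2 := is_deriveB DA DbJ.
have Dz1 := is_deriveB Dy DF.
have Dz := is_derive_pair Dz1 Dz2.
apply: (ex_intro2 _ _ _ Dz).
have zE1 : `|(h t).1.2 - F (u t)| <= `|slice_deviation t|.
  exact: fst_norm_le (slice_deviation t).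
have zE2 : `|(h t).2 - (h t).2 *m P *m K (u t) *m J (u t)| <= `|slice_deviation t|.
  exact: snd_norm_le (slice_deviation t).
rewrite [X in X <= _]prod_normE ge_max /=.
apply/andP; apply: (@slice_velocity_bound _ _ _ _ (h t).2 (J (u t)) ('d J (u t) u') P (K (u t)) xi Om
  (G (h t).1.2 (xi *m (h t).2)) (G (F (u t))) BA BQ CO LG) => //.
- by rewrite mulmxV.
- move=> w; exact: GB.
- apply: le_trans (GL _ yr Fr) _.
  by rewrite ler_wpM2r// ler_wpM2l.
Qed.
End SliceDerivative.

Section SliceInvariance.
Context {R : realType} {n m q : nat}.
Notation mu := (@lebesgue_measure R).
Variables (U : set 'rV[R]_m) (F : 'rV[R]_m -> 'rV[R]_q).
Hypotheses (oU : open U) (F2 : Ck_on 2 U F).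
Local Notation J := (jac F).

Lemma negligible_set1 (a : R) : mu.-negligible [set a].
Proof. by exists [set a]; split=> //; exact: lebesgue_measure_set1. Qed.

(** The size [e] of the admissible variation is fixed before the curve: it depends on the slice, the
    connection and the bounds [BA] and [CO] only. Within that variation the deviation is defined
    throughout, starts from zero at [c], and the Gronwall lemma applies with [h] itself as clock. *)
Lemma slice_invariance (u0 : 'rV[R]_m)
    (G : 'rV[R]_q -> 'rV[R]_q -> 'M[R]_q) (rG LG r0 BA CO : R) :
  U u0 -> row_free (J u0) -> 0 < rG -> 0 <= LG -> 0 < r0 -> 0 <= CO ->
  (forall y w, `|y - F u0| < rG -> `|G y w| <= LG * `|w|) ->
  (forall y w w', G y (w - w') = G y w - G y w') ->
  (forall y y' w, `|y - F u0| < rG -> `|y' - F u0| < rG ->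
     `|G y w - G y' w| <= LG * `|y - y'| * `|w|) ->
  (forall u X, U u -> `|F u - F u0| < rG ->
     (('d J u X + J u *m G (F u) (X *m J u))%R <= J u)%MS) ->
  exists2 e : R, 0 < e &
  forall (a b c : R) (h : R -> 'rV[R]_n * 'rV[R]_q * 'M[R]_(n, q)) (N : set R),
    a <= c <= b -> mu.-negligible N -> abs_continuous_on a b h ->
    (forall s t k tau, a <= s -> t <= b -> partition_of s t k tau ->
       \sum_(i < k) `|h (tau i.+1) - h (tau i)| <= e) ->
    (h c).1.2 = F u0 -> ((h c).2 <= J u0)%MS -> `|(h c).2| <= BA ->
    (forall t, a <= t <= b -> ~ N t -> exists (xi : 'rV[R]_n) (Om : 'M[R]_n),
       `|Om| <= CO * `|xi| /\
       is_derive t (1 : R) h (xi, xi *m (h t).2,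
         Om *m (h t).2 - (h t).2 *m G (h t).1.2 (xi *m (h t).2))) ->
  forall t, a <= t <= b -> exists u,
    [/\ `|u - u0| < r0, U u, (h t).1.2 = F u & ((h t).2 <= J u)%MS].
Proof.
move=> Uu0 J0 rG0 LG0 r00 CO0 GB GD GL TG.
have [r1 r10 Hr1] : exists2 r1 : R, 0 < r1 & forall u, `|u - u0| < r1 ->
    `|F u - F u0| < rG.
  have cF : {for u0, continuous F}.
    by apply: differentiable_continuous; case: (immersion_has_jac F2 Uu0).
  move/cvgrPdist_lt: cF => /(_ rG rG0)/nbhs_normP[r1 /= r10 H].
  by exists r1 => // u ur; rewrite distrC; apply: H; rewrite /= distrC.
have rmin0 : 0 < Num.min r0 r1 by rewrite lt_min r00.
have [P [r [B [rr HA]]]] := adapted_exists oU F2 Uu0 J0 rmin0.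
have rr0 u : `|u - u0| < r -> `|u - u0| < r0.
  by move=> ur; apply: lt_le_trans ur _; apply: le_trans rr _; rewrite ge_min lexx.
have rrG u : `|u - u0| < r -> `|F u - F u0| < rG.
  move=> ur; apply: Hr1; apply: lt_le_trans ur _; apply: le_trans rr _.
  by rewrite ge_min lexx orbT.
have rpos := adapted_r HA; have B0 := adapted_B HA.
pose BQ : R := m%:R * m%:R * `|P| * B * B.
pose BA' : R := `|BA| + 1.
have BA'0 : 0 <= BA' by rewrite addr_ge0.
have BQ0 : 0 <= BQ by rewrite !mulr_ge0.
pose C : R := n%:R + (n%:R * CO + q%:R * (q%:R * BA' * (LG * (n%:R * BA')) +
      q%:R * BA' * (LG * n%:R) + q%:R * (LG * (q%:R * (n%:R * BA') * BQ))) *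
      (1 + BQ)).
have C0 : 0 <= C by rewrite !(addr_ge0, mulr_ge0).
have C1 : 0 < 2 * (C + 1) by rewrite mulr_gt0// ltr_wpDl.
have qP : 0 < 8 * (q%:R * `|P| + 1) by rewrite mulr_gt0// ltr_wpDl// mulr_ge0.
(* In order: [|A|] grows by at most 1, so [BA'] bounds it; [y] stays where the connection is
   bounded; [C * e <= 1/2] as Gronwall requires; [y *m P] stays in the ball of radius [r / 4] on
   which the slice coordinate exists. *)
pose e := Num.min (Num.min 1 (rG / 2)) (Num.min (2 * (C + 1))^-1
   (r / (8 * (q%:R * `|P| + 1)))).
have e0 : 0 < e.
  by rewrite !lt_min ltr01 (divr_gt0 rG0 (ltr0n _ 2)) (divr_gt0 rpos qP) invr_gt0 C1.
have [e1 eG eC eP] : [/\ e <= 1, e < rG, C * e <= 2^-1 & q%:R * e * `|P| < r / 4].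
  have := lexx e; rewrite {2}/e !le_min => /andP[/andP[h1 h2] /andP[h3 h4]].
  split=> //.
  - by apply: le_lt_trans h2 _; lra.
  - apply: (le_trans (ler_wpM2l C0 h3)).
    rewrite invfM mulrCA -[leRHS]mulr1 ler_wpM2l ?invr_ge0//.
    by rewrite ler_pdivrMr ?mul1r ?lerDl// ltr_wpDl.
  - apply: (@le_lt_trans _ _ ((q%:R * `|P| + 1) * (r / (8 * (q%:R * `|P| + 1))))).
      rewrite mulrAC ler_pM ?mulr_ge0//; [exact: ltW|by rewrite lerDl].
    have -> : (q%:R * `|P| + 1) * (r / (8 * (q%:R * `|P| + 1))) = r / 8.
      by field; apply: lt0r_neq0; rewrite ltr_wpDl// mulr_ge0.
    by rewrite ltr_pM2l// ltf_pV2 ?posrE// ltr_nat.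
exists e => // a b c h N /andP[ac cb] N0 ach hvar yc Ac ABc Hode.
have hc t : a <= t <= b -> `|h t - h c| <= e.
  have key s s' : a <= s -> s <= s' -> s' <= b -> `|h s' - h s| <= e.
    move=> as_ ss' sb.
    have := hvar s s' 1%N (fun i => if i is 0%N then s else s') as_ sb.
    by rewrite big_ord1 /=; apply; split=> // -[].
  move=> /andP[at_ tb]; have [tc|ct] := leP t c; first by rewrite distrC key.
  by apply: key => //; exact: ltW.
have yB t : a <= t <= b -> `|(h t).1.2 - F u0| <= e.
  move=> /hc; apply: le_trans; rewrite -yc.
  by apply: le_trans (snd_norm_le ((h t).1 - (h c).1)) _; exact: fst_norm_le (h t - h c).
have AB t : a <= t <= b -> `|(h t).2| <= BA'.
  move=> /hc Ht; rewrite -(subrK (h c).2 (h t).2) addrC.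
  apply: le_trans (ler_normD _ _) _; apply: lerD.
    by apply: le_trans ABc _; exact: ler_norm.
  by apply: le_trans e1; apply: le_trans Ht; exact: snd_norm_le (h t - h c).
(* The slice coordinate, chosen time by time; its value outside [[a, b]] is arbitrary. *)
have /choice[u Hu] : forall t, exists v : 'rV[R]_m, a <= t <= b ->
    `|v - u0| < r /\ F v *m P = (h t).1.2 *m P.
  move=> t; have [tab|] := pselect (is_true (a <= t <= b)); last by exists 0.
  have [|v vr Ev] := adapted_surjective HA (z := (h t).1.2 *m P); last by exists v.
  rewrite -mulmxBl; apply: le_lt_trans (mulmx_le (yB t tab) (lexx _)) _.
  exact: eP.
pose I : set R := `[a, b]%classic.
have IE t : I t -> a <= t <= b by rewrite /I /= in_itv.
(* Every ingredient of the deviation is bounded and Lipschitz as a function of [h], which transfers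
   the absolute continuity of [h] to the deviation. *)
have dh : dominated_on I h (fun t => (h t).1.2).
  exists 1, (`|F u0| + e); split=> //; first by rewrite addr_ge0// ltW.
    move=> s t _ _; rewrite mul1r.
    by apply: le_trans (snd_norm_le ((h t).1 - (h s).1)) _; exact: fst_norm_le (h t - h s).
  move=> t /IE/yB Ht; rewrite -(subrK (F u0) (h t).1.2) addrC.
  by apply: le_trans (ler_normD _ _) _; rewrite lerD2l.
have dA : dominated_on I h (fun t => (h t).2).
  exists 1, BA'; split; [exact: ler01|exact: BA'0| |by move=> t /IE tab; exact: AB].
  by move=> s t _ _; rewrite mul1r; exact: snd_norm_le (h t - h s).
have duP : dominated_on I h (fun t => (h t).1.2 *m P).
  exact: dominated_mulmx dh (dominated_cst _ _ P).
have du : dominated_on I h u.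
  apply: (dominated_comp (L := 2) (B := r + `|u0|) _ _ _ _ duP).
  - exact: ler0n.
  - by rewrite addr_ge0// ltW.
  - move=> s t /IE/Hu[sr <-] /IE/Hu[tr <-].
    exact: (adapted_lipschitz HA sr tr).
  - move=> t /IE/Hu[tr _]; rewrite -(subrK u0 (u t)).
    by apply: le_trans (ler_normD _ _) _; rewrite lerD2r ltW.
have dF : dominated_on I h (F \o u).
  apply: (dominated_comp (L := B) (B := rG + `|F u0|) _ _ _ _ du).
  - exact: B0.
  - by rewrite addr_ge0// ltW.
  - by move=> s t /IE/Hu[sr _] /IE/Hu[tr _]; exact: (adapted_F HA sr tr).
  - move=> t /IE/Hu[tr _]; rewrite -(subrK (F u0) ((F \o u) t)).
    by apply: le_trans (ler_normD _ _) _; rewrite lerD2r ltW// rrG.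
have dJ : dominated_on I h (J \o u).
  apply: (dominated_comp (L := B) (B := B) _ _ _ _ du).
  - exact: B0.
  - exact: B0.
  - by move=> s t /IE/Hu[sr _] /IE/Hu[tr _]; exact: (adapted_J HA sr tr).
  - by move=> t /IE/Hu[tr _]; exact: (adapted_Jle HA tr).
have dK : dominated_on I h (fun t => invmx (J (u t) *m P)).
  apply: (dominated_invmx (B := B)) => //.
    by move=> t /IE/Hu[tr _]; exact: (adapted_K HA tr).
  exact: dominated_mulmx dJ (dominated_cst _ _ P).
pose z := slice_deviation F P u h.
have dz : dominated_on I h z.
  apply: dominated_pair; first exact: dominatedB dh dF.
  apply: (dominatedB dA); apply: (dominated_mulmx _ dJ).
  apply: (dominated_mulmx _ dK).
  exact: (dominated_mulmx dA (dominated_cst _ _ P)).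
have acz : abs_continuous_on a b z by exact: dominated_abs_continuous dz ach.
have [_ [Bz [_ _ _ HBz]]] := dz.
have cab : a <= c <= b by rewrite ac.
have [ucr Euc] := Hu c cab.
have u0r : `|u0 - u0| < r by rewrite subrr normr0.
(* Both parameters give the same [F *m P], which is injective on the ball. *)
have ucE : u c = u0.
  apply/eqP; rewrite -subr_eq0 -normr_le0.
  apply: le_trans (adapted_lipschitz HA u0r ucr) _.
  by rewrite Euc yc subrr normr0 mulr0.
have zc : z c = 0.
  rewrite /z /slice_deviation ucE yc subrr.
  have /submxP[D ->] := Ac.
  have [uK _] := adapted_K HA u0r.
  by rewrite -(mulmxA D) mulmxK// subrr.
have zI t : a <= t <= b -> z t = 0.
  (* The end points join the null set because the equation defining [u] holds only on [[a, b]], and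
     differentiating it requires a neighbourhood. *)
  pose N' := N `|` ([set a] `|` [set b]).
  have N'0 : mu.-negligible N'.
    by do 2 ?apply: negligibleU => //; exact: negligible_set1.
  apply: (gronwall_zero (C := C) cab C0 zc acz N'0).
  - by move=> s sab; apply: HBz; rewrite /I /= in_itv.
  - move=> s sab N's.
    have Ns : ~ N s by move=> ?; apply: N's; left.
    have [xi [Om [OmB Dh]]] := Hode s sab Ns.
    have sa : a < s.
      rewrite lt_neqAle; case/andP: (sab) => -> _; rewrite andbT.
      by apply/eqP => E; apply: N's; right; left.
    have sb : s < b.
      rewrite lt_neqAle; case/andP: (sab) => _ ->; rewrite andbT.
      by apply/eqP => E; apply: N's; right; right.
    have Hus : \forall v \near s, `|u v - u0| < r /\ F (u v) *m P = (h v).1.2 *m P.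
      have : \forall v \near s, v \in `]a, b[ by apply: near_in_itvoo; rewrite in_itv /= sa.
      apply: filterS => v; rewrite in_itv /= => /andP[av vb]; apply: Hu.
      by rewrite !ltW.
    have [usr _] := Hu s sab.
    have QB : `|P *m invmx (J (u s) *m P) *m J (u s)| <= BQ.
      apply: le_trans (mulmx3_norm _ _ _) _.
      have [_ KB] := adapted_K HA usr; have JB := adapted_Jle HA usr.
      by rewrite /BQ ler_pM ?mulr_ge0// ler_pM ?mulr_ge0.
    have [z' Dz z'B] := slice_derivative oU F2 HA GB GD GL TG Hus
      (le_lt_trans (yB s sab) eG) (rrG _ usr) (AB s sab) QB OmB LG0 CO0 Dh.
    (* [xi] is a component of the derivative of [h], so [|xi|] is bounded by the norm of that
       derivative. *)
    eexists z', _; split; [exact: Dz|exact: Dh|].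
    apply: le_trans z'B _; rewrite -/C.
    apply: ler_wpM2r => //; apply: ler_wpM2l => //.
    by rewrite !prod_normE /= !le_max lexx.
  - move=> s s' k tau as_ tb Htau; apply: le_trans eC.
    by apply: ler_wpM2l => //; exact: hvar Htau.
move=> t tab; exists (u t); have [tr _] := Hu t tab.
have /(f_equal fst) /= /subr0_eq yE := zI t tab.
have /(f_equal snd) /= /subr0_eq AE := zI t tab.
split; [exact: rr0|exact: (adapted_U HA tr)|exact: yE|].
by rewrite AE submxMl.
Qed.

End SliceInvariance.

HB.lock Definition change (R : realType) (n : nat) (M : manifold R n)
  (c c' : chart R n M) (x : M) : 'M[R]_n := change_chart c c' x.

(** * Charts and the Christoffel symbols *)

Section Charts.
Context {R : realType} {n : nat} {M : manifold R n}.
Implicit Types (c : chart R n M) (x : M).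

Lemma cinvK c x : cdom c x -> cinv c (cmap c x) = x.
Proof. by move=> cx; apply: cmapK; rewrite inE. Qed.

Lemma cmap_cinv c y : (cmap c @` cdom c) y -> cdom c (cinv c y) /\ cmap c (cinv c y) = y.
Proof. by move=> [x cx <-]; rewrite cinvK. Qed.

Lemma open_cmap_image c (O : set M) : open O ->
  open (cmap c @` (cdom c `&` O)).
Proof.
move=> oO.
have -> : cmap c @` (cdom c `&` O) = (cmap c @` cdom c) `&` (cinv c @^-1` O).
  apply/seteqP; split=> [_ [x [cx Ox] <-]|y [[x cx <-]]] /=.
    by split; [exists x|rewrite /= cinvK].
  by rewrite cinvK// => Ox; exists x.
rewrite openE => y [cy Oy]; apply: filterI.
  by apply: open_nbhs_nbhs; split=> //; exact: cimage_open.
by apply: (cinv_continuous cy); exact: open_nbhs_nbhs.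
Qed.

Lemma nbhs_cinv c y (O : set M) : (cmap c @` cdom c) y -> nbhs (cinv c y) O ->
  \forall z \near y, (cmap c @` cdom c) z /\ O (cinv c z).
Proof.
move=> cy HO; apply: filterI.
  by apply: open_nbhs_nbhs; split=> //; exact: cimage_open.
exact: (cinv_continuous cy).
Qed.

Lemma nbhs_cdom c x : cdom c x -> nbhs x (cdom c).
Proof. by move=> cx; apply: open_nbhs_nbhs; split=> //; exact: cdom_open. Qed.

Lemma changeE c c' x : change_chart c c' x = change c c' x.
Proof. by rewrite change.unlock. Qed.

Section Transition.
Variables (c c' : chart R n M).
Hypotheses (ac : atlas c) (ac' : atlas c').

Lemma transition_smooth : smooth_on (cmap c @` (cdom c `&` cdom c')) (cmap c' \o cinv c).
Proof. exact: atlas_smooth. Qed.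

Lemma change_jac x : change c c' x = jac (cmap c' \o cinv c) (cmap c x).
Proof. by rewrite change.unlock /change_chart jacE. Qed.

Lemma has_jac_transition x : cdom c x -> cdom c' x ->
  has_jac (cmap c' \o cinv c) (cmap c x) (change c c' x).
Proof.
move=> cx cx'; rewrite change_jac; apply: has_jac_jac.
by apply: (transition_smooth 1).1; exists x.
Qed.

End Transition.

Lemma change_comp c c' c'' x : atlas c -> atlas c' -> atlas c'' ->
  cdom c x -> cdom c' x -> cdom c'' x ->
  change c c' x *m change c' c'' x = change c c'' x.
Proof.
move=> ac ac' ac'' cx cx' cx''; rewrite (change_jac c c'' x).
apply/esym/has_jac_unique.
have h1 := has_jac_transition ac ac' cx cx'.
have h2 := has_jac_transition ac' ac'' cx' cx''.
have E : (cmap c' \o cinv c) (cmap c x) = cmap c' x by rewrite /= cinvK.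
rewrite -E in h2; apply: near_eq_has_jac (has_jac_comp h1 h2).
have cy : (cmap c @` cdom c) (cmap c x) by exists x.
have : nbhs (cinv c (cmap c x)) (cdom c') by rewrite cinvK//; exact: nbhs_cdom.
move=> /(nbhs_cinv cy); apply: filterS => z [cz cz'] /=.
by rewrite cinvK.
Qed.

Lemma change_id c x : cdom c x -> change c c x = 1%:M.
Proof.
move=> cx; rewrite (change_jac c c x); apply: has_jac_unique.
apply: near_eq_has_jac (has_jac_id _).
have : nbhs (cmap c x) (cmap c @` cdom c).
  by apply: open_nbhs_nbhs; split; [exact: cimage_open|exists x].
by apply: filterS => z /cmap_cinv[_ /= ->].
Qed.

Lemma changeK c c' x : atlas c -> atlas c' -> cdom c x -> cdom c' x ->
  change c c' x *m change c' c x = 1%:M.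
Proof. by move=> *; rewrite change_comp// change_id. Qed.

Lemma to_chartE c x : to_chart c x = change (chart_at x) c x.
Proof. by rewrite /to_chart changeE. Qed.

Lemma from_chartE c x : from_chart c x = change c (chart_at x) x.
Proof. by rewrite /from_chart changeE. Qed.

Lemma to_from_chart c x : atlas c -> cdom c x -> to_chart c x *m from_chart c x = 1%:M.
Proof.
move=> ac cx; rewrite to_chartE from_chartE changeK//.
  exact: chart_at_atlas.
exact: chart_at_dom.
Qed.

Lemma from_to_chart c x : atlas c -> cdom c x -> from_chart c x *m to_chart c x = 1%:M.
Proof.
move=> ac cx; rewrite to_chartE from_chartE changeK//.
  exact: chart_at_atlas.
exact: chart_at_dom.
Qed.

Lemma to_chart_change c c' x : atlas c -> atlas c' -> cdom c x -> cdom c' x ->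
  to_chart c x *m change c c' x = to_chart c' x.
Proof.
move=> ac ac' cx cx'; rewrite !to_chartE change_comp//.
  exact: chart_at_atlas.
exact: chart_at_dom.
Qed.

Lemma from_chart_change c c' x : atlas c -> atlas c' -> cdom c x -> cdom c' x ->
  change c c' x *m from_chart c' x = from_chart c x.
Proof.
move=> ac ac' cx cx'; rewrite !from_chartE change_comp//.
  exact: chart_at_atlas.
exact: chart_at_dom.
Qed.

End Charts.

(** * Locally Lipschitz functions *)

Section LocallyLipschitz.
Context {R : realType} {V : normedModType R}.
Implicit Types (W : normedModType R) (x : V).

(** Lipschitz and bounded on a ball, phrased as domination by the identity so that the rules for
    products and inverses of [dominated_on] carry over. *)
Definition loclip W (f : V -> W) x0 := exists2 r : R, 0 < r &
  dominated_on [set x | `|x - x0| < r] id f.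

Lemma dominated_sub (T : Type) (V' W : normedModType R) (I I' : set T)
    (w : T -> V') (f : T -> W) : I' `<=` I ->
  dominated_on I w f -> dominated_on I' w f.
Proof.
move=> sI [L [B [L0 B0 H HB]]]; exists L, B.
by split=> // [s t /sI Is /sI It|t /sI It]; [exact: H|exact: HB].
Qed.

Lemma loclip2 W1 W2 W3 (f : V -> W1) (g : V -> W2) (k : V -> W3) x0 :
  (forall I, dominated_on I id f -> dominated_on I id g -> dominated_on I id k) ->
  loclip f x0 -> loclip g x0 -> loclip k x0.
Proof.
move=> H [r r0 Hf] [r' r0' Hg]; exists (Num.min r r'); first by rewrite lt_min r0.
by apply: H; [apply: dominated_sub Hf|apply: dominated_sub Hg] => x /=;
  rewrite lt_min => /andP[].
Qed.

Lemma loclipB W (f g : V -> W) x0 : loclip f x0 -> loclip g x0 ->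
  loclip (fun x => f x - g x) x0.
Proof. by apply: loclip2 => I; exact: dominatedB. Qed.

Lemma loclip_cst W (a : W) x0 : loclip (fun=> a) x0.
Proof. by exists 1 => //; exact: dominated_cst. Qed.

Lemma loclipD W (f g : V -> W) x0 : loclip f x0 -> loclip g x0 ->
  loclip (fun x => f x + g x) x0.
Proof.
move=> Hf Hg; have := loclipB Hf (loclipB (loclip_cst 0 x0) Hg).
by congr loclip; apply/funext => x; rewrite sub0r opprK.
Qed.

Lemma loclip_sum W p (f : 'I_p -> V -> W) x0 : (forall i, loclip (f i) x0) ->
  loclip (fun x => \sum_(i < p) f i x) x0.
Proof.
elim: p f => [|p IH] f H.
  have := loclip_cst (0 : W) x0.
  by congr loclip; apply/funext => x; rewrite big_ord0.
have := loclipD (IH _ (fun i => H (widen_ord (leqnSn p) i))) (H ord_max).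
by congr loclip; apply/funext => x; rewrite big_ord_recr.
Qed.

Lemma loclip_invmx p (f : V -> 'M[R]_p) x0 : f x0 \in unitmx ->
  loclip f x0 -> loclip (fun x => invmx (f x)) x0.
Proof.
move=> ux0 [r r0 Hf]; have [L [B [L0 B0 H HB]]] := Hf.
have [r' [B' [r0' B0' H']]] := invmx_near ux0.
have L1 : 0 < L + 1 by rewrite ltr_wpDl.
exists (Num.min r (r' / (L + 1))); first by rewrite lt_min r0 divr_gt0.
apply: (dominated_invmx B0').
  move=> x /=; rewrite lt_min => /andP[xr xr']; apply: H'.
  apply: le_lt_trans (H x0 x _ xr) _; first by rewrite /= subrr normr0.
  apply: (@le_lt_trans _ _ ((L + 1) * `|x - x0|)).
    by rewrite ler_wpM2r// lerDl.
  by rewrite mulrC -ltr_pdivlMr.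
by apply: dominated_sub Hf => x /=; rewrite lt_min => /andP[].
Qed.

End LocallyLipschitz.

Lemma loclip_C1 (R : realType) m p q (U : set 'rV[R]_m)
    (f : 'rV[R]_m -> 'M[R]_(p, q)) x0 :
  open U -> Ck_on 1 U f -> U x0 -> loclip f x0.
Proof.
move=> oU fC Ux0; have [r [L [r0 L0 H]]] := C1_lipschitz oU fC Ux0.
exists r => //; exists L, (L * r + `|f x0|); split=> //.
- by rewrite addr_ge0// mulr_ge0// ltW.
- move=> t tr; rewrite -(subrK (f x0) (f t)) (le_trans (ler_normD _ _))// lerD2r.
  have x0r : `|x0 - x0| < r by rewrite subrr normr0.
  by apply: le_trans (H x0 t x0r tr) _; rewrite ler_wpM2l// ltW.
Qed.

Lemma fin_common_radius (R : realType) p (P : 'I_p -> R -> Prop) :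
  (forall i r r', 0 < r' -> r' <= r -> P i r -> P i r') ->
  (forall i, exists2 r, 0 < r & P i r) -> exists2 r, 0 < r & forall i, P i r.
Proof.
elim: p P => [|p IH] P Hmono H; first by exists 1 => // -[].
have [|//|r r0 Hr] := IH (fun i => P (widen_ord (leqnSn p) i)).
  by move=> i; exact: Hmono.
have [r' r0' Hr'] := H ord_max.
have rr : 0 < Num.min r r' by rewrite lt_min r0.
exists (Num.min r r') => // i.
have [ip|ip] := ltnP i p.
  have -> : i = widen_ord (leqnSn p) (Ordinal ip) by exact: val_inj.
  by apply: Hmono (Hr _) => //; rewrite ge_min lexx.
have -> : i = ord_max.
  by apply: val_inj; apply/eqP; rewrite eqn_leq -ltnS ltn_ord ip.
by apply: Hmono Hr' => //; rewrite ge_min lexx orbT.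
Qed.

Section LocallyLipschitzEntries.
Context {R : realType} {V : normedModType R}.

Lemma loclip_near (W : normedModType R) (f g : V -> W) x0 :
  (\near x0, f x0 = g x0) -> loclip f x0 -> loclip g x0.
Proof.
move=> /nbhs_normP[d /= d0 Hd] [r r0 [L [B [L0 B0 H HB]]]].
exists (Num.min d r); first by rewrite lt_min d0.
have E x : `|x - x0| < Num.min d r -> f x = g x /\ `|x - x0| < r.
  by rewrite lt_min => /andP[xd xr]; split=> //; apply: Hd; rewrite /= distrC.
exists L, B; split=> //.
  by move=> s t /E[<- sr] /E[<- tr]; exact: H.
by move=> t /E[<- tr]; exact: HB.
Qed.

Lemma loclip_entry p q (f : V -> 'M[R]_(p, q)) x0 i j :
  loclip f x0 -> loclip (fun x => f x i j : R) x0.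
Proof.
move=> [r r0 [L [B [L0 B0 H HB]]]]; exists r => //; exists L, B; split=> //.
  move=> s t Is It; apply: le_trans (H s t Is It).
  by apply: le_trans (mx_entry_le (f t - f s) i j); rewrite !mxE.
by move=> t It; apply: le_trans (HB t It); exact: mx_entry_le.
Qed.

Lemma loclipM (f g : V -> R) x0 :
  loclip f x0 -> loclip g x0 -> loclip (fun x => f x * g x) x0.
Proof.
apply: loclip2 => I [L [B [L0 B0 H HB]]] [L' [B' [L0' B0' H' HB']]].
exists (L * B' + B * L'), (B * B').
split; [by rewrite addr_ge0// mulr_ge0|by rewrite mulr_ge0|
  move=> s t Is It|move=> t It]; last by rewrite normrM ler_pM// ?HB ?HB'.
have -> : f t * g t - f s * g s = (f t - f s) * g t + f s * (g t - g s) by ring.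
apply: le_trans (ler_normD _ _) _; rewrite !normrM [leRHS]mulrDl lerD//.
  by rewrite mulrAC ler_pM// ?H ?HB'.
by rewrite -mulrA ler_pM// ?HB ?H'.
Qed.

Lemma loclip_scalel (W : normedModType R) (f : V -> R) (a : W) x0 :
  loclip f x0 -> loclip (fun x => f x *: a) x0.
Proof.
move=> [r r0 [L [B [L0 B0 H HB]]]]; exists r => //; exists (L * `|a|), (B * `|a|).
split; [by rewrite mulr_ge0|by rewrite mulr_ge0| |].
  by move=> s t Is It; rewrite -scalerBl normrZ mulrAC ler_wpM2r// H.
by move=> t It; rewrite normrZ ler_wpM2r// HB.
Qed.

Lemma loclip_mx p q (f : V -> 'M[R]_(p, q)) x0 :
  (forall i j, loclip (fun x => f x i j : R) x0) -> loclip f x0.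
Proof.
move=> H.
have -> : f = fun x => \sum_(i < p) \sum_(j < q) f x i j *: delta_mx i j.
  by apply/funext => x; rewrite {1}(matrix_sum_delta (f x)).
by apply: loclip_sum => i; apply: loclip_sum => j; exact: loclip_scalel.
Qed.

End LocallyLipschitzEntries.

(** The connection form in the chart [c] along the direction [u], as a matrix acting from the right
    on the components of the differentiated vector. *)
HB.lock Definition christ_mx (R : realType) (n : nat) (M : manifold R n)
    (g : M -> 'M[R]_n) (c : chart R n M) (y u : 'rV[R]_n) : 'M[R]_n :=
  \matrix_(j, k) \sum_(i < n) christoffel g c y i j k * u 0 i.

(** * Regularity of the metric and of the Christoffel symbols *)

Section Metric.
Context {R : realType} {n : nat} {M : manifold R n}.
Implicit Types (c : chart R n M).

Lemma christoffel_formE (g : M -> 'M[R]_n) c y u v :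
  christoffel_form g c y u v = v *m christ_mx g c y u.
Proof.
rewrite christ_mx.unlock; apply/rowP => k; rewrite !mxE exchange_big.
apply: eq_bigr => j _; rewrite !mxE mulr_sumr; apply: eq_bigr => i _.
by rewrite mulrC.
Qed.

Variable g : riemannian_metric M.

Lemma inner_mulmx p q (N1 : manifold R p) (A : 'M[R]_(q, p)) (h : N1 -> 'M[R]_p) x
    (v : 'rV[R]_q) : inner h x (v *m A) (v *m A) = (v *m (A *m h x *m A^T) *m v^T) 0 0.
Proof. by rewrite /inner trmx_mul !mulmxA. Qed.

Lemma metric_in_chart_pos c y (v : 'rV[R]_n) : atlas c -> (cmap c @` cdom c) y ->
  v != 0 -> 0 < (v *m metric_in_chart g c y *m v^T) 0 0.
Proof.
move=> ac cy v0; have [cx _] := cmap_cinv cy.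
rewrite /metric_in_chart -inner_mulmx; apply: metric_pos.
apply: contraNneq v0 => E.
have := congr1 (mulmx^~ (to_chart c (cinv c y))) E.
by rewrite mul0mx -mulmxA from_to_chart// mulmx1 => ->.
Qed.

Lemma posdef_unitmx p (A : 'M[R]_p) :
  (forall v : 'rV[R]_p, v != 0 -> 0 < (v *m A *m v^T) 0 0) -> A \in unitmx.
Proof.
move=> H; rewrite -row_free_unit; apply: inj_row_free => v vA.
by apply/eqP; apply/negP => /negP /H; rewrite vA mul0mx mxE ltxx.
Qed.

Lemma metric_in_chart_unit c y : atlas c -> (cmap c @` cdom c) y ->
  metric_in_chart g c y \in unitmx.
Proof. by move=> ac cy; apply: posdef_unitmx => v; exact: metric_in_chart_pos. Qed.

Lemma loclip_metric c y : atlas c -> (cmap c @` cdom c) y ->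
  loclip (metric_in_chart g c) y.
Proof.
move=> ac cy.
have H1 := metric_smooth g ac 1.
exact: loclip_C1 (@cimage_open _ _ _ c) H1 cy.
Qed.

Lemma loclip_metric_derive c y v : atlas c -> (cmap c @` cdom c) y ->
  loclip ('D_v (metric_in_chart g c)) y.
Proof.
move=> ac cy; have oU := @cimage_open _ _ _ c.
have [dG dGC] := metric_smooth g ac 2.
have := loclip_C1 oU (dGC v) cy; apply: loclip_near.
have : nbhs y (cmap c @` cdom c) by exact: open_nbhs_nbhs.
by apply: filterS => z cz; rewrite deriveE//; exact: dG.
Qed.

Lemma loclip_christoffel c y i j k : atlas c -> (cmap c @` cdom c) y ->
  loclip (fun z => christoffel g c z i j k) y.
Proof.
move=> ac cy; rewrite /christoffel; apply: loclipM; first exact: loclip_cst.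
apply: loclip_sum => l; apply: loclipM.
  apply: loclip_entry; apply: loclip_invmx; first exact: metric_in_chart_unit.
  exact: loclip_metric.
apply: loclipB; last by apply: loclip_entry; exact: loclip_metric_derive.
by apply: loclipD; apply: loclip_entry; exact: loclip_metric_derive.
Qed.

Lemma christ_mxB c y u v : christ_mx g c y (u - v) = christ_mx g c y u - christ_mx g c y v.
Proof.
rewrite christ_mx.unlock; apply/matrixP => j k; rewrite !mxE -sumrB.
by apply: eq_bigr => i _; rewrite !mxE mulrBr.
Qed.

(** Linear in [u] with finitely many locally Lipschitz coefficient matrices, for which one radius
    can be chosen. These are the bounds on the connection that the slice estimate requires. *)
Lemma christ_mx_local c y0 : atlas c -> (cmap c @` cdom c) y0 ->
  exists r L : R, [/\ 0 < r, 0 <= L,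
    forall y u, `|y - y0| < r -> `|christ_mx g c y u| <= L * `|u|
  & forall y y' u, `|y - y0| < r -> `|y' - y0| < r ->
      `|christ_mx g c y u - christ_mx g c y' u| <= L * `|y - y'| * `|u|].
Proof.
move=> ac cy.
pose C (i : 'I_n) (y : 'rV[R]_n) : 'M[R]_n := \matrix_(j, k) christoffel g c y i j k.
have E y u : christ_mx g c y u = \sum_(i < n) u 0 i *: C i y.
  rewrite christ_mx.unlock; apply/matrixP => j k; rewrite !mxE summxE.
  by apply: eq_bigr => i _; rewrite !mxE mulrC.
have lC i : loclip (C i) y0.
  apply: loclip_mx => j k; have := loclip_christoffel i j k ac cy.
  by congr loclip; apply/funext => y; rewrite mxE.
have [|i|r r0 H] := @fin_common_radius R n (fun i r =>
    dominated_on [set x | `|x - y0| < r] id (C i)).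
- by move=> i r r' _ rr'; apply: dominated_sub => x /= xr; exact: lt_le_trans rr'.
- by have [r r0 Hr] := lC i; exists r.
have {H}/choice[L H] : forall i, exists L : R, 0 <= L /\
    (forall y, `|y - y0| < r -> `|C i y| <= L) /\
    (forall y y', `|y - y0| < r -> `|y' - y0| < r -> `|C i y - C i y'| <= L * `|y - y'|).
  move=> i; have [L [B [L0 B0 HL HB]]] := H i; exists (L + B).
  split; first exact: addr_ge0.
  split=> [y yr|y y' yr yr'].
    by apply: le_trans (HB y yr) _; rewrite lerDr.
  by apply: le_trans (HL y' y yr' yr) _; rewrite ler_wpM2r// lerDl.
exists r, (\sum_i L i); split=> //.
- by apply: sumr_ge0 => i _; case: (H i).
- move=> y u yr; rewrite E mulr_suml; apply: le_trans (ler_norm_sum _ _ _) _.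
  apply: ler_sum => i _; rewrite normrZ mulrC; have [L0 [HL _]] := H i.
  by rewrite ler_pM// ?HL// mx_entry_le.
- move=> y y' u yr yr'; rewrite !E -sumrB !mulr_suml.
  apply: le_trans (ler_norm_sum _ _ _) _.
  apply: ler_sum => i _; rewrite -scalerBr normrZ mulrC; have [L0 [_ HL]] := H i.
  by rewrite ler_pM// ?HL// mx_entry_le.
Qed.

End Metric.

(** * The equations of motion *)

Section LinearOde.
Context {R : realType}.

(** At a maximum [v] of [|Z|] the mean value estimate between [t] and [v] yields
    [|Z v| <= |Z v| / 2]. *)
Lemma linear_ode_unique p q (Z : R -> 'M[R]_(p, q)) (Om : R -> 'M[R]_q)
    (a b t K : R) : a <= t <= b -> 0 <= K -> q%:R * K * (b - a) <= 2^-1 ->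
  (forall u, a <= u <= b -> is_derive u (1 : R) Z (- (Z u *m Om u)) /\ `|Om u| <= K) ->
  Z t = 0 -> forall u, a <= u <= b -> Z u = 0.
Proof.
move=> tab K0 small H Zt.
have ab : a <= b by case/andP: tab => [h1 h2]; exact: le_trans h2.
have cZ u : a <= u <= b -> {for u, continuous Z}.
  move=> /H[DZ _]; apply: differentiable_continuous.
  exact: (is_derive_differentiable DZ).1.
have [|v vab Hv] := @EVT_max R (fun u => `|Z u|) a b ab.
  apply: continuous_in_subspaceT => u; rewrite inE /= in_itv /= => uab.
  by apply: (@continuous_comp _ _ _ Z); [exact: cZ|exact: norm_continuous].
move: vab; rewrite in_itv /= => vab.
have {}Hv u : a <= u <= b -> `|Z u| <= `|Z v|.
  by move=> uab; apply: Hv; rewrite in_itv.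
suff Zv0 : `|Z v| <= 0.
  by move=> u /Hv; rewrite (le_anti (introT andP (conj Zv0 (normr_ge0 _)))) => Zu;
     apply/eqP; rewrite -normr_le0.
have : `|Z v - Z t - 0| <= q%:R * `|Z v| * K * (b - a).
  apply: mean_value_estimate => s /andP[s0 s1].
  set u := t + _.
  have uab : a <= u <= b.
    move: tab vab => /andP[t1 t2] /andP[v1 v2].
    have -> : u = (1 - s) * t + s * v by rewrite /u /GRing.scale /=; ring.
    by apply/andP; split; nra.
  have [DZ OmK] := H u uab.
  have [dZ EZ] := is_derive_differentiable DZ; split=> //.
  rewrite subr0 linear_scalar EZ normrZ normrN mulrC; apply: ler_pM => //.
    by apply: mulmx_le => //; exact: Hv.
  move: tab vab => /andP[t1 t2] /andP[v1 v2].
  by rewrite ler_norml; apply/andP; split; lra.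
rewrite Zt !subr0 => h.
have : q%:R * `|Z v| * K * (b - a) <= 2^-1 * `|Z v|.
  rewrite (_ : _ * (b - a) = q%:R * K * (b - a) * `|Z v|); last by ring.
  by rewrite ler_wpM2r.
by lra.
Qed.

End LinearOde.

Section Curves.
Context {R : realType} {n : nat} {M : manifold R n}.
Implicit Types (c : chart R n M) (gamma : R -> M) (I : set R).

Lemma curve_nbhs gamma c t : {for t, continuous gamma} -> cdom c (gamma t) ->
  \forall s \near t, cdom c (gamma s).
Proof. by move=> cg /nbhs_cdom /cg. Qed.

Lemma open_curve_preimage I gamma c : open I -> smooth_curve I gamma ->
  open (I `&` gamma @^-1` cdom c).
Proof.
move=> oI [cg _]; rewrite openE => t [It ct]; apply: filterI.
  by apply: open_nbhs_nbhs.
exact: curve_nbhs (cg t It) ct.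
Qed.

Lemma smooth_curve_differentiable I gamma c t : smooth_curve I gamma -> atlas c ->
  I t -> cdom c (gamma t) -> differentiable (cmap c \o gamma) t.
Proof. by move=> [_ sg] ac It ct; have [H _] := sg c ac 1%N; exact: H. Qed.

Lemma derive_change_chart gamma c c' t v : {for t, continuous gamma} ->
  atlas c -> atlas c' -> cdom c (gamma t) -> cdom c' (gamma t) ->
  is_derive t (1 : R) (cmap c \o gamma) v ->
  is_derive t (1 : R) (cmap c' \o gamma) (v *m change c c' (gamma t)).
Proof.
move=> cg ac ac' ct ct' Dc.
have [dT HT] := has_jac_transition ac ac' ct ct'.
have := is_derive_comp Dc dT; rewrite HT => D.
have E : \forall s \near t, ((cmap c' \o cinv c) \o (cmap c \o gamma)) s =
    (cmap c' \o gamma) s.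
  by apply: filterS (curve_nbhs cg ct) => s cs /=; rewrite cinvK.
exact: near_eq_is_derive E D.
Qed.

Lemma velocity_in_chart I gamma c t : smooth_curve I gamma -> I t -> atlas c ->
  cdom c (gamma t) ->
  is_derive t (1 : R) (cmap c \o gamma) (velocity gamma t *m to_chart c (gamma t)).
Proof.
move=> sg It ac ct; rewrite to_chartE.
have a0 := chart_at_atlas (gamma t); have d0 := chart_at_dom (gamma t).
apply: derive_change_chart => //; first exact: sg.1.
have D := smooth_curve_differentiable sg a0 It d0.
by apply: DeriveDef => //; exact: diff_derivable.
Qed.

Variable g : riemannian_metric M.

(** Each row of [B *m P s u] is a parallel field, so the vector equation becomes a matrix equation
    row by row. *)
Lemma parallel_transport_derive I gamma P s t c p (B : 'M[R]_(p, n)) :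
  parallel_transport g I gamma P -> I s -> I t -> atlas c -> cdom c (gamma t) ->
  is_derive t (1 : R) (fun u => B *m P s u *m to_chart c (gamma u))
    (- (B *m P s t *m to_chart c (gamma t) *m
        christ_mx g c (cmap c (gamma t)) ('D_1 (cmap c \o gamma) t))).
Proof.
move=> HP Is It ac ct; apply/is_derive_mxP => i k.
have /is_derive_mxP/(_ 0 k) := (HP s Is).2 (row i B) c ac t It ct.
rewrite christoffel_formE.
have -> : (fun y => (row i B *m P s y *m to_chart c (gamma y)) 0 k) =
    (fun y => (B *m P s y *m to_chart c (gamma y)) i k).
  by apply/funext => y; rewrite -!row_mul mxE.
rewrite -!row_mul; set C := _ *m christ_mx _ _ _ _.
by rewrite mxE [in X in _ -> X]mxE mxE.
Qed.

(** As functions of [u], [P s t *m P t u] and [P s u] solve the same linear equation and agree at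
    [u = t]; evaluating at [u = s] gives the claim. The restriction to [t] near [s] keeps the
    interval short enough for uniqueness and inside one chart. *)
Lemma parallel_transport_inverse I gamma P s : open I -> smooth_curve I gamma ->
  parallel_transport g I gamma P -> I s ->
  \forall t \near s, P s t *m P t s = 1%:M.
Proof.
move=> oI sg HP Is.
pose c := chart_at (gamma s).
have ac : atlas c := chart_at_atlas (gamma s).
have cs : cdom c (gamma s) := chart_at_dom (gamma s).
have [r [L [r0 L0 HL _]]] := christ_mx_local g ac (imageP (cmap c) cs).
have cg := sg.1 s Is.
have [dc dcC] := sg.2 c ac 1%N.
have IU : (I `&` gamma @^-1` cdom c) s by [].
pose V := 'd (cmap c \o gamma) s 1.
have : \forall u \near s, [/\ I u, cdom c (gamma u),
    `|cmap c (gamma u) - cmap c (gamma s)| < r &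
    `|'D_1 (cmap c \o gamma) u| < `|V| + 1].
  have N1 : nbhs s (I `&` gamma @^-1` cdom c).
    by apply: open_nbhs_nbhs; split=> //; exact: open_curve_preimage.
  have N2 : \forall u \near s, `|(cmap c \o gamma) s - (cmap c \o gamma) u| < r.
    have : {for s, continuous (cmap c \o gamma)}.
      by apply: differentiable_continuous; exact: dc.
    by move/cvgrPdist_lt; apply.
  have N3 : \forall u \near s, `|V - 'd (cmap c \o gamma) u 1| < 1.
    by move/cvgrPdist_lt: (dcC 1 s IU); apply.
  near=> u.
  have [Iu cu] : (I `&` gamma @^-1` cdom c) u by near: u.
  have u2 : `|(cmap c \o gamma) s - (cmap c \o gamma) u| < r by near: u.
  have u3 : `|V - 'd (cmap c \o gamma) u 1| < 1 by near: u.
  split=> //; first by rewrite distrC.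
  rewrite deriveE; last exact: dc.
  move: u3; move: ('d (cmap c \o gamma) u 1) => w u3.
  by rewrite -(subKr V w); apply: le_lt_trans (ler_normB _ _) _; rewrite ltrD2l.
move=> /nbhs_normP[d /= d0 Hd].
pose K := L * (`|V| + 1).
have K0 : 0 <= K by rewrite mulr_ge0// addr_ge0.
pose k := n%:R * K + 1.
have k0 : 0 < k by rewrite ltr_wpDl// mulr_ge0.
(* The window around [s] has length [2 * e], so uniqueness needs [n * K * 2 * e <= 1/2]; [d / 2]
   keeps the window where the bounds hold. *)
pose e := Num.min (d / 2) (4 * k)^-1.
have e0 : 0 < e by rewrite lt_min divr_gt0// invr_gt0 mulr_gt0.
apply/nbhs_normP; exists e => // t /= ste.
have Hu u : s - e <= u <= s + e -> [/\ I u, cdom c (gamma u),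
    `|cmap c (gamma u) - cmap c (gamma s)| < r &
    `|'D_1 (cmap c \o gamma) u| < `|V| + 1].
  move=> /andP[u1 u2]; apply: Hd; rewrite /=.
  have ed : e < d by rewrite gt_min; apply/orP; left; lra.
  by rewrite ltr_norml; apply/andP; split; lra.
have te : s - e <= t <= s + e.
  by move: ste; rewrite ltr_norml => /andP[? ?]; apply/andP; split; lra.
have se : s - e <= s <= s + e by apply/andP; split; lra.
have [It ct _ _] := Hu t te.
pose Z u := P s t *m P t u *m to_chart c (gamma u) -
  1%:M *m P s u *m to_chart c (gamma u).
have Zs : Z s = 0.
  apply: (@linear_ode_unique _ _ _ Z
    (fun u => christ_mx g c (cmap c (gamma u)) ('D_1 (cmap c \o gamma) u))
    (s - e) (s + e) t K) => //.
  - rewrite (_ : s + e - (s - e) = 2 * e); last by ring.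
    have : e <= (4 * k)^-1 by rewrite ge_min lexx orbT.
    rewrite -[X in _ <= X]div1r ler_pdivlMr ?mulr_gt0//.
    have : n%:R * K <= k by rewrite lerDl.
    by have := ltW e0; nra.
  - move=> u /Hu[Iu cu ur uV]; split.
      have D1 := parallel_transport_derive (P s t) HP It Iu ac cu.
      have D2 := parallel_transport_derive (1%:M : 'M[R]_n) HP Is Iu ac cu.
      apply: is_derive_eq (is_deriveB D1 D2) _.
      by rewrite /Z [in RHS]mulmxBl opprB addrC opprK.
    apply: le_trans (HL _ _ ur) _.
    by rewrite ler_wpM2l// ltW.
  - by rewrite /Z (HP t It).1 mulmx1 mul1mx subrr.
move: Zs; rewrite /Z (HP s Is).1 mulmx1 => /subr0_eq E.
have := congr1 (mulmx^~ (from_chart c (gamma s))) E.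
by rewrite mul1mx -mulmxA to_from_chart// mulmx1.
Unshelve. all: by end_near. Qed.

End Curves.

Section HomChart.
Context {R : realType} {n nhat : nat}.
Context {M : manifold R n} {Mhat : manifold R nhat}.
Implicit Types q : hom_point M Mhat.

Lemma hom_chart_change (c d : chart R n M) (c' d' : chart R nhat Mhat) q :
  atlas c -> atlas d -> atlas c' -> atlas d' ->
  cdom c (pt q) -> cdom d (pt q) -> cdom c' (pthat q) -> cdom d' (pthat q) ->
  (hom_chart d d' q).2 =
    change d c (pt q) *m (hom_chart c c' q).2 *m change c' d' (pthat q).
Proof.
move=> ac ad ac' ad' cq dq cq' dq' /=.
rewrite -(from_chart_change ad ac dq cq) -(to_chart_change ac' ad' cq' dq').
by rewrite !mulmxA.
Qed.

(* The derivative of a curve of [hom_point]s in one pair of charts determines it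
   in any other pair, through a map that does not depend on the curve. *)
Lemma derive_hom_chart_change (c d : chart R n M) (c' d' : chart R nhat Mhat) :
  atlas c -> atlas d -> atlas c' -> atlas d' ->
  exists D : 'rV[R]_n * 'rV[R]_nhat * 'M[R]_(n, nhat) ->
    'rV[R]_n * 'rV[R]_nhat * 'M[R]_(n, nhat) ->
    'rV[R]_n * 'rV[R]_nhat * 'M[R]_(n, nhat),
  forall (q : R -> hom_point M Mhat) (t : R) W,
    {for t, continuous (fun s : R => pt (q s))} ->
    {for t, continuous (fun s : R => pthat (q s))} ->
    cdom c (pt (q t)) -> cdom d (pt (q t)) ->
    cdom c' (pthat (q t)) -> cdom d' (pthat (q t)) ->
    is_derive t (1 : R) (hom_chart c c' \o q) W ->
    is_derive t (1 : R) (hom_chart d d' \o q) (D (hom_chart c c' (q t)) W).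
Proof.
move=> ac ad ac' ad'.
pose T := cmap d \o cinv c; pose T' := cmap d' \o cinv c'.
pose S := cmap c \o cinv d.
pose C := fun y => jac S (T y).
pose C' := fun y => jac T' y.
exists (fun p W : 'rV[R]_n * 'rV[R]_nhat * 'M[R]_(n, nhat) => ('d T (p.1.1 : 'rV_n) W.1.1, 'd T' (p.1.2 : 'rV_nhat) W.1.2,
  ('d (jac S) (T p.1.1) ('d T (p.1.1 : 'rV_n) W.1.1) *m p.2 + C p.1.1 *m W.2) *m C' p.1.2
   + C p.1.1 *m p.2 *m 'd (jac T') (p.1.2 : 'rV_nhat) W.1.2)).
move=> q t W cq cq' ct dt ct' dt' DW.
have DX : is_derive t (1 : R) (fun s => cmap c (pt (q s))) W.1.1.
  exact: is_derive_fst (is_derive_fst DW).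
have DY : is_derive t (1 : R) (fun s => cmap c' (pthat (q s))) W.1.2.
  exact: is_derive_snd (is_derive_fst DW).
have DA : is_derive t (1 : R) (fun s => (hom_chart c c' (q s)).2) W.2.
  exact: is_derive_snd DW.
have [dT _] := has_jac_transition ac ad ct dt.
have [dT' _] := has_jac_transition ac' ad' ct' dt'.
have DTX := is_derive_comp DX dT.
have DTY := is_derive_comp DY dT'.
have oS := @open_cmap_image _ _ _ d (cdom c) (@cdom_open _ _ _ c).
have oT' := @open_cmap_image _ _ _ c' (cdom d') (@cdom_open _ _ _ d').
have [dS _] := Ck_on_jac oS (transition_smooth ad ac 2).
have [dJT' _] := Ck_on_jac oT' (transition_smooth ac' ad' 2).
have TX : T (cmap c (pt (q t))) = cmap d (pt (q t)) by rewrite /T /= cinvK.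
have DCX : is_derive t (1 : R) (fun s => C (cmap c (pt (q s))))
    ('d (jac S) (T (cmap c (pt (q t)))) ('d T (cmap c (pt (q t))) W.1.1)).
  apply: (is_derive_comp DTX); apply: dS.
  by rewrite /= cinvK//; exists (pt (q t)).
have DCY : is_derive t (1 : R) (fun s => C' (cmap c' (pthat (q s))))
    ('d (jac T') (cmap c' (pthat (q t))) W.1.2).
  by apply: (is_derive_comp DY); apply: dJT'; exists (pthat (q t)).
have DM := is_derive_mulmx (is_derive_mulmx DCX DA) DCY.
have D := is_derive_pair (is_derive_pair DTX DTY) DM.
apply: near_eq_is_derive D.
near=> s.
have cs : cdom c (pt (q s)) by near: s; exact: (cq _ (nbhs_cdom ct)).
have ds : cdom d (pt (q s)) by near: s; exact: (cq _ (nbhs_cdom dt)).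
have cs' : cdom c' (pthat (q s)) by near: s; exact: (cq' _ (nbhs_cdom ct')).
have ds' : cdom d' (pthat (q s)) by near: s; exact: (cq' _ (nbhs_cdom dt')).
rewrite /= [RHS]surjective_pairing; congr pair.
  by rewrite /hom_chart /= /T /T' /= !cinvK.
rewrite (@hom_chart_change c d c' d')// /C /C' /T /= cinvK//.
by rewrite !change_jac.
Unshelve. all: by end_near. Qed.

End HomChart.

Section RollingOde.
Context {R : realType} {n nhat : nat}.
Context {M : manifold R n} {Mhat : manifold R nhat}.
Variables (g : riemannian_metric M) (ghat : riemannian_metric Mhat).

(* With [X0 s] the matrix of the transport from [gamma 0] to [gamma s], read in
   the chart [c], the curve satisfies [X0 s *m a s = ahat s]; this identity is
   differentiated at [0]. *)
Lemma rolling_lift_derive (q0 : hom_point M Mhat) (c : chart R n M)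
    (c' : chart R nhat Mhat) (e : R) gamma gammahat P Phat W :
  let I := `]- e, e[%classic : set R in
  let q s := HomPoint (gamma s) (gammahat s) (P s 0 *m hom q0 *m Phat 0 s) in
  let a := (hom_chart c c' q0).2 in
  atlas c -> atlas c' -> cdom c (pt q0) -> cdom c' (pthat q0) -> 0 < e ->
  smooth_curve I gamma -> gamma 0 = pt q0 ->
  smooth_curve I gammahat -> gammahat 0 = pthat q0 ->
  velocity gammahat 0 = velocity gamma 0 *m hom q0 ->
  parallel_transport g I gamma P -> parallel_transport ghat I gammahat Phat ->
  is_derive 0 (1 : R) (hom_chart c c' \o q) W ->
  exists xi, W = (xi, xi *m a,
    christ_mx g c (cmap c (pt q0)) xi *m a -
    a *m christ_mx ghat c' (cmap c' (pthat q0)) (xi *m a)).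
Proof.
move=> I q a ac ac' cq cq' e0 sg g0 sgh gh0 vel HP HPh DW.
have I0 : I 0 by rewrite /I /= in_itv /= e0 oppr_lt0 e0.
have oI : open I by exact: interval_open.
have cg : cdom c (gamma 0) by rewrite g0.
have cgh : cdom c' (gammahat 0) by rewrite gh0.
have DX : is_derive (0 : R) (1 : R) (cmap c \o gamma) W.1.1.
  exact: is_derive_fst (is_derive_fst DW).
have DY : is_derive (0 : R) (1 : R) (cmap c' \o gammahat) W.1.2.
  exact: is_derive_snd (is_derive_fst DW).
have DA : is_derive (0 : R) (1 : R) (fun s => (hom_chart c c' (q s)).2) W.2.
  exact: is_derive_snd DW.
have xiE : W.1.1 = velocity gamma 0 *m to_chart c (pt q0).
  have [_ <-] := DX; rewrite -g0.
  by have [_ ->] := velocity_in_chart sg I0 ac cg.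
have yE : W.1.2 = W.1.1 *m a.
  have [_ <-] := DY; have [_ ->] := velocity_in_chart sgh I0 ac' cgh.
  rewrite vel gh0 xiE /a /= !mulmxA -(mulmxA (velocity gamma 0) (to_chart c _)).
  by rewrite to_from_chart// mulmx1.
have D1 := parallel_transport_derive (from_chart c (pt q0)) HP I0 I0 ac cg.
have D2 := parallel_transport_derive (from_chart c (pt q0) *m hom q0) HPh I0 I0
  ac' cgh.
have [_ EX] := DX; have [_ EY] := DY.
rewrite EX g0 (HP 0 I0).1 mulmx1 from_to_chart// mul1mx in D1.
rewrite EY gh0 (HPh 0 I0).1 mulmx1 -/a in D2.
have D3 := is_derive_mulmx D1 DA.
have E : \forall s \near (0 : R),
    from_chart c (pt q0) *m P 0 s *m to_chart c (gamma s) *m (hom_chart c c' (q s)).2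
    = from_chart c (pt q0) *m hom q0 *m Phat 0 s *m to_chart c' (gammahat s).
  near=> s.
  have cs : cdom c (gamma s) by near: s; exact: curve_nbhs (sg.1 0 I0) cg.
  have Ps : P 0 s *m P s 0 = 1%:M.
    by near: s; exact: parallel_transport_inverse oI sg HP I0.
  rewrite /=; move: (to_from_chart ac cs) Ps.
  move: (to_chart c (gamma s)) (from_chart c (gamma s)) (P 0 s) (P s 0) => A B C D.
  move: (from_chart c (pt q0)) (to_chart c' (gammahat s)) => A' B' AB CD.
  by rewrite !mulmxA -(mulmxA _ A B) AB mulmx1 -(mulmxA _ C D) CD mulmx1.
have [_ E3] := near_eq_is_derive E D3.
have [_ E2] := D2.
move: E3; rewrite E2 /= g0 gh0 => E3.
exists W.1.1.
rewrite [LHS]surjective_pairing [W.1]surjective_pairing -yE; congr pair.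
move: E3; rewrite (HP 0 I0).1 (HPh 0 I0).1 !mulmx1 from_to_chart// !mul1mx -/a.
rewrite mulNmx => /eqP; rewrite eq_sym addrC subr_eq => /eqP ->.
by rewrite addrC.
Unshelve. all: by end_near. Qed.

(** Velocity and lift are given in the preferred charts at [q t]. The curve realising the lift
    passes through [q t] at time 0 with the same [W], and the change of charts depends on the point
    and [W] only, so [q] has the derivative of that curve in the charts [c] and [c'] too. *)
Lemma rolling_velocity (q : R -> hom_point M Mhat) t W (c : chart R n M)
    (c' : chart R nhat Mhat) :
  let a := (hom_chart c c' (q t)).2 in
  atlas c -> atlas c' ->
  {for t, continuous (fun s : R => pt (q s))} ->
  {for t, continuous (fun s : R => pthat (q s))} ->
  cdom c (pt (q t)) -> cdom c' (pthat (q t)) ->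
  has_velocity q t W -> rolling_distribution g ghat (q t) W ->
  exists xi, is_derive t (1 : R) (hom_chart c c' \o q) (xi, xi *m a,
    christ_mx g c (cmap c (pt (q t))) xi *m a -
    a *m christ_mx ghat c' (cmap c' (pthat (q t))) (xi *m a)).
Proof.
move=> a ac ac' cq cq' ct ct' HV.
move=> [X [e [gamma [gammahat [P [Phat [e0 [sg g0 vg] [sgh gh0 vgh] [HP HPh] HW]]]]]]].
set I := `]- e, e[%classic in sg sgh HP HPh.
have I0 : I 0 by rewrite /I /= in_itv /= e0 oppr_lt0 e0.
pose qt s := HomPoint (gamma s) (gammahat s) (P s 0 *m hom (q t) *m Phat 0 s).
have qt0 : qt 0 = q t.
  rewrite /qt g0 gh0 (HP 0 I0).1 (HPh 0 I0).1 mul1mx mulmx1.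
  by case: (q t).
have [D HD] := derive_hom_chart_change (chart_at_atlas (pt (q t))) ac
  (chart_at_atlas (pthat (q t))) ac'.
have d0 := chart_at_dom (pt (q t)); have d0' := chart_at_dom (pthat (q t)).
have DV := HD q t W cq cq' d0 ct d0' ct' HV.
have HW' : is_derive (0 : R) (1 : R)
    (hom_chart (chart_at (pt (q t))) (chart_at (pthat (q t))) \o qt) W.
  by move: HW; rewrite /has_velocity -/qt /= g0 gh0.
have DW : is_derive (0 : R) (1 : R) (hom_chart c c' \o qt)
    (D (hom_chart (chart_at (pt (q t))) (chart_at (pthat (q t))) (q t)) W).
  have := HD qt 0 W (sg.1 0 I0) (sgh.1 0 I0).
  by rewrite qt0; apply.
have vel : velocity gammahat 0 = velocity gamma 0 *m hom (q t) by rewrite vg.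
have [xi Exi] := rolling_lift_derive ac ac' ct ct' e0 sg g0 sgh gh0 vel HP HPh DW.
by exists xi; rewrite -Exi.
Qed.

End RollingOde.

(** * Totally geodesic immersions *)

Section SubmanifoldCharts.
Context {R : realType} {m nhat : nat} {N : manifold R m} {M : manifold R nhat}.
Variable (f : N -> M).

Definition chart_domain (c : chart R m N) (c' : chart R nhat M) : set 'rV[R]_m :=
  cmap c @` (cdom c `&` f @^-1` cdom c').

Lemma open_chart_domain c c' : continuous f -> open (chart_domain c c').
Proof.
move=> cf; apply: open_cmap_image; apply: open_comp; last exact: cdom_open.
by move=> x _; exact: cf.
Qed.

Lemma in_chart_domain c c' p : cdom c p -> cdom c' (f p) ->
  chart_domain c c' (cmap c p).
Proof. by move=> cp cfp; exists p. Qed.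

Lemma in_chartsE c c' p : cdom c p -> in_charts f c c' (cmap c p) = cmap c' (f p).
Proof. by move=> cp; rewrite /in_charts /= cinvK. Qed.

Hypothesis fs : smooth_map f.

Lemma in_charts_smooth c c' : atlas c -> atlas c' ->
  smooth_on (chart_domain c c') (in_charts f c c').
Proof. exact: fs.2. Qed.

Lemma has_jac_in_charts c c' p : atlas c -> atlas c' -> cdom c p -> cdom c' (f p) ->
  has_jac (in_charts f c c') (cmap c p) (jac (in_charts f c c') (cmap c p)).
Proof.
move=> ac ac' cp cfp; apply: has_jac_jac.
by apply: (in_charts_smooth ac ac' 1).1; exact: in_chart_domain.
Qed.

Lemma jac_in_charts c c' p : atlas c -> atlas c' -> cdom c p -> cdom c' (f p) ->
  jac (in_charts f c c') (cmap c p) =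
    from_chart c p *m differential f p *m to_chart c' (f p).
Proof.
move=> ac ac' cp cfp.
rewrite from_chartE to_chartE /differential jacE.
have ad := chart_at_atlas p; have dp := chart_at_dom p.
have ad' := chart_at_atlas (f p); have dfp := chart_at_dom (f p).
set d := chart_at p in ad dp *; set d' := chart_at (f p) in ad' dfp *.
apply: has_jac_unique.
have h1 := has_jac_transition ac ad cp dp.
have h2 := has_jac_in_charts ad ad' dp dfp.
have h3 := has_jac_transition ad' ac' dfp cfp.
have E1 : (cmap d \o cinv c) (cmap c p) = cmap d p by rewrite /= cinvK.
rewrite -E1 in h2.
have h12 := has_jac_comp h1 h2.
have E2 : (in_charts f d d' \o (cmap d \o cinv c)) (cmap c p) = cmap d' (f p).
  by rewrite /= cinvK// in_chartsE.
rewrite -E2 in h3.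
have := has_jac_comp h12 h3; rewrite E1.
apply: near_eq_has_jac.
have cy : (cmap c @` cdom c) (cmap c p) by exists p.
have N1 : nbhs (cinv c (cmap c p)) (cdom d `&` f @^-1` cdom d').
  rewrite cinvK//; apply: filterI; first exact: nbhs_cdom.
  by apply: fs.1; exact: nbhs_cdom.
have := nbhs_cinv cy N1; apply: filterS => z [cz [dz dfz]].
by rewrite /in_charts /= !cinvK.
Qed.

(** Changes of frame are invertible, so the inclusion of row spaces can be tested in any charts. *)
Lemma submx_in_charts (n : nat) (X : manifold R n) (q : hom_point X M)
    (d : chart R n X) c c' p :
  atlas d -> atlas c -> atlas c' -> cdom d (pt q) -> cdom c p -> cdom c' (f p) ->
  pthat q = f p ->
  (hom q <= differential f p)%MS =
    ((hom_chart d c' q).2 <= jac (in_charts f c c') (cmap c p))%MS.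
Proof.
move=> ad ac ac' dq cp cfp Eq; rewrite jac_in_charts//= Eq.
have := to_from_chart ad dq; have := from_to_chart ad dq.
have := to_from_chart ac cp; have := from_to_chart ac cp.
have := to_from_chart ac' cfp; have := from_to_chart ac' cfp.
move: (to_chart d _) (from_chart d _) (to_chart c _) (from_chart c _)
  (to_chart c' _) (from_chart c' _) => A A' B B' C C' C'C CC' B'B BB' A'A AA'.
apply/idP/idP => /submxP[D E].
  apply/submxP; exists (A' *m D *m B).
  by rewrite E !mulmxA -(mulmxA _ B B') BB' mulmx1.
apply/submxP; exists (A *m D *m B').
have : A *m (A' *m hom q *m C) *m C' = A *m (D *m (B' *m differential f p *m C)) *m C'.
  by rewrite E.
by rewrite !mulmxA -!(mulmxA _ C C') CC' !mulmx1 AA' mul1mx.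
Qed.

Lemma row_free_in_charts c c' p : atlas c -> atlas c' -> cdom c p -> cdom c' (f p) ->
  row_free (differential f p) -> row_free (jac (in_charts f c c') (cmap c p)).
Proof.
move=> ac ac' cp cfp /row_freeP[B DB].
apply/row_freeP; exists (from_chart c' (f p) *m B *m to_chart c p).
rewrite jac_in_charts//.
have := to_from_chart ac' cfp; have := from_to_chart ac cp.
move: (to_chart c _) (from_chart c _) (to_chart c' _) (from_chart c' _)
  => C C' A A' C'C AA'.
by rewrite !mulmxA -(mulmxA _ A A') AA' mulmx1 -(mulmxA _ _ B) DB mulmx1.
Qed.

Variable g : riemannian_metric M.

(** A subspace is determined by its normals: the transposed columns of the cokernel of [J *m G] are
    normal to [J], hence [A *m G] vanishes on that cokernel, and [G] cancels. *)
Lemma submx_of_normal p q (A : 'M[R]_(p, q)) (J : 'M[R]_(m, q)) (G : 'M[R]_q) :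
  G \in unitmx ->
  (forall nu : 'rV[R]_q, J *m G *m nu^T = 0 -> A *m G *m nu^T = 0) ->
  (A <= J)%MS.
Proof.
move=> uG H.
have : (A *m G <= J *m G)%MS.
  rewrite submxE; apply/eqP/matrixP => i k.
  have := mulmx_coker (J *m G); move: (cokermx _) => K JK.
  have := H (col k K)^T; rewrite trmxK colE.
  rewrite (mulmxA (J *m G)) (mulmxA (A *m G)) JK mul0mx => /(_ erefl).
  by rewrite -colE => /matrixP/(_ i 0); rewrite [LHS]mxE => ->; rewrite !mxE.
move=> /submxP[D E]; apply/submxP; exists D.
by rewrite -(mulmxK uG A) E mulmxA mulmxK.
Qed.

(** Vanishing of the second fundamental form against all normals says that the covariant derivative
    of every coordinate field along the submanifold is tangent; the coordinate fields are the rows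
    of the jacobian. *)
Lemma totally_geodesic_submx c c' u X : totally_geodesic g f ->
  atlas c -> atlas c' -> chart_domain c c' u ->
  (('d (jac (in_charts f c c')) u X + jac (in_charts f c c') u *m
      christ_mx g c' (in_charts f c c' u) (X *m jac (in_charts f c c') u))%R
     <= jac (in_charts f c c') u)%MS.
Proof.
move=> tg ac ac' Uu; set F := in_charts f c c'; have [p [cp cfp] pu] := Uu.
have oU := @open_chart_domain c c' fs.1.
have F2 := in_charts_smooth ac ac' 2.
have Fu : F u = cmap c' (f p) by rewrite -pu /F in_chartsE.
have DF Y z : chart_domain c c' z -> 'D_Y F z = Y *m jac F z.
  move=> Uz; have [dF HF] := immersion_has_jac F2 Uz.
  by rewrite deriveE// HF.
have DDF Y : 'D_X ('D_Y F) u = Y *m 'd (jac F) u X.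
  rewrite -(diff_jac X Y oU F2 Uu).
  have [_ dF1] := Ck_onS F2.
  have [_ dF2] := F2; have [dFY _] := dF2 Y.
  rewrite -(deriveE _ (dFY u Uu)); apply: near_eq_derive.
  have : nbhs u (chart_domain c c') by exact: open_nbhs_nbhs.
  apply: filterS => z Uz; have [dF HF] := immersion_has_jac F2 Uz.
  by rewrite deriveE.
have uG : metric_in_chart g c' (cmap c' (f p)) \in unitmx.
  by apply: metric_in_chart_unit => //; exists (f p).
apply/row_subP => i; apply: (submx_of_normal uG) => nu Hnu.
have nuN : normal_vector g f c c' p nu.
  move=> Z; rewrite pu (DF _ _ Uu) -(mulmxA Z) -(mulmxA Z) Hnu mulmx0 mxE //.
have := tg c c' p ac ac' cp cfp nu nuN X (delta_mx 0 i).
rewrite /second_fundamental_form /ambient_derivative christoffel_formE -/F pu.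
rewrite (DF _ _ Uu) (DF _ _ Uu) DDF -(mulmxA (delta_mx 0 i)) -mulmxDr -rowE.
by move=> h; apply/matrixP => a b; rewrite !ord1 h mxE.
Qed.

End SubmanifoldCharts.

(** * Tangency is an open condition along rolling curves *)

Section LocalInvariance.
Context {R : realType}.
Notation mu := (@lebesgue_measure R).

Lemma dist_bounds (x y d : R) : `|x - y| < d -> (y - d <= x) && (x <= y + d).
Proof. by rewrite ltr_norml => /andP[? ?]; apply/andP; split; lra. Qed.

Lemma dist_of_bounds (x y d : R) : 0 < d -> y - d / 2 <= x -> x <= y + d / 2 ->
  `|x - y| < d.
Proof. by move=> d0 ? ?; rewrite ltr_norml; apply/andP; split; lra. Qed.

Lemma within_continuous_near (X : topologicalType) (f : R -> X) (a b t : R)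
    (O : set X) : {within `[a, b], continuous f} -> a <= t <= b -> nbhs (f t) O ->
  exists2 d : R, 0 < d & forall s, a <= s <= b -> `|s - t| < d -> O (f s).
Proof.
move=> /subspace_continuousP cf tab HO.
have := cf t; rewrite /= in_itv /= => /(_ tab) /(_ O HO).
rewrite /= /within /= => /nbhs_normP[d /= d0 H]; exists d => // s sab sd.
by apply: H; rewrite /= ?in_itv// distrC.
Qed.

Lemma within_continuous_interior (X : topologicalType) (f : R -> X) (a b t : R) :
  {within `[a, b], continuous f} -> a < t < b -> {for t, continuous f}.
Proof.
move=> cf /andP[at_ tb] O HO.
have [|d d0 H] := within_continuous_near cf _ HO; first by rewrite !ltW.
apply/nbhs_normP; exists (Num.min d (Num.min (t - a) (b - t))).
  by rewrite /= !lt_min d0 !subr_gt0 at_.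
move=> s; rewrite /= !lt_min => /and3P[sd sa sb].
have s1 := ler_norm (t - s); have s2 := ler_norm (s - t).
rewrite distrC in s2.
by apply: H; [apply/andP; split; lra|rewrite distrC].
Qed.

Context {n nhat m : nat} {M : manifold R n} {Mhat : manifold R nhat}.
Variables (g : riemannian_metric M) (ghat : riemannian_metric Mhat).
Context {N : manifold R m} (iota : N -> Mhat).

Definition tangent_at (q : hom_point M Mhat) (p : N) :=
  iota p = pthat q /\ (hom q <= differential iota p)%MS.

Variables (T : R) (q : R -> hom_point M Mhat).
Hypotheses (acq : abs_continuous_curve T q) (tq : tangent_ae g ghat T q).

(* The equations of motion in a fixed pair of charts. *)
Lemma rolling_ode_ae c c' a b : atlas c -> atlas c' -> 0 <= a -> b <= T ->
  (forall t, a <= t <= b -> cdom c (pt (q t)) /\ cdom c' (pthat (q t))) ->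
  exists E : set R, mu.-negligible E /\ forall t, a <= t <= b -> ~ E t ->
    exists xi, is_derive t (1 : R) (hom_chart c c' \o q)
      (xi, xi *m (hom_chart c c' (q t)).2,
       christ_mx g c (cmap c (pt (q t))) xi *m (hom_chart c c' (q t)).2 -
       (hom_chart c c' (q t)).2 *m christ_mx ghat c' (cmap c' (pthat (q t)))
          (xi *m (hom_chart c c' (q t)).2)).
Proof.
move=> ac ac' a0 bT Hc.
pose B := [set t : R | 0 <= t <= T ->
  exists2 W, has_velocity q t W & rolling_distribution g ghat (q t) W].
(* At 0 and [T] the curve is only known to be continuous from one side, while changing charts in a
   derivative needs both. *)
exists (~` B `|` ([set 0] `|` [set T])); split.
  apply: negligibleU; first exact: tq.
  by apply: negligibleU; exact: negligible_set1.
move=> t tab nE.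
have tT : 0 < t < T.
  move: (tab) => /andP[at_ tb]; rewrite !lt_neqAle (le_trans a0 at_) (le_trans tb bT).
  rewrite !andbT; apply/andP; split; apply/eqP => Et; apply: nE; right.
    by left; rewrite /= -Et.
  by right.
have [W HW HR] : exists2 W, has_velocity q t W & rolling_distribution g ghat (q t) W.
  have Bt : B t by apply: contrapT => nB; apply: nE; left.
  by apply: Bt; case/andP: tT => h1 h2; rewrite !ltW.
have [ct ct'] := Hc t tab.
have [cq1 cq2 _] := acq.
have c1 := within_continuous_interior cq1 tT.
have c2 := within_continuous_interior cq2 tT.
exact: rolling_velocity ac ac' c1 c2 ct ct' HW HR.
Qed.

Lemma curve_in_charts (c : chart R n M) (c' : chart R nhat Mhat) t0 : 0 <= t0 <= T ->
  cdom c (pt (q t0)) -> cdom c' (pthat (q t0)) ->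
  exists2 d : R, 0 < d & forall t, 0 <= t <= T -> `|t - t0| < d ->
    cdom c (pt (q t)) /\ cdom c' (pthat (q t)).
Proof.
move=> t0T ct ct'; have [cq1 cq2 _] := acq.
have [d1 d10 H1] := within_continuous_near cq1 t0T (nbhs_cdom ct).
have [d2 d20 H2] := within_continuous_near cq2 t0T (nbhs_cdom ct').
exists (Num.min d1 d2); first by rewrite lt_min d10.
move=> t tT; rewrite lt_min => /andP[h1 h2].
by split; [exact: H1|exact: H2].
Qed.

Hypotheses (hN : immersed_submanifold iota) (hgeo : totally_geodesic ghat iota).

(** The closeness of [p] to [p0] is part of the conclusion because it cannot be recovered from the
    closeness of their images under an immersion. *)
Lemma tangent_local t0 p0 c r0 : 0 <= t0 <= T -> tangent_at (q t0) p0 ->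
  atlas c -> cdom c p0 -> 0 < r0 ->
  exists2 d : R, 0 < d & forall t, 0 <= t <= T -> `|t - t0| < d ->
    exists p, [/\ cdom c p, `|cmap c p - cmap c p0| < r0 & tangent_at (q t) p].
Proof.
move=> t0T [Ep0 Ap0] ac cp0 r00.
have [_ fs fi] := hN.
pose cM := chart_at (pt (q t0)); pose c' := chart_at (pthat (q t0)).
have aM : atlas cM := chart_at_atlas _. have a' : atlas c' := chart_at_atlas _.
have dM : cdom cM (pt (q t0)) := chart_at_dom _.
have d' : cdom c' (pthat (q t0)) := chart_at_dom _.
have cfp0 : cdom c' (iota p0) by rewrite Ep0.
pose U := chart_domain iota c c'; pose F := in_charts iota c c'.
pose u0 := cmap c p0.
have oU : open U by apply: open_chart_domain; exact: fs.1.
have F2 : Ck_on 2 U F by exact: in_charts_smooth.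
have Uu0 : U u0 by exact: in_chart_domain.
have J0 : row_free (jac F u0) by apply: row_free_in_charts.
have Fu0 : F u0 = cmap c' (pthat (q t0)) by rewrite /F /u0 in_chartsE// Ep0.
have y0im : (cmap c' @` cdom c') (F u0) by rewrite Fu0; exists (pthat (q t0)).
have x0im : (cmap cM @` cdom cM) (cmap cM (pt (q t0))) by exists (pt (q t0)).
have [rG [LG [rG0 LG0 GB GL]]] := christ_mx_local ghat a' y0im.
have [rM [CO [rM0 CO0 GM _]]] := christ_mx_local g aM x0im.
pose h := hom_chart cM c' \o q.
have [e e0 He] := slice_invariance (n := n) (G := christ_mx ghat c')
  oU F2 `|(h t0).2| Uu0 J0 rG0 LG0 r00 CO0 GB
  (fun y w w' => christ_mxB ghat c' y w w') GL
  (fun u X Uu _ => totally_geodesic_submx fs X hgeo ac a' Uu).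
have [d1 d10 Hd1] := curve_in_charts t0T dM d'.
(* On [[a, b]] the curve stays in one pair of charts. It is shrunk below to [[a1, b1]], of length at
   most [2 * d2 / 3 < d2], to make its variation small. *)
pose a := Num.max 0 (t0 - d1 / 2); pose b := Num.min T (t0 + d1 / 2).
have [a0 bT at0 t0b] : [/\ 0 <= a, b <= T, a <= t0 & t0 <= b].
  rewrite /a /b le_max lexx ge_min lexx ge_max le_min.
  by case/andP: t0T => -> ->; split=> //=; lra.
have abd t : a <= t <= b -> (0 <= t <= T) /\ `|t - t0| < d1.
  rewrite /a /b ge_max le_min => /andP[/andP[h1 h2] /andP[h3 h4]].
  split; first by rewrite h1.
  exact: dist_of_bounds.
have Hc t : a <= t <= b -> cdom cM (pt (q t)) /\ cdom c' (pthat (q t)).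
  by move=> /abd[h1 h2]; exact: Hd1.
have ach : abs_continuous_on a b h by have [_ _] := acq; apply.
(* Variation below [e] is what the slice lemma asks for; below [rM] it also keeps x where the
   connection of [M] is bounded by [CO]. *)
have emin0 : 0 < Num.min e rM by rewrite lt_min e0.
have [d2 d20 Hd2] := ac_partition_sum_lt ach emin0.
pose a1 := Num.max a (t0 - d2 / 3); pose b1 := Num.min b (t0 + d2 / 3).
have [aa' b'b a't0 t0b'] : [/\ a <= a1, b1 <= b, a1 <= t0 & t0 <= b1].
  split.
  - by rewrite /a1 le_max lexx.
  - by rewrite /b1 ge_min lexx.
  - by rewrite /a1 (ge_max t0) at0 /=; lra.
  - by rewrite /b1 (le_min t0) t0b /=; lra.
have b'a1 : b1 - a1 < d2.
  have : b1 <= t0 + d2 / 3 by rewrite ge_min lexx orbT.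
  have : t0 - d2 / 3 <= a1 by rewrite le_max lexx orbT.
  lra.
have hvar s t k tau : a1 <= s -> t <= b1 -> partition_of s t k tau ->
    \sum_(i < k) `|h (tau i.+1) - h (tau i)| < Num.min e rM.
  move=> as_ tb Htau; apply: (Hd2 s t) => //.
  - exact: le_trans as_.
  - exact: le_trans b'b.
  - lra.
have hM t : a1 <= t <= b1 -> `|h t - h t0| < rM.
  have key s s' : a1 <= s -> s <= s' -> s' <= b1 -> `|h s' - h s| < rM.
    move=> as_ ss' sb.
    have := hvar s s' 1%N (fun i => if i is 0%N then s else s') as_ sb.
    rewrite big_ord1 /= lt_min => /(_ _)/andP[]//.
    by split=> // -[].
  move=> /andP[at_ tb]; have [tc|ct] := leP t t0; first by rewrite distrC key.
  by apply: key => //; exact: ltW.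
have [E [E0 HE]] := rolling_ode_ae aM a' a0 bT Hc.
have H := He a1 b1 t0 h E.
exists (Num.min (d1 / 2) (d2 / 3)); first by rewrite lt_min !divr_gt0.
move=> t /andP[t1 t2]; rewrite lt_min => /andP[td1 td2].
have tab' : a1 <= t <= b1.
  rewrite /a1 /b1 ge_max le_min /a /b ge_max le_min t1 t2 /=.
  by have /andP[-> ->] := dist_bounds td1; have /andP[-> ->] := dist_bounds td2.
have [||||||||u [ur Uu yu Au]] := H _ _ _ _ _ _ _ _ t tab'.
- by rewrite a't0.
- exact: E0.
- exact: abs_continuous_sub ach aa' b'b.
- by move=> s v k tau s1 s2 /(hvar _ _ _ _ s1 s2)/ltW; rewrite le_min => /andP[].
- by rewrite Fu0.
- by move: Ap0; rewrite (submx_in_charts (d := cM) fs aM ac a' dM cp0 cfp0) ?Ep0.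
- by [].
- move=> s /andP[s1 s2] nEs.
  have [|xi Dxi] := HE s _ nEs; first by rewrite (le_trans aa' s1) (le_trans s2 b'b).
  (* The left coefficient of the equation for [A] is the connection form of [M] along [xi], hence at
     most [CO * |xi|]. *)
  exists xi, (christ_mx g cM (cmap cM (pt (q s))) xi); split=> //.
  apply: GM; have := hM s; rewrite s1 s2 => /(_ isT); apply: le_lt_trans.
  apply: le_trans (fst_norm_le ((h s).1 - (h t0).1)) _.
  exact: fst_norm_le (h s - h t0).
have [p [cp cfp] pu] := Uu.
have tabc : a <= t <= b.
  by case/andP: tab' => h1 h2; rewrite (le_trans aa' h1) (le_trans h2 b'b).
have [cMt c't] := Hc t tabc.
have fp : iota p = pthat (q t).
  rewrite -(cinvK cfp) -(cinvK c't); congr cinv.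
  by have := yu; rewrite /= -pu /F in_chartsE.
exists p; split; [exact: cp|rewrite pu; exact: ur|split; first exact: fp].
have := submx_in_charts fs aM ac a' cMt cp cfp (esym fp).
by rewrite pu => ->; exact: Au.
Qed.

End LocalInvariance.

(** * Tangency is a closed condition along rolling curves *)

Section IntegralBound.
Import HBNNSimple.
Context {R : realType}.
Notation mu := (@lebesgue_measure R).

(* For an arbitrary [f] the integral is the supremum of the integrals of the
   simple functions below [f], and these lie below the constant. *)
Lemma integral_le_cst (f : R -> R) (K : R) :
  (forall t, 0 <= t <= 1 -> 0 <= f t <= K) -> \int[mu]_(t in `[0, 1]) f t <= K.
Proof.
move=> H.
have H' t : `[(0:R), 1]%classic t -> 0 <= f t <= K by rewrite /= in_itv; exact: H.
have K0 : 0 <= K.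
  by have /andP[h1 h2] := H 0 (introT andP (conj (lexx 0) ler01)); exact: le_trans h2.
rewrite /Rintegral.
have le : (\int[mu]_(t in `[0%R, 1%R]) (f t)%:E <= K%:E)%E.
  rewrite ge0_integralE; last by move=> t /H'; rewrite lee_fin => /andP[].
  apply: ub_ereal_sup => _ [h hf <-].
  have hD : (fun t => (h t)%:E) = (fun t => (h t)%:E) \_ `[0%R, 1%R].
    apply/funext => t; rewrite patchE; case: ifPn => // tD.
    have := hf t; rewrite patchE (negbTE tD) lee_fin => h0.
    by congr EFin; apply/eqP; rewrite eq_le h0 fun_ge0.
  rewrite -integralT_nnsfun hD -integral_mkcond.
  have -> : K%:E = (\int[mu]_(t in `[0%R, 1%R]) (cst K%:E t))%E.
    rewrite integral_cst//= lebesgue_measure_itv /= lte_fin ltr01.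
    by rewrite oppr0 adde0 mule1.
  apply: ge0_le_integral => //.
  - by move=> t _; rewrite lee_fin; exact: fun_ge0.
  - apply/measurable_realfun.measurable_EFinP.
    by apply: measurable_funTS; exact: measurable_funP.
  move=> t Dt; apply: le_trans (hf t) _; rewrite patchE mem_set//.
  by have := H' t Dt; rewrite lee_fin => /andP[].
have ge : (0 <= \int[mu]_(t in `[0%R, 1%R]) (f t)%:E)%E.
  by apply: integral_ge0 => t /H'; rewrite lee_fin => /andP[].
by move: le ge; case: integral => // r; rewrite lee_fin.
Qed.

End IntegralBound.

(** * Lengths of segments in a chart of the submanifold *)

Section ImmersionSegment.
Context {R : realType} {m q : nat}.
Variables (U : set 'rV[R]_m) (F : 'rV[R]_m -> 'rV[R]_q).
Hypotheses (oU : open U) (F2 : Ck_on 2 U F).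
Local Notation J := (jac F).

(** A smooth curve has to live on an open interval around [[0, 1]], here []-1, 2[]. End points
    within [r / 8] of the centre keep even the prolonged segment inside the ball. *)
Lemma ball_segment (u0 u u' : 'rV[R]_m) (r s : R) : 0 < r ->
  `|u - u0| < r / 8 -> `|u' - u0| < r / 8 -> -1 < s < 2 ->
  `|u + s *: (u' - u) - u0| < r.
Proof.
move=> r0 ur ur' /andP[s1 s2].
have : `|u' - u| < r / 4.
  have -> : u' - u = (u' - u0) - (u - u0) by rewrite opprB addrA subrK.
  by apply: le_lt_trans (ler_normB _ _) _; lra.
have -> : u + s *: (u' - u) - u0 = (u - u0) + s *: (u' - u) by rewrite addrAC.
move=> w; apply: le_lt_trans (ler_normD _ _) _; rewrite normrZ.
have : `|s| < 2 by rewrite ltr_norml; apply/andP; split; lra.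
have := normr_ge0 s; have := normr_ge0 (u' - u); nra.
Qed.

(** The left side is the image speed of the segment from [u] to [u'], with the jacobian taken at any
    nearby [v]. It differs from [F u' - F u] by errors proportional to [|u' - u|], which the
    immersion bounds by a multiple of [|F u' - F u|]. *)
Lemma immersion_segment u0 : U u0 -> row_free (J u0) -> exists2 r : R, 0 < r &
  (forall u, `|u - u0| < r -> U u) /\
  forall u u' v, `|u - u0| < r -> `|u' - u0| < r -> `|v - u0| < r ->
    `|(u' - u) *m J v| <= 2 * `|F u' - F u|.
Proof.
move=> Uu0 J0.
have [P [r1 [B [_ HA]]]] := adapted_exists oU F2 Uu0 J0 ltr01.
(* The two errors together are at most [(1 + m) * |w| / k], and [|w| <= 2 * q * |P| * |dF|]; this
   [k] brings them below [|dF|]. *)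
pose k : R := (1 + m%:R) * (2 * (q%:R * `|P|)) + 1.
have k0 : 0 < k by rewrite ltr_wpDl// !mulr_ge0// addr_ge0.
have [r2 r20 H2] := immersion_expansion oU F2 Uu0 (divr_gt0 ltr01 k0).
exists (Num.min r1 r2); first by rewrite lt_min (adapted_r HA).
split=> [u|u u' v]; first by rewrite lt_min => /andP[/(adapted_U HA)].
rewrite !lt_min => /andP[u1 u2] /andP[u1' u2'] /andP[v1 v2].
have [_ _ E _] := H2 u u' u2 u2'.
have u00 : `|u0 - u0| < r2 by rewrite subrr normr0.
have [_ _ _ EJ] := H2 u0 v u00 v2.
have w2 := adapted_lipschitz HA u1 u1'.
have wP : `|F u' *m P - F u *m P| <= q%:R * `|F u' - F u| * `|P|.
  by rewrite -mulmxBl; exact: mulmx_le.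
set w := u' - u in E w2 *; set dF := F u' - F u in E wP *.
have -> : w *m J v = dF - (dF - w *m J u0) + w *m (J v - J u0).
  by rewrite subKr mulmxBr addrC subrK.
apply: le_trans (ler_normD _ _) _.
have h1 : `|dF - (dF - w *m J u0)| <= `|dF| + 1 / k * `|w|.
  by apply: le_trans (ler_normB _ _) _; rewrite lerD2l.
have h2 : `|w *m (J v - J u0)| <= m%:R * `|w| * (1 / k) by exact: mulmx_le.
have h3 : (1 + m%:R) * `|w| <= k * `|dF|.
  have : (1 + m%:R) * `|w| <= (1 + m%:R) * (2 * (q%:R * `|dF| * `|P|)).
    by rewrite ler_wpM2l ?addr_ge0//; lra.
  have := normr_ge0 dF; rewrite /k; lra.
have h4 : 1 / k * ((1 + m%:R) * `|w|) <= `|dF|.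
  by rewrite mul1r ler_pdivrMl.
lra.
Qed.

End ImmersionSegment.

Section SubmanifoldSegment.
Context {R : realType} {m nhat : nat} {N : manifold R m} {M : manifold R nhat}.
Variables (f : N -> M) (g : riemannian_metric M).
Hypothesis hf : immersed_submanifold f.

Definition smooth_path_le (p p' : N) (K : R) := exists gamma : R -> N,
  [/\ smooth_curve `]- 1, 1 + 1[ gamma, gamma 0 = p, gamma 1 = p'
    & path_length (induced_metric g f) gamma <= K].

Lemma segment_curve (c : chart R m N) (u w : 'rV[R]_m) (e : R) : atlas c ->
  (forall s, `]- e, 1 + e[%classic s -> (cmap c @` cdom c) (u + s *: w)) ->
  smooth_curve `]- e, 1 + e[ (fun s : R => cinv c (u + s *: w)).
Proof.
move=> ac H.
have D s : differentiable (fun s : R => u + s *: w) s.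
  apply: differentiableD; first exact: differentiable_cst.
  by apply: differentiableZl.
split=> [s Is|d ad].
  apply: (@continuous_comp _ _ _ (fun s : R => u + s *: w) (cinv c)).
    exact: differentiable_continuous.
  exact: cinv_continuous (H s Is).
move=> k.
have oV : open (cmap c @` (cdom c `&` cdom d)).
  by apply: open_cmap_image; exact: cdom_open.
have := Ck_on_affine u w oV (transition_smooth ac ad k).
apply: Ck_on_sub => s [Is ds] /=.
have [cs E] := cmap_cinv (H s Is).
by exists (cinv c (u + s *: w)).
Qed.

(** The straight segment in the chart has speed at most [C] times its coordinate speed in [c'],
    which is at most twice the displacement of the image; its length is bounded by the largest
    speed. *)
Lemma segment_path (p0 : N) (c : chart R m N) (c' : chart R nhat M) (C : R) :
  atlas c -> atlas c' -> cdom c p0 -> cdom c' (f p0) -> 0 <= C ->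
  (\forall y \near cmap c' (f p0), forall v : 'rV[R]_nhat,
     (v *m metric_in_chart g c' y *m v^T) 0 0 <= (C * `|v|) ^+ 2) ->
  exists2 r : R, 0 < r & forall p p', cdom c p -> cdom c p' ->
    `|cmap c p - cmap c p0| < r -> `|cmap c p' - cmap c p0| < r ->
    smooth_path_le p p' (2 * C * `|cmap c' (f p') - cmap c' (f p)|).
Proof.
move=> ac ac' cp0 cfp0 C0 HC; have [_ fs fi] := hf.
pose U := chart_domain f c c'; pose F := in_charts f c c'; pose u0 := cmap c p0.
have oU : open U by apply: open_chart_domain; exact: fs.1.
have F2 : Ck_on 2 U F by exact: in_charts_smooth.
have Uu0 : U u0 by exact: in_chart_domain.
have J0 : row_free (jac F u0) by apply: row_free_in_charts.
have [r1 r10 [HU HJ]] := immersion_segment oU F2 Uu0 J0.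
have cF : {for u0, continuous F}.
  by apply: differentiable_continuous; case: (immersion_has_jac F2 Uu0).
have Fu0 : F u0 = cmap c' (f p0) by rewrite /F /u0 in_chartsE.
rewrite -Fu0 in HC.
have HF : \forall u \near u0, forall v : 'rV[R]_nhat,
    (v *m metric_in_chart g c' (F u) *m v^T) 0 0 <= (C * `|v|) ^+ 2 by exact: cF HC.
have [r2 r20 Hr2] := (nbhs_normP _ _).1 HF.
pose r := Num.min r1 r2.
have r0 : 0 < r by rewrite lt_min r10; exact: r20.
exists (r / 8); first by rewrite divr_gt0.
move=> p p' cp cp' pr pr'.
set u := cmap c p in pr *; set u' := cmap c p' in pr' *.
pose w := u' - u.
pose gamma := fun s : R => cinv c (u + s *: w).
have rr1 v : `|v - u0| < r -> `|v - u0| < r1 by rewrite lt_min => /andP[].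
have Ur v : `|v - u0| < r -> U v by move=> /rr1; exact: HU.
have r8 v : `|v - u0| < r / 8 -> `|v - u0| < r by lra.
have IU s : -1 < s < 2 -> `|u + s *: w - u0| < r by exact: ball_segment.
have Ic s : `]- 1, 1 + 1[%classic s -> (cmap c @` cdom c) (u + s *: w).
  rewrite /= in_itv /= => s12; have [|x [cx _] <-] := Ur (u + s *: w).
    exact: IU.
  by exists x.
have sg : smooth_curve `]- 1, 1 + 1[ gamma by exact: segment_curve.
have FE x : cdom c x -> F (cmap c x) = cmap c' (f x) by exact: in_chartsE.
exists gamma; split=> //.
- by rewrite /gamma scale0r addr0 cinvK.
- by rewrite /gamma scale1r /w addrC subrK cinvK.
apply: integral_le_cst => t /andP[t0 t1].
have t12 : -1 < t < 2 by apply/andP; split; lra.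
have It : `](- 1 : R), 1 + 1[%classic t by rewrite /= in_itv.
have [x [cx cfx] xE] := Ur _ (IU t t12).
have gt : gamma t = x by rewrite /gamma -xE cinvK.
have cgt : cdom c (gamma t) by rewrite gt.
have vE : velocity gamma t *m to_chart c (gamma t) = w.
  have [_ <-] := velocity_in_chart sg It ac cgt.
  have D : is_derive t (1 : R) (fun s : R => u + s *: w) w.
    apply: is_derive_of_increment => e e0; exists 1 => // h _.
    by rewrite scalerDl addrA (addrC _ (h *: w)) addrK subrr normr0 mulr_ge0// ltW.
  have E : \forall s \near t, u + s *: w = (cmap c \o gamma) s.
    have : \forall s \near t, s \in `](- 1 : R), 1 + 1[.
      by apply: near_in_itvoo; rewrite in_itv.
    by apply: filterS => s Is; have [_ /= ->] := cmap_cinv (Ic s Is).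
  by have [_ ->] := near_eq_is_derive E D.
rewrite sqrtr_ge0 /=.
have -> : inner (induced_metric g f) (gamma t) (velocity gamma t) (velocity gamma t)
    = (w *m jac F (u + t *: w) *m metric_in_chart g c' (F (u + t *: w))
        *m (w *m jac F (u + t *: w))^T) 0 0.
  rewrite -xE FE// /metric_in_chart cinvK// jac_in_charts// -vE gt.
  have := to_from_chart ac cx; have := to_from_chart ac' cfx.
  rewrite /inner /induced_metric.
  move: (to_chart c _) (from_chart c _) (to_chart c' _) (from_chart c' _)
    => A A' B B' BB' AA'.
  rewrite !trmx_mul !mulmxA -(mulmxA _ A A') AA' mulmx1.
  rewrite -(mulmxA _ B B') BB' mulmx1.
  rewrite -(mulmxA _ B'^T) -trmx_mul BB' trmx1 mulmx1.
  by rewrite -(mulmxA _ A'^T) -trmx_mul AA' trmx1 mulmx1.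
have wJ : `|w *m jac F (u + t *: w)| <= 2 * `|F u' - F u|.
  by apply: HJ; apply: rr1; [exact: r8|exact: r8|exact: IU].
have ur2 : `|u0 - (u + t *: w)| < r2.
  by have := IU t t12; rewrite distrC lt_min => /andP[].
have := Hr2 _ ur2 (w *m jac F (u + t *: w)).
move=> h; apply: le_trans (ler_wsqrtr h) _.
rewrite sqrtr_sqr ger0_norm ?mulr_ge0// -mulrA mulrCA ler_wpM2l//.
by rewrite -(FE p cp) -(FE p' cp').
Qed.

End SubmanifoldSegment.

Section Distance.
Context {R : realType} {n : nat} {M : manifold R n}.
Variable g : M -> 'M[R]_n.

Lemma joined_ge0 x y l : joined g x y l -> 0 <= l.
Proof.
elim=> // {x y l} x y l gamma e _ l0 _ _ _; rewrite addr_ge0//.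
by apply: Rintegral_ge0 => t _; exact: sqrtr_ge0.
Qed.

Lemma joined_trans x y z l l' : joined g x y l -> joined g y z l' ->
  joined g x z (l + l').
Proof.
move=> xy yz; elim: yz xy => [{}y xy|{y z l'} y z l' gamma e _ IH e0 sg g0 xy].
  by rewrite addr0.
by rewrite addrA; apply: joined_step (IH xy) e0 sg g0.
Qed.

Lemma riemannian_distance_le x y l : joined g x y l -> riemannian_distance g x y <= l.
Proof.
move=> xyl; apply: ge_inf => //.
by exists 0 => k /joined_ge0.
Qed.

End Distance.

Section MetricBound.
Context {R : realType} {n : nat} {M : manifold R n}.
Variable g : riemannian_metric M.

Lemma metric_local_bound c y0 : atlas c -> (cmap c @` cdom c) y0 ->
  exists C r : R, [/\ 0 <= C, 0 < r & forall y (v : 'rV[R]_n), `|y - y0| < r ->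
    (v *m metric_in_chart g c y *m v^T) 0 0 <= (C * `|v|) ^+ 2].
Proof.
move=> ac cy0; have [r r0 [_ [B [_ B0 _ HB]]]] := loclip_metric g ac cy0.
(* [k <= (k + 1)^2] for [k >= 0] puts the bound in the form of a square, ready for the square root
   in the length. *)
exists (n%:R * n%:R * B + 1), r.
have C0 : 0 <= n%:R * n%:R * B :> R by rewrite !mulr_ge0.
split=> //; first by rewrite addr_ge0.
move=> y v yr; have {}HB := HB y yr.
move: (metric_in_chart g c y) HB => G HB.
apply: le_trans (ler_norm _) _; apply: le_trans (mx_entry_le _ _ _) _.
apply: le_trans (mulmx3_norm _ _ _) _; rewrite trmx_norm.
have v0 := normr_ge0 v.
apply: (@le_trans _ _ (n%:R * n%:R * B * (`|v| * `|v|))).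
  rewrite (_ : _ * `|v| = n%:R * n%:R * `|G| * (`|v| * `|v|)); last by ring.
  by rewrite ler_wpM2r ?mulr_ge0// ler_wpM2l// mulr_ge0.
rewrite exprMn !expr2 ler_wpM2r ?mulr_ge0//.
by move: (n%:R * n%:R * B) C0 => k k0; nra.
Qed.

End MetricBound.

(** With [P] a right inverse of [J], the coefficients [D] in [A' = D *m J'] equal
    [A' *m P *m invmx (J' *m P)] and stay bounded, so the residual [A - A *m P *m J] is arbitrarily
    small. *)
Lemma submx_limit (R : realType) n m q (J : 'M[R]_(m, q)) (A : 'M[R]_(n, q)) :
  row_free J ->
  (forall e : R, 0 < e -> exists J' A', [/\ `|J' - J| < e, `|A' - A| < e &
     (A' <= J')%MS]) -> (A <= J)%MS.
Proof.
move=> /row_freeP[P JP] H.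
have [r [B [r0 B0 HB]]] := @invmx_near R m 1%:M (unitmx1 _ _).
suff : A = A *m P *m J by move=> ->; exact: submxMl.
apply/subr0_eq/eqP; rewrite -normr_le0; apply/ler_addgt0Pr => e e0; rewrite add0r.
pose a := `|A| + 1; pose j := `|J| + 1; pose p : R := `|P|.
pose qp : R := q%:R * p.
(* D = A' P (J' P)^-1 is bounded *)
pose b := m%:R * (q%:R * a * p) * B.
(* The sum of the coefficients of [d] in the four error terms below. *)
pose k := 1 + m%:R * m%:R * b * qp * j + q%:R * m%:R * p * j
  + q%:R * m%:R * a * p.
have [a0 j0 p0] : [/\ 0 <= a, 0 <= j & 0 <= p].
  by split; [exact: addr_ge0|exact: addr_ge0|exact: normr_ge0].
have k0 : 0 < k + 1 by rewrite ltr_wpDl// !(addr_ge0, mulr_ge0).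
have qp0 : 0 < qp + 1 by rewrite ltr_wpDl// mulr_ge0.
pose d := Num.min (Num.min 1 (r / (qp + 1))) (e / (k + 1)).
have d0 : 0 < d by rewrite !lt_min ltr01 !divr_gt0.
have [J' [A' [HJ HA AJ]]] := H d d0.
have [d1 dr de] : [/\ d <= 1, d * (qp + 1) <= r & d * (k + 1) <= e].
  have := lexx d; rewrite {2}/d !le_min => /andP[/andP[-> h2] h3].
  by rewrite -!ler_pdivlMr.
have Aa : `|A'| <= a.
  rewrite -(subrK A A') addrC; apply: le_trans (ler_normD _ _) _.
  by rewrite lerD2l; apply: le_trans (ltW HA) d1.
have Jj : `|J'| <= j.
  rewrite -(subrK J J') addrC; apply: le_trans (ler_normD _ _) _.
  by rewrite lerD2l; apply: le_trans (ltW HJ) d1.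
have HJP : `|1%:M - J' *m P| <= qp * d.
  rewrite -JP -mulmxBl -(opprB J') mulNmx normrN.
  by apply: le_trans (mulmx_le (ltW HJ) (lexx _)) _; rewrite /qp mulrAC.
have [uK KB] : J' *m P \in unitmx /\ `|invmx (J' *m P)| <= B.
  apply: HB; rewrite distrC; apply: le_lt_trans HJP _.
  by apply: lt_le_trans dr; rewrite mulrC ltr_pM2l// ltrDl.
have [D AE] := submxP AJ.
have DE : D = A' *m P *m invmx (J' *m P).
  by rewrite AE -(mulmxA D) mulmxK.
have Db : `|D| <= b.
  by rewrite DE; apply: mulmx_le => //; apply: mulmx_le.
(* Every summand carries one of the small factors [A - A'], [J' - J] and [1%:M - J' *m P]. *)
have -> : A - A *m P *m J = (A - A') + D *m (1%:M - J' *m P) *m J' +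
    (A' *m P *m (J' - J) - (A - A') *m P *m J).
  rewrite mulmxBr mulmx1 mulmxBl -AE mulmxA -AE mulmxBr !mulmxBl.
  move: (A' *m P *m J') (A' *m P *m J) (A *m P *m J) => X Y Z.
  apply/matrixP => i l; rewrite !mxE; ring.
apply: le_trans (ler_normD _ _) _.
apply: (@le_trans _ _ (d * (k + 1))) => //.
have t1 : `|A - A' + D *m (1%:M - J' *m P) *m J'| <=
    d + m%:R * (m%:R * b * (qp * d)) * j.
  apply: le_trans (ler_normD _ _) _; apply: lerD; first by rewrite distrC ltW.
  by apply: mulmx_le => //; exact: mulmx_le.
have t2 : `|A' *m P *m (J' - J) - (A - A') *m P *m J| <=
    m%:R * (q%:R * a * p) * d + m%:R * (q%:R * d * p) * j.
  apply: le_trans (ler_normB _ _) _; apply: lerD.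
    by apply: mulmx_le; [exact: mulmx_le|exact: ltW].
  apply: mulmx_le; last by rewrite lerDl.
  by apply: mulmx_le => //; rewrite distrC ltW.
apply: le_trans (lerD t1 t2) _.
rewrite -subr_ge0 (_ : _ - _ = d); first exact: ltW.
by rewrite /k; ring.
Qed.

Section TangentClosed.
Context {R : realType} {n nhat m : nat} {M : manifold R n} {Mhat : manifold R nhat}.
Variables (g : riemannian_metric M) (ghat : riemannian_metric Mhat).
Context {N : manifold R m} (iota : N -> Mhat).
Local Notation gN := (induced_metric ghat iota).
Local Notation path_le := (smooth_path_le iota ghat).

Lemma increasing_approach (a b : R) : a < b -> exists s : nat -> R,
  [/\ forall k, a <= s k < b, forall i j, (i <= j)%N -> s i <= s j
    & forall d, 0 < d -> exists K, forall k, (K <= k)%N -> b - s k < d].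
Proof.
move=> ab; have ba : 0 < b - a by rewrite subr_gt0.
exists (fun k => b - (b - a) / k.+1%:R); split.
- move=> k; rewrite ltrBlDr ltrDl divr_gt0// andbT lerBrDl -lerBrDr.
  by rewrite ler_pdivrMr// ler_peMr ?(ltW ba)// ler1n.
- move=> i j ij; rewrite lerD2l lerN2 ler_pM2l// lef_pV2 ?posrE//.
  by rewrite ler_nat.
move=> d d0; exists (Num.bound ((b - a) / d)) => k Kk.
rewrite opprB addrC subrK ltr_pdivrMr// mulrC -ltr_pdivrMr//.
apply: lt_le_trans (archi_boundP _) _; first by rewrite divr_ge0// ltW.
by rewrite ler_nat ltnW.
Qed.

Lemma smooth_path_joined p p' K : path_le p p' K ->
  exists2 l, joined gN p p' l & l <= K.
Proof.
move=> [gamma [sg g0 <- lK]]; exists (0 + path_length gN gamma).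
  by apply: joined_step (joined_refl _ _) ltr01 sg g0.
by rewrite add0r.
Qed.

(** Both orders are carried along, since [joined] prolongs paths at their end only and the Cauchy
    condition compares points in either order. *)
Lemma chain_distance_le k (x : nat -> N) (K : nat -> R) :
  (forall i, (i < k)%N -> path_le (x i) (x i.+1) (K i) /\ path_le (x i.+1) (x i) (K i)) ->
  riemannian_distance gN (x 0%N) (x k) <= \sum_(i < k) K i /\
  riemannian_distance gN (x k) (x 0%N) <= \sum_(i < k) K i.
Proof.
move=> H; suff [[l j le] [l' j' le']] :
    (exists2 l, joined gN (x 0%N) (x k) l & l <= \sum_(i < k) K i) /\
    (exists2 l, joined gN (x k) (x 0%N) l & l <= \sum_(i < k) K i).
  by split; apply: le_trans (riemannian_distance_le _) _; eassumption.
elim: k H => [|k IH] H.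
  by split; exists 0; rewrite ?big_ord0//; exact: joined_refl.
have [|[l j le] [l' j' le']] := IH; first by move=> i ik; apply: H; exact: ltnW.
have [/smooth_path_joined[l1 j1 le1] /smooth_path_joined[l2 j2 le2]] := H k (ltnSn k).
rewrite big_ord_recr /=; split.
  by exists (l + l1); [exact: joined_trans j j1|exact: lerD].
by exists (l2 + l'); [exact: joined_trans j2 j'|rewrite addrC; exact: lerD].
Qed.

Variables (T : R) (q : R -> hom_point M Mhat).
Hypotheses (acq : abs_continuous_curve T q) (tq : tangent_ae g ghat T q).
Hypotheses (hN : immersed_submanifold iota) (hgeo : totally_geodesic ghat iota).
Hypothesis (hNcomplete : complete_metric gN).
Local Notation tangent := (tangent_at iota).

(** Around each time [tangent_local] provides tangent points close to [p x], and injectivity of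
    [iota] identifies them with the chosen [p y]. Hence neighbouring points are joined by segments,
    and Cousin's lemma chains these over the interval. *)
Lemma tangent_path_le (c' : chart R nhat Mhat) (C a t1 : R) (p : R -> N) :
  0 <= a -> t1 <= T -> atlas c' -> 0 <= C ->
  (forall t, a <= t < t1 -> cdom c' (pthat (q t)) /\ tangent (q t) (p t) /\
    \forall y \near cmap c' (pthat (q t)), forall v : 'rV[R]_nhat,
     (v *m metric_in_chart ghat c' y *m v^T) 0 0 <= (C * `|v|) ^+ 2) ->
  forall s t, a <= s -> s <= t -> t < t1 -> exists k tau, partition_of s t k tau /\
    forall i, (i < k)%N ->
    let l := 2 * C * `|cmap c' (pthat (q (tau i.+1))) - cmap c' (pthat (q (tau i)))| in
    path_le (p (tau i)) (p (tau i.+1)) l /\ path_le (p (tau i.+1)) (p (tau i)) l.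
Proof.
move=> a0 t1T ac' C0 H s t as_ st tt1.
pose E s t := let l := 2 * C * `|cmap c' (pthat (q t)) - cmap c' (pthat (q s))| in
    path_le (p s) (p t) l /\ path_le (p t) (p s) l.
apply: (@cousin_partition R s t E st) => x /andP[sx xt].
have axt : a <= x < t1 by rewrite (le_trans as_ sx) (le_lt_trans xt tt1).
have xT : 0 <= x <= T.
  by case/andP: axt => h1 h2; rewrite (le_trans a0 h1) (le_trans (ltW h2) t1T).
have [c'x [Tx HC]] := H x axt; have [Ex _] := Tx.
pose c := chart_at (p x).
have ac : atlas c := chart_at_atlas _. have cp : cdom c (p x) := chart_at_dom _.
have [||r r0 Hr] := segment_path (p0 := p x) (g := ghat) hN ac ac' cp _ C0.
- by rewrite Ex.
- by rewrite Ex.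
have [d d0 Hd] := tangent_local acq tq hN hgeo xT Tx ac cp r0.
have iN y : s <= y <= t -> iota (p y) = pthat (q y) /\ 0 <= y <= T.
  move=> /andP[sy yt]; have ayt : a <= y < t1.
    by rewrite (le_trans as_ sy) (le_lt_trans yt tt1).
  have [_ [[Ey _] _]] := H y ayt; split; first exact: Ey.
  by case/andP: ayt => h1 h2; rewrite (le_trans a0 h1) (le_trans (ltW h2) t1T).
have key y : s <= y <= t -> `|y - x| < d ->
    cdom c (p y) /\ `|cmap c (p y) - cmap c (p x)| < r.
  move=> syt yd; have [Ey yT] := iN y syt.
  have [p' [cp' p'r [Ep' _]]] := Hd y yT yd.
  have inj : injective iota by case: hN.
  by have -> : p y = p' by apply: inj; rewrite Ep' Ey.
have xx : cdom c (p x) /\ `|cmap c (p x) - cmap c (p x)| < r by rewrite subrr normr0.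
have Eyx y y' : s <= y <= t -> s <= y' <= t -> `|y - x| < d -> `|y' - x| < d -> E y y'.
  move=> sy sy' /(key y sy)[cy ry] /(key y' sy')[cy' ry'].
  have [Ey _] := iN y sy; have [Ey' _] := iN y' sy'.
  have h1 := Hr _ _ cy cy' ry ry'; have h2 := Hr _ _ cy' cy ry' ry.
  rewrite Ey Ey' in h1 h2; rewrite distrC in h2.
  by split; [exact: h1|exact: h2].
have sxt : s <= x <= t by rewrite sx.
have dxx : `|x - x| < d by rewrite subrr normr0.
exists d => //; split=> y yb /andP[y1 y2]; apply: Eyx => //.
- by rewrite yb (le_trans y2 xt).
- by rewrite ltr_norml; apply/andP; split; lra.
- by rewrite yb (le_trans sx y1).
- by rewrite ltr_norml; apply/andP; split; lra.
Qed.

(** The distance from [p s] to [p t] is at most [2 * C] times the variation of the chart reading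
    between [s] and [t], which absolute continuity makes small near [t1]. At the limit point the
    position follows by continuity and the inclusion by [submx_limit]. *)
Lemma tangent_closed t1 : 0 < t1 <= T ->
  (forall s, 0 <= s < t1 -> exists p, tangent (q s) p) -> exists p, tangent (q t1) p.
Proof.
move=> /andP[t10 t1T] Hs.
have [p Hp] : exists p : R -> N, forall t, 0 <= t < t1 -> tangent (q t) (p t).
  have [p0 _] := @manifold_nonempty _ _ N.
  have /choice[p Hp] : forall t, exists v, 0 <= t < t1 -> tangent (q t) v.
    move=> t; case: (pselect (0 <= t < t1)) => [/Hs[v Hv]|nt]; first by exists v.
    by exists p0.
  by exists p.
have t1T' : 0 <= t1 <= T by rewrite (ltW t10).
pose cM := chart_at (pt (q t1)); pose c' := chart_at (pthat (q t1)).
have aM : atlas cM := chart_at_atlas _. have a' : atlas c' := chart_at_atlas _.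
have dM : cdom cM (pt (q t1)) := chart_at_dom _.
have d' : cdom c' (pthat (q t1)) := chart_at_dom _.
pose h := hom_chart cM c' \o q; pose Y t := cmap c' (pthat (q t)).
have y0im : (cmap c' @` cdom c') (Y t1) by exists (pthat (q t1)).
have [C [rG [C0 rG0 HC]]] := metric_local_bound ghat a' y0im.
have [d1 d10 Hd1] := curve_in_charts acq t1T' dM d'.
pose a0 := Num.max 0 (t1 - d1 / 2).
have a00 : 0 <= a0 by rewrite le_max lexx.
have a0t : a0 < t1 by rewrite gt_max t10; lra.
have Hc t : a0 <= t <= t1 -> cdom cM (pt (q t)) /\ cdom c' (pthat (q t)).
  rewrite ge_max => /andP[/andP[h1 h2] h3]; apply: Hd1.
    by rewrite h1 (le_trans h3).
  by rewrite ltr_norml; apply/andP; split; lra.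
have ach : abs_continuous_on a0 t1 h by have [_ _] := acq; apply.
have hsum e : 0 < e -> exists2 d, 0 < d & forall s t k tau, a0 <= s -> t <= t1 ->
    t - s < d -> partition_of s t k tau ->
    \sum_(i < k) `|h (tau i.+1) - h (tau i)| < e.
  by move=> e0; exact: ac_partition_sum_lt.
have hcont e : 0 < e -> exists2 d, 0 < d & forall t, a0 <= t <= t1 -> t1 - t < d ->
    `|h t1 - h t| < e.
  move=> /hsum[d d0 Hd]; exists d => // t /andP[at_ tt1] td.
  have := Hd t t1 1%N (fun i => if i is 0%N then t else t1) at_ (lexx _) td.
  by rewrite big_ord1; apply; split=> // -[].
have Yh s t : `|Y t - Y s| <= `|h t - h s|.
  apply: le_trans (snd_norm_le ((h t).1 - (h s).1)) _.
  exact: fst_norm_le (h t - h s).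
have [d2 d20 Hd2] := hcont _ rG0.
pose a := Num.max a0 (t1 - d2 / 2).
have a0a : a0 <= a by rewrite le_max lexx.
have at1 : a < t1 by rewrite gt_max a0t; lra.
have aYr t : a <= t < t1 -> `|Y t1 - Y t| < rG.
  rewrite ge_max => /andP[/andP[h1 h2] h3]; apply: le_lt_trans (Yh _ _) (Hd2 t _ _).
    by rewrite h1 ltW.
  lra.
have Hpath := @tangent_path_le c' C a t1 p (le_trans a00 a0a) t1T a' C0.
have {}Hpath s t : a <= s -> s <= t -> t < t1 -> _ := Hpath _ s t.
have {}Hpath s t : a <= s -> s <= t -> t < t1 -> exists k tau, partition_of s t k tau /\
    forall i, (i < k)%N ->
    let l := 2 * C * `|Y (tau i.+1) - Y (tau i)| in
    path_le (p (tau i)) (p (tau i.+1)) l /\ path_le (p (tau i.+1)) (p (tau i)) l.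
  apply: Hpath => x /andP[ax xt1].
  have [|_ cx] := Hc x; first by rewrite (le_trans a0a ax) ltW.
  split; first exact: cx.
  split; first by apply: Hp; rewrite (le_trans a00 (le_trans a0a ax)).
  have := aYr x; rewrite ax xt1 => /(_ isT) xr.
  apply/nbhs_normP; exists (rG - `|Y t1 - Y x|); first by rewrite /= subr_gt0.
  move=> y /= yr v; apply: HC; rewrite distrC.
  rewrite -(subrK (Y x) (Y t1)) -addrA; apply: le_lt_trans (ler_normD _ _) _; lra.
have dist e : 0 < e -> exists2 d, 0 < d & forall s t, a <= s -> s <= t -> t < t1 ->
    t1 - s < d -> riemannian_distance gN (p s) (p t) < e /\
      riemannian_distance gN (p t) (p s) < e.
  move=> e0; have C1 : 0 < 2 * C + 1 by lra.
  have [d d0 Hd] := hsum _ (divr_gt0 e0 C1); exists d => // s t as_ st tt1 sd.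
  have [k [tau [Htau HE]]] := Hpath s t as_ st tt1.
  have [tau0 tauk _] := Htau.
  have := chain_distance_le HE; rewrite tau0 tauk.
  have le : \sum_(i < k) 2 * C * `|Y (tau i.+1) - Y (tau i)| < e.
    have st_d : t - s < d by lra.
    have := Hd s t k tau (le_trans a0a as_) (ltW tt1) st_d Htau.
    rewrite ltr_pdivlMr// => sume; apply: le_lt_trans sume.
    rewrite -mulr_sumr mulrC.
    have S0 : 0 <= \sum_(i < k) `|h (tau i.+1) - h (tau i)| by rewrite sumr_ge0.
    have : \sum_(i < k) `|Y (tau i.+1) - Y (tau i)|
        <= \sum_(i < k) `|h (tau i.+1) - h (tau i)| by apply: ler_sum.
    move: (\sum_(i < k) _) S0 => S S0; move: (\sum_(i < k) _) => S' le.
    apply: le_trans (_ : S * (2 * C) <= _); first by rewrite ler_wpM2r// mulr_ge0.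
    by rewrite ler_wpM2l// lerDl.
  by move=> [h1 h2]; split; [exact: le_lt_trans h1 le|exact: le_lt_trans h2 le].
have [s [sab smono slim]] := increasing_approach at1.
have [pl upl] : exists x : N, (fun k => p (s k)) @ \oo --> x.
  apply: (hNcomplete (u := fun k => p (s k))) => e /dist[d d0 Hd]; have [K HK] := slim d d0.
  exists K => i j Ki Kj; have [si1 si2] := andP (sab i); have [sj1 sj2] := andP (sab j).
  have [ij|ji] := leqP i j.
    by have [] := Hd (s i) (s j) si1 (smono _ _ ij) sj2 (HK i Ki).
  by have [] := Hd (s j) (s i) sj1 (smono _ _ (ltnW ji)) si2 (HK j Kj).
have spT k : tangent (q (s k)) (p (s k)).
  apply: Hp; have /andP[h1 h2] := sab k.
  by rewrite (le_trans a00 (le_trans a0a h1)).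
have [_ fs fi] := hN.
have Epl : iota pl = pthat (q t1).
  (* Along the sequence of times the positions converge both to the image of the limit point and to
     the position at [t1]. *)
  apply: (@manifold_hausdorff _ _ Mhat) => A B HA HB.
  have HA' : nbhs pl (iota @^-1` A) by exact: fs.1.
  have [K1 _ HK1] := upl _ HA'.
  have [_ cq2 _] := acq.
  have [d d0 Hd] := within_continuous_near cq2 t1T' HB.
  have [K2 HK2] := slim d d0.
  have h1 := HK1 (maxn K1 K2) (leq_maxl _ _).
  have h2 := HK2 (maxn K1 K2) (leq_maxr _ _).
  exists (pthat (q (s (maxn K1 K2)))); split.
    by have [<- _] := spT (maxn K1 K2).
  have /andP[s1 s2] := sab (maxn K1 K2).
  apply: Hd; first by rewrite (le_trans a00 (le_trans a0a s1)) (le_trans (ltW s2) t1T).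
  by rewrite ltr_norml; apply/andP; split; lra.
exists pl; split; first exact: Epl.
pose c := chart_at pl.
have ac : atlas c := chart_at_atlas _. have cp : cdom c pl := chart_at_dom _.
have cfp : cdom c' (iota pl) by rewrite Epl.
rewrite (submx_in_charts fs aM ac a' dM cp cfp (esym Epl)).
pose F := in_charts iota c c'.
have F2 : Ck_on 2 (chart_domain iota c c') F by exact: in_charts_smooth.
have oU : open (chart_domain iota c c') by apply: open_chart_domain; exact: fs.1.
have cJ : {for cmap c pl, continuous (jac F)}.
  apply: differentiable_continuous.
  by apply: (Ck_on_jac oU F2).1; exact: in_chart_domain.
apply: submx_limit; first exact: row_free_in_charts.
move=> e e0.
have Nc : nbhs (iota pl) (cdom c') by exact: nbhs_cdom.
have N1 : nbhs pl [set x | [/\ cdom c x, cdom c' (iota x) &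
    `|jac F (cmap c x) - jac F (cmap c pl)| < e]].
  have B : nbhs (jac F (cmap c pl)) [set X | `|X - jac F (cmap c pl)| < e].
    move: (jac F (cmap c pl) : 'M[R]_(m, nhat)) => J0.
    by apply/(@nbhs_normP _ 'M[R]_(m, nhat)); exists e => // X /=; rewrite distrC.
  have h1 : nbhs pl (cmap c @^-1` (jac F @^-1` [set X | `|X - jac F (cmap c pl)| < e])).
    by apply: (cmap_continuous cp); exact: cJ B.
  have h2 : nbhs pl (iota @^-1` cdom c') by exact: fs.1.
  by near=> x; split; near: x; [exact: nbhs_cdom|exact: h2|exact: h1].
have [K1 _ HK1] := upl _ N1.
have [d d0 Hd] := hcont e e0; have [K2 HK2] := slim d d0.
pose k := maxn K1 K2.
have [ck cfk Jk] := HK1 k (leq_maxl _ _); have sk := HK2 k (leq_maxr _ _).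
have /andP[s1 s2] := sab k.
have sa0 : a0 <= s k <= t1 by rewrite (le_trans a0a s1) ltW.
exists (jac F (cmap c (p (s k)))), (h (s k)).2; split; first exact: Jk.
  rewrite distrC; apply: le_lt_trans (Hd _ sa0 sk).
  exact: snd_norm_le (h t1 - h (s k)).
have [Ek Ak] := spT k; have [cMk _] := Hc _ sa0.
by rewrite -(submx_in_charts fs aM ac a' cMk ck cfk (esym Ek)).
Unshelve. all: by end_near. Qed.

End TangentClosed.

(** * Points that cannot be joined *)

Section Invariance.
Context {R : realType} {n nhat m : nat} {M : manifold R n} {Mhat : manifold R nhat}.
Variables (g : riemannian_metric M) (ghat : riemannian_metric Mhat).
Context {N : manifold R m} (iota : N -> Mhat).
Variables (T : R) (q : R -> hom_point M Mhat).
Hypotheses (T0 : 0 < T) (acq : abs_continuous_curve T q) (tq : tangent_ae g ghat T q).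

Lemma tangent_invariant : immersed_submanifold iota -> totally_geodesic ghat iota ->
  complete_metric (induced_metric ghat iota) ->
  (exists p, tangent_at iota (q 0) p) -> exists p, tangent_at iota (q T) p.
Proof.
move=> hN hgeo hNc H0.
suff : forall t, 0 <= t <= T -> exists p, tangent_at iota (q t) p.
  by apply; rewrite lexx ltW.
apply: real_induction => //.
  move=> t /andP[t0 tT] [p0 Hp0].
  have tT' : 0 <= t <= T by rewrite t0 ltW.
  have [d d0 Hd] := tangent_local acq tq hN hgeo tT' Hp0 (chart_at_atlas p0)
    (chart_at_dom p0) ltr01.
  exists d => // s /andP[ts std] sT.
  have [||p [_ _ Hp]] := Hd s; last by exists p.
    by rewrite (le_trans t0 ts).
  by rewrite ltr_norml; apply/andP; split; lra.
by move=> t tT Hs; apply: (tangent_closed acq tq hN hgeo hNc tT).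
Qed.

(** For [n = 0] the matrix A is empty and cannot separate tangent from non-tangent points, so
    position is used instead. The equations of motion have zero right side, and an absolutely
    continuous curve with zero derivative almost everywhere is constant. *)
Lemma rolling_of_point : n = 0%N -> pthat (q T) = pthat (q 0).
Proof.
move=> n0.
have loc t0 : 0 <= t0 <= T -> exists2 d, 0 < d & forall t, 0 <= t <= T ->
    `|t - t0| < d -> pthat (q t) = pthat (q t0).
  move=> t0T.
  pose cM := chart_at (pt (q t0)); pose c' := chart_at (pthat (q t0)).
  have aM : atlas cM := chart_at_atlas _. have a' : atlas c' := chart_at_atlas _.
  have dM : cdom cM (pt (q t0)) := chart_at_dom _.
  have d' : cdom c' (pthat (q t0)) := chart_at_dom _.
  have [d d0 Hd] := curve_in_charts acq t0T dM d'.
  exists d => // t tT td.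
  have const a b : 0 <= a -> a <= b -> b <= T ->
      (forall s, a <= s <= b -> `|s - t0| < d) -> pthat (q a) = pthat (q b).
    move=> a0 ab bT Hab.
    have Hc s : a <= s <= b -> cdom cM (pt (q s)) /\ cdom c' (pthat (q s)).
      move=> sab; apply: Hd; last exact: Hab.
      by case/andP: sab => h1 h2; rewrite (le_trans a0 h1) (le_trans h2).
    have ach : abs_continuous_on a b (hom_chart cM c' \o q) by have [_ _] := acq; apply.
    have [E [E0 HE]] := rolling_ode_ae acq tq aM a' a0 bT Hc.
    have H0 : `|(hom_chart cM c' \o q) b - (hom_chart cM c' \o q) a| <= 0 * 0.
      (* With a constant clock and [K = 0] the increment estimate says that the increment
         vanishes. *)
      apply: (ac_increment_le (w := cst 0 : R -> R) ab _ ach E0) => //; last first.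
        by move=> k tau _; rewrite big1// => i _; rewrite /= subrr normr0.
      move=> s /HE/[apply] -[xi D]; eexists; exists 0; split; [exact: D| |].
        exact: is_derive_cst.
      have z p (X : 'M[R]_(n, p)) : X = 0.
        by apply/matrixP => i; have := ltn_ord i; rewrite {2}n0.
      have xi0 : xi = 0.
        by apply/rowP => i; have := ltn_ord i; rewrite {2}n0.
      by rewrite xi0 mul0mx (z _ (_ - _)) mul0r normr0.
    have E' : cmap c' (pthat (q b)) = cmap c' (pthat (q a)).
      have : `|cmap c' (pthat (q b)) - cmap c' (pthat (q a))| <= 0 * 0.
        apply: le_trans H0; set h := hom_chart cM c' \o q.
        apply: le_trans (fst_norm_le (h b - h a)).
        exact: snd_norm_le ((h b).1 - (h a).1).
      move: (cmap c' _) (cmap c' _) => y y'.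
      by rewrite mul0r normr_le0 subr_eq0 => /eqP.
    have [_ ca] : cdom cM (pt (q a)) /\ cdom c' (pthat (q a)) by apply: Hc; rewrite lexx.
    have [_ cb] : cdom cM (pt (q b)) /\ cdom c' (pthat (q b)) by apply: Hc; rewrite lexx ab.
    by rewrite -(cinvK ca) -(cinvK cb) E'.
  have [ht|ht] := leP t t0.
    apply: const => //; first by case/andP: tT.
      by case/andP: t0T.
    move=> s /andP[h1 h2]; move: td; rewrite !ltr_norml => /andP[h3 h4].
    by apply/andP; split; lra.
  apply/esym/const; [by case/andP: t0T|exact: ltW|by case/andP: tT|].
  move=> s /andP[h1 h2]; move: td; rewrite !ltr_norml => /andP[h3 h4].
  by apply/andP; split; lra.
suff : forall t, 0 <= t <= T -> pthat (q t) = pthat (q 0).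
  by apply; rewrite lexx ltW.
apply: real_induction => // t /andP[h1 h2].
  move=> Et; have [|d d0 Hd] := loc t; first by rewrite h1 ltW.
  exists d => // s /andP[s1 s2] sT; rewrite -Et; apply: Hd.
    by rewrite (le_trans h1 s1).
  by rewrite ltr_norml; apply/andP; split; lra.
move=> Hs; have [|d d0 Hd] := loc t; first by rewrite ltW.
pose s := Num.max 0 (t - d / 2).
have [s0 ts st] : [/\ 0 <= s, t - d / 2 <= s & s < t].
  by rewrite /s !le_max !lexx orbT gt_max h1; split=> //=; lra.
rewrite -(Hs s) ?s0//; apply/esym/Hd; first by rewrite s0 (le_trans (ltW st)).
by rewrite ltr_norml; apply/andP; split; lra.
Qed.

End Invariance.

(** * Orthonormal frames and isometric maps with prescribed range *)

Section Orthonormal.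
Context {R : realType}.

Definition posdef k (G : 'M[R]_k) :=
  G^T = G /\ forall v : 'rV[R]_k, v != 0 -> 0 < (v *m G *m v^T) 0 0.

Lemma posdef_row_free k l (G : 'M[R]_k) (D : 'M[R]_(l, k)) : posdef G -> row_free D ->
  posdef (D *m G *m D^T).
Proof.
move=> [sG pG] fD; split=> [|v v0]; first by rewrite !trmx_mul trmxK sG mulmxA.
rewrite !mulmxA -(mulmxA _ D^T) -trmx_mul; apply: pG.
by apply: contra v0; rewrite -(mul0mx _ D) => /eqP/(row_free_inj fD) ->.
Qed.

(** The [l] linear conditions have rank at most [l < k], which leaves a nonzero kernel. *)
Lemma exists_orthogonal k l (G : 'M[R]_k) (D : 'M[R]_(l, k)) : (l < k)%N ->
  exists2 v : 'rV[R]_k, v != 0 & D *m G *m v^T = 0.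
Proof.
move=> lk; pose K := kermx (D *m G)^T.
have K0 : K != 0.
  rewrite -mxrank_eq0 mxrank_ker subn_eq0 -ltnNge.
  exact: leq_ltn_trans (rank_leq_col _) lk.
exists (nz_row K); first by rewrite nz_row_eq0.
have : nz_row K *m (D *m G)^T = 0 by apply/sub_kermxP; exact: nz_row_sub.
by move=> /(congr1 trmx); rewrite trmx_mul trmxK trmx0.
Qed.

Lemma extend_orthonormal k l (G : 'M[R]_k) (A : 'M[R]_(l, k)) (v : 'rV[R]_k) :
  posdef G -> A *m G *m A^T = 1%:M -> v != 0 -> A *m G *m v^T = 0 ->
  exists c : R, col_mx (c *: v) A *m G *m (col_mx (c *: v) A)^T = 1%:M.
Proof.
move=> [sG pG] AA v0 Av; have vv := pG v v0.
exists (Num.sqrt ((v *m G *m v^T) 0 0))^-1; set c := _^-1.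
rewrite tr_col_mx mul_col_mx mul_col_row AA [RHS]scalar_mx_block.
have -> : (c *: v)^T = c *: v^T by rewrite linearZ.
rewrite -!scalemxAr Av scaler0 -!scalemxAl.
have -> : v *m G *m A^T = 0.
  by apply: trmx_inj; rewrite !trmx_mul trmxK sG mulmxA Av trmx0.
rewrite !scaler0 scalerA (mx11_scalar (v *m G *m v^T)) scale_scalar_mx.
by rewrite -expr2 exprVn sqr_sqrtr ?ltW// mulVf ?gt_eqF.
Qed.

(** Built one row at a time: each new row is taken from the orthogonal complement of the previous
    ones and normalised. *)
Lemma exists_orthonormal k l (G : 'M[R]_k) : posdef G -> (l <= k)%N ->
  exists A : 'M[R]_(l, k), A *m G *m A^T = 1%:M.
Proof.
move=> pG; elim: l => [_|l IH lk].
  by exists 0; apply/matrixP => -[].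
have [A AA] := IH (ltnW lk); have [v v0 Av] := exists_orthogonal G A lk.
have [c Hc] := extend_orthonormal pG AA v0 Av.
by exists (col_mx (c *: v) A : 'M[R]_(1 + l, k)).
Qed.

(* The range of the second isometry contains a vector orthogonal to [D]. *)
Lemma exists_isometries n m k (G : 'M[R]_n.+1) (Gh : 'M[R]_k) (D : 'M[R]_(m, k)) :
  posdef G -> posdef Gh -> row_free D -> (n < m)%N -> (m < k)%N ->
  exists A A' : 'M[R]_(n.+1, k), [/\ A *m Gh *m A^T = G, A' *m Gh *m A'^T = G,
    (A <= D)%MS & ~~ (A' <= D)%MS].
Proof.
move=> pG pGh fD nm mk.
have [B BB] := exists_orthonormal pG (leqnn n.+1).
have uB : B \in unitmx by move: BB; rewrite -mulmxA => /mulmx1_unit[].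
(* [B] is an orthonormal frame for [G]; the map sending it to an orthonormal frame [E] for [Gh] is
   an isometry. *)
have iso (E : 'M[R]_(n.+1, k)) : E *m Gh *m E^T = 1%:M ->
    (invmx B *m E) *m Gh *m (invmx B *m E)^T = G.
  move=> EE; rewrite trmx_mul !mulmxA -(mulmxA (invmx B)) -(mulmxA (invmx B)) EE mulmx1.
  apply: (can_inj (mulKmx uB)); rewrite mulKVmx//.
  have uBT : B^T \in unitmx by rewrite unitmx_tr.
  by apply: (can_inj (mulmxK uBT)); rewrite BB -trmx_mul mulmxV ?trmx1.
have pD := posdef_row_free pGh fD.
(* [C] gives [n + 1] orthonormal vectors inside the row space of [D], [C0] only [n]; the missing one
   is supplied by the normal [v]. *)
have [C CC] := exists_orthonormal pD nm.
have [C0 CC0] := exists_orthonormal pD (ltnW nm).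
have [v v0 Dv] := exists_orthogonal Gh D mk.
have CD0 : (C0 *m D) *m Gh *m (C0 *m D)^T = 1%:M by rewrite -CC0 trmx_mul !mulmxA.
have CDv : (C0 *m D) *m Gh *m v^T = 0 by rewrite -!mulmxA (mulmxA D) Dv mulmx0.
have [c EE] := extend_orthonormal pGh CD0 v0 CDv.
set E' := col_mx _ _ in EE.
exists (invmx B *m (C *m D)), (invmx B *m (E' : 'M[R]_(1 + n, k))); split.
- by apply: iso; rewrite -CC trmx_mul !mulmxA.
- exact: iso.
- by rewrite mulmxA submxMl.
apply/negP => AD; have : (E' <= D)%MS.
  by rewrite -[E'](mulKVmx uB); apply: submx_trans AD; exact: submxMl.
rewrite col_mx_sub => /andP[/submxP[X vX] _].
(* The first row of the frame has length 1. If it lay in the row space of [D], to which it is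
   orthogonal, its length would also be 0. *)
have := congr1 ulsubmx EE; rewrite tr_col_mx mul_col_mx mul_col_row block_mxKul.
rewrite [in X in X *m _ = _]vX linearZ /= -scalemxAr -!mulmxA (mulmxA D) Dv mulmx0 scaler0.
rewrite [in RHS]scalar_mx_block block_mxKul => /matrixP/(_ 0 0); rewrite !mxE.
by move/eqP; rewrite eq_sym oner_eq0.
Qed.

End Orthonormal.

Section Endpoints.
Context {R : realType}.

Lemma metric_posdef n (M : manifold R n) (g : riemannian_metric M) x : posdef (g x).
Proof. by split=> [|v /(metric_pos g x)]; first exact: metric_sym. Qed.

Lemma isometry_in_Q n nhat (M : manifold R n) (Mhat : manifold R nhat)
    (g : riemannian_metric M) (ghat : riemannian_metric Mhat) x xhat
    (A : 'M[R]_(n, nhat)) :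
  A *m ghat xhat *m A^T = g x -> Q g ghat (HomPoint x xhat A).
Proof. by move=> E X Y; rewrite /inner /= -E trmx_mul !mulmxA. Qed.

Lemma exists_distinct_points nhat (Mhat : manifold R nhat) : (0 < nhat)%N ->
  exists x y : Mhat, x <> y.
Proof.
case: nhat Mhat => // nhat Mhat _; have [x _] := @manifold_nonempty _ _ Mhat.
pose c := chart_at x; have cx : cdom c x := chart_at_dom _.
have : nbhs (cmap c x) (cmap c @` cdom c).
  by apply: open_nbhs_nbhs; split; [exact: cimage_open|exists x].
move=> /nbhs_normP[r /= r0 Hr].
pose y : 'rV[R]_nhat.+1 := cmap c x + const_mx (r / 2).
have r2 : `|const_mx (r / 2) : 'rV[R]_nhat.+1| < r.
  apply: le_lt_trans (_ : r / 2 < r); last by rewrite ltr_pdivrMr// ltr_pMr// ltr1n.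
  apply: mx_norm_le => [|i j]; first by rewrite divr_ge0// ltW.
  by rewrite mxE ger0_norm// divr_ge0// ltW.
have [z cz zE] : (cmap c @` cdom c) y by apply: Hr; rewrite /= distrC /y addrC addKr.
exists x, z => xz; have : (const_mx (r / 2) : 'rV[R]_nhat.+1) = 0.
  by apply: (addrI (cmap c x)); rewrite addr0 -/y -zE xz.
by move=> /matrixP/(_ 0 0)/eqP; rewrite !mxE gt_eqF// divr_gt0.
Qed.

End Endpoints.

Theorem proposition5p11 (R : realType) (n nhat m : nat)
  (M : manifold R n) (Mhat : manifold R nhat)
  (g : riemannian_metric M) (ghat : riemannian_metric Mhat)
  (o : M -> bool) (ohat : Mhat -> bool)
  (ho : is_orientation o) (hohat : is_orientation ohat)
  (hg : complete_metric g) (hghat : complete_metric ghat)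
  (hn : (n < nhat)%N)
  (hnm : (n <= m)%N) (hm : (m < nhat)%N)
  (N : manifold R m) (iota : N -> Mhat)
  (hN : immersed_submanifold iota)
  (hgeo : totally_geodesic ghat iota)
  (hNcomplete : complete_metric (induced_metric ghat iota)) :
  ~ completely_controllable g ghat.
Proof.
move=> ctrl; have [x _] := @manifold_nonempty _ _ M.
case: n M g o {ho} hg hn hnm x ctrl => [|n] M g _ _ hn hnm x ctrl.
  have [y [z yz]] := exists_distinct_points Mhat hn.
  have inQ xhat : Q g ghat (HomPoint x xhat 0).
    by apply: isometry_in_Q; apply/matrixP => -[].
  have [T [q [T0 [q0 qT] _ acq tq]]] := ctrl _ _ (inQ y) (inQ z).
  by have := rolling_of_point T0 acq tq erefl; rewrite q0 qT => /esym.
have [p _] := @manifold_nonempty _ _ N; have [inj _ fi] := hN.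
(* Both end configurations sit over the same pair [x], [iota p] and differ only in the range of the
   isometry. *)
have [A [A' [AG A'G AD A'D]]] := exists_isometries (metric_posdef g x)
  (metric_posdef ghat (iota p)) (fi p) hnm hm.
have [T [q [T0 [q0 qT] _ acq tq]]] := ctrl _ _ (isometry_in_Q AG) (isometry_in_Q A'G).
have [|p' []] := tangent_invariant T0 acq tq hN hgeo hNcomplete.
  by exists p; rewrite q0.
(* Injectivity of [iota] forces the tangency point at the end to be [p] again, where the range of
   [A'] is not tangent. *)
by rewrite qT /= => /inj -> /(negP A'D).
Qed.
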